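(* Let $\lambda_1^*,\lambda_2^*,\mu_1^*,\mu_2^*,\omega_1^2,\omega_2^2>0$, $\eta_1>0$, $p\in[0,1]$, and let $\eta_2=0$. Set $\beta_i=\lambda_i^*-\mu_i^*$. For all $t>0$ and $y,x\in\mathbb{R}^+_0$, the probability densities $f_i(x,t)=\frac{d}{dx}\mathbb{P}\{X(t)<x,\mathscr{E}(t)=i\}$ of ${\bf X}(t)$, with initial state $(y,1)$ with probability $p$ and $(y,2)$ with probability $1-p$, satisfy $$f_1(x,t)=p\,e^{-\eta_1t}\,\widehat r^{(1)}(x,t|y),$$ $$f_2(x,t)=(1-p)\,\widehat r^{(2)}(x,t|y)+p\,\eta_1\int_0^{+\infty}dz\int_0^t\widehat r^{(1)}(z,\tau|y)\,e^{-\eta_1\tau}\,\widehat r^{(2)}(x,t-\tau|z)\,d\tau,$$ where, for $i=1,2$, $$\widehat r^{(i)}(x,t|y)=\frac{1}{\sqrt{2\pi\omega_i^2t}}\Biggl[\exp\biggl\{-\frac{(x-y-\beta_it)^2}{2\omega_i^2t}\biggr\}+\exp\biggl\{-\frac{2\beta_iy}{\omega_i^2}\biggr\}\exp\biggl\{-\frac{(x+y-\beta_it)^2}{2\omega_i^2t}\biggr\}\Biggr]-\frac{\beta_i}{\omega_i^2}\exp\biggl\{\frac{2\beta_ix}{\omega_i^2}\biggr\}\,\mathrm{Erfc}\biggl(\frac{x+y+\beta_it}{\sqrt{2\omega_i^2t}}\biggr).$$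
   Context: $\mathbb R_0^+=[0,\infty)$ and $\mathrm{Erfc}(x)=\frac{2}{\sqrt\pi}\int_x^{+\infty}e^{-z^2}dz$. $\{{\bf X}(t)=[X(t),\mathscr{E}(t)],\,t\ge0\}$ is the alternating Wiener process with state space $\mathbb{R}^+_0\times\{1,2\}$ in the case $\eta_2=0$: the environment $\mathscr{E}(t)$ switches from $1$ to $2$ at rate $\eta_1$ and never from $2$ to $1$, and while $\mathscr{E}(t)=i$ the component $X(t)$ evolves as a Wiener process with drift $\lambda_i^*-\mu_i^*$ and infinitesimal variance $\omega_i^2$, with a reflecting boundary at $0$. The densities satisfy, for $x>0$, $t>0$, $$\frac{\partial f_1}{\partial t}=-(\lambda_1^*-\mu_1^* )\frac{\partial f_1}{\partial x}+\frac{\omega_1^2}{2}\frac{\partial^2f_1}{\partial x^2}-\eta_1f_1,\qquad \frac{\partial f_2}{\partial t}=-(\lambda_2^*-\mu_2^* )\frac{\partial f_2}{\partial x}+\frac{\omega_2^2}{2}\frac{\partial^2f_2}{\partial x^2}+\eta_1f_1,$$ with the reflecting conditions $\lim_{x\to0^+}\bigl[(\lambda_i^*-\mu_i^* )f_i-\frac{\omega_i^2}{2}\frac{\partial f_i}{\partial x}\bigr]=0$ ($i=1,2$), the initial conditions $\lim_{t\downarrow0}f_1(x,t)=p\,\delta(x-y)$, $\lim_{t\downarrow0}f_2(x,t)=(1-p)\,\delta(x-y)$ ($\delta$ the Dirac delta), and $\int_0^\infty(f_1+f_2)\,dx=1$. The function $\widehat r^{(i)}(x,t|y)$ is the transition density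 of the Wiener process with drift $\beta_i$ and infinitesimal variance $\omega_i^2$ on $[0,+\infty)$ with $0$ a reflecting boundary. *)

(* Defs.v *)
From HB Require Import structures.
From mathcomp Require Import all_boot all_order all_algebra.
From mathcomp Require Import all_classical all_reals all_analysis.

Set Implicit Arguments.
Unset Strict Implicit.
Unset Printing Implicit Defensive.

Import Order.TTheory GRing.Theory Num.Theory.
Import numFieldNormedType.Exports.

Local Open Scope classical_set_scope.
Local Open Scope ring_scope.

Inductive env := env1 | env2.

(* All processes are indexed by R; only the times t >= 0 are constrained. *)

(* sigma(B_u, 0 <= u, u in D) *)
Definition generated_by {T : Type} {R : realType} (D : set R)
    (B : R -> T -> R) : set (set T) :=
  <<s [set G | exists u, exists A : set R,
         [/\ 0 <= u, D u, measurable A & G = B u @^-1` A] ]>>.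

Record brownian_motion {d : measure_display} {T : measurableType d}
    {R : realType} (P : probability T R) (B : R -> T -> R) : Prop := {
  bm_measurable : forall t : R, 0 <= t -> measurable_fun setT (B t) ;
  bm_start : forall w, B 0 w = 0 ;
  bm_continuous : forall w, {within `[0, +oo[, continuous (B ^~ w)} ;
  bm_gaussian : forall (s t : R) (A : set R), 0 <= s -> s < t -> measurable A ->
    P [set w | A (B t w - B s w)] = normal_prob 0 (Num.sqrt (t - s)) A ;
  bm_independent : forall (s t : R) (G : set T) (A : set R),
    0 <= s -> s < t -> generated_by `[0, s] B G -> measurable A ->
    P (G `&` [set w | A (B t w - B s w)]) =
      (P G * P [set w | A (B t w - B s w)%R])%E }.

(* Two-state Markov environment whose only jumps are 1 -> 2, at rate eta1:
   started in 1 it stays there for an exponential holding time S, started in 2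
   it never moves. *)
Record environment {d : measure_display} {T : measurableType d}
    {R : realType} (P : probability T R) (eta1 p : R)
    (E : R -> T -> env) (S : T -> R) : Prop := {
  env_measurable : forall (t : R) i, 0 <= t -> measurable [set w | E t w = i] ;
  env_initial : P [set w | E 0 w = env1] = p%:E ;
  env_holding_measurable : measurable_fun setT S ;
  env_holding_law : forall A : set R, measurable A ->
    P (S @^-1` A) = exponential_prob eta1 A ;
  env_path : forall (t : R) w, 0 <= t ->
    (E t w = env1 <-> E 0 w = env1 /\ t < S w) }.

(* sigma(B), sigma(E_0) and sigma(S) are mutually independent. *)
Definition independent_sources {d : measure_display} {T : measurableType d}
    {R : realType} (P : probability T R) (B : R -> T -> R)
    (E : R -> T -> env) (S : T -> R) : Prop :=
  forall (G : set T) (i : env) (A : set R),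
    generated_by setT B G -> measurable A ->
    P (G `&` [set w | E 0 w = i] `&` S @^-1` A) =
      (P G * P [set w | E 0%R w = i] * P (S @^-1` A))%E.

(* Weak-solution form of the alternating Wiener process on [0, +oo[ with drift
   beta i and infinitesimal variance omega2 i in environment i.  Reflection at 0
   is the Skorokhod problem: the regulator L pushes X upwards and increases only
   when X = 0.  While the environment is constantly i on [s, t[, this reads
   dX = beta i dt + sqrt (omega2 i) dB + dL. *)
Record alternating_wiener {d : measure_display} {T : measurableType d}
    {R : realType} (P : probability T R) (beta omega2 : env -> R)
    (eta1 p y : R) (B : R -> T -> R) (S : T -> R) (L : R -> T -> R)
    (X : R -> T -> R) (E : R -> T -> env) : Prop := {
  aw_brownian : brownian_motion P B ;
  aw_environment : environment P eta1 p E S ;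
  aw_independent : independent_sources P B E S ;
  aw_measurable : forall t : R, 0 <= t -> measurable_fun setT (X t) ;
  aw_continuous : forall w, {within `[0, +oo[, continuous (X ^~ w)} ;
  aw_start : forall w, X 0 w = y ;
  aw_ge0 : forall (t : R) w, 0 <= t -> 0 <= X t w ;
  aw_increment : forall w (s t : R) i, 0 <= s -> s <= t ->
    (forall u, s <= u < t -> E u w = i) ->
    X t w - X s w = beta i * (t - s)
      + Num.sqrt (omega2 i) * (B t w - B s w) + (L t w - L s w) ;
  aw_regulator_start : forall w, L 0 w = 0 ;
  aw_regulator_nondecreasing : forall w (s t : R), 0 <= s -> s <= t ->
    L s w <= L t w ;
  aw_regulator_flat : forall w (s t : R), 0 <= s -> s <= t ->
    (forall u, s <= u <= t -> 0 < X u w) -> L s w = L t w }.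

Definition joint_cdf {d : measure_display} {T : measurableType d}
    {R : realType} (P : probability T R) (X : R -> T -> R) (E : R -> T -> env)
    (i : env) (t x : R) : R :=
  fine (P [set w | X t w < x /\ E t w = i]).

(* v is the derivative of F at x relative to the half-line [0, +oo[: the usual
   two-sided derivative if x > 0, the right derivative if x = 0. *)
Definition has_density_at {R : realType} (F : R -> R) (x v : R) : Prop :=
  (fun h => h^-1 * (F (x + h) - F x)) @ within [set h | 0 <= x + h] 0^' --> v.

Definition erfc {R : realType} (x : R) : R :=
  2 / Num.sqrt pi * \int[lebesgue_measure]_(z in `[x, +oo[) expR (- z ^+ 2).

(* The closed form of the transition density, at x after time t from y, of the
   Wiener process with drift b and infinitesimal variance s2 reflected at 0. *)
Definition rhat {R : realType} (b s2 x t y : R) : R :=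
  (Num.sqrt (2 * pi * s2 * t))^-1 *
    (expR (- ((x - y - b * t) ^+ 2 / (2 * s2 * t)))
     + expR (- (2 * b * y / s2)) * expR (- ((x + y - b * t) ^+ 2 / (2 * s2 * t))))
  - b / s2 * expR (2 * b * x / s2) * erfc ((x + y + b * t) / Num.sqrt (2 * s2 * t)).

(* Main.v *)
(** While the environment stays constant, [X] is the Skorokhod reflection at [0]
of a drifted Brownian path, so the law of [X t] follows from that of a
reflected path.  Such a path is the limit of Lindley chains
[C_(k+1) = max (C_k + increment) 0], whose distribution functions satisfy
[F_(k+1) = gop h F_k] on the positive half-line and vanish on the negative one,
[gop h] being convolution with the Gaussian kernel of variance [v h].  The
method of images gives an exact solution of this boundary problem,
[gop s F - gop s (tilt F)] with [tilt F u = e^(2 b u / v) F (- u)], because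
[gop s (tilt F) x = e^(2 b x / v) gop s F (- x)]; an induction squeezes the
chain between this solution and its translate by [e], up to an error that is
negligible against the number of steps.  For a deterministic start the limit is
the combination [rcdf] of two [erfc] terms, with [x]-derivative [rhat].

The holding time is independent of the Brownian motion.  Rounded up to a grid
it only produces deterministic switches, and [X t] is continuous in the switching
time, so the law after the switch is the exponential mixture of the laws with
a deterministic switch.  Since [rhat] is [O ((t - tau)^(-1/2))], the mixture can be
differentiated under the integral, and Fubini gives the stated double integral. *)

From HB Require Import structures.
Require Import Defs.
From mathcomp Require Import all_boot all_order all_algebra.
From mathcomp Require Import all_classical all_reals all_analysis.
From mathcomp Require Import measurable_realfun.
From mathcomp Require Import ring lra.

Set Implicit Arguments.
Unset Strict Implicit.
Unset Printing Implicit Defensive.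

Import Order.TTheory GRing.Theory Num.Theory.
Import numFieldNormedType.Exports.
Local Open Scope classical_set_scope.
Local Open Scope ring_scope.

(** * Gaussian kernels and the method of images *)

(** The squeeze rests on a sign. If [F] vanishes on the negative half-line,
    [gop s F - gop s (tilt F)] is nonnegative for [x >= 0] and nonpositive for [x <= 0]. Chain
    distribution functions vanish for [x <= 0], so there they dominate this solution, and
    monotonicity of [gop] propagates the comparison: the lower bound has no error term. For the
    upper bound, the translate by [e] is still nonnegative on [[- e, 0]], and below [- e] its
    deficit is at most an exponential. One step of variance [v * h] carries only [o(h)] of that
    deficit to the positive half-line, so [n] steps of length [s / n] accumulate a vanishing error.
    The comparisons are written as sums rather than differences, since the functions take extended
    real values. Positivity of [rhat] and the bound on its mass are not derived from the formula:
    they are read off the probability that it computes. *)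

Section gaussian_kernel.
Context {R : realType}.
Local Notation leb := (@lebesgue_measure R).

Lemma affine_preimage_pos (a c p q : R) : 0 < c ->
  (fun z => a + c * z) @^-1` `]p, q] = `](p - a) / c, (q - a) / c]%classic.
Proof.
move=> c0; apply/seteqP; split => z /=;
  by rewrite !in_itv/= ltr_pdivrMr// ler_pdivlMr// ltrBlDr lerBrDr ![z * c]mulrC
     ![_ * _ + a]addrC.
Qed.

Lemma affine_preimage_neg (a c p q : R) : c < 0 ->
  (fun z => a + c * z) @^-1` `]p, q] = `[(q - a) / c, (p - a) / c[%classic.
Proof.
move=> c0; apply/seteqP; split => z /=;
  by rewrite !in_itv/= ltr_ndivlMr// ler_ndivrMr// ltrBlDr lerBrDr ![z * c]mulrC
     ![_ * _ + a]addrC andbC.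
Qed.

Lemma measurable_affine (a c : R) (D : set R) :
  measurable_fun D (fun z : R => a + c * z).
Proof. by apply: measurable_funD => //; exact: measurable_funM. Qed.

(** Scaled by the modulus of [c], the pushforward of Lebesgue measure along the affine map gives
    every interval []p, q]] its length, and these intervals determine the measure. *)
Lemma lebesgue_measure_affine (a c : R) (A : set R) : c != 0 -> measurable A ->
  leb A = (`|c|%:E * leb ((fun z => a + c * z)%R @^-1` A))%E.
Proof.
move=> c0 mA.
pose phi := (fun z => a + c * z) : measurableTypeR R -> measurableTypeR R.
have mphi : measurable_fun setT phi by exact: measurable_affine.
pose k : {nonneg R} := NngNum (normr_ge0 c).
rewrite (@lebesgue_measure_unique _ (mscale k (pushforward leb phi)))//.
move=> _ [[p q]] _ <-; rewrite /mscale /pushforward/= /mscale /phi /=.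
have [c_gt0|c_lt0] : 0 < c \/ c < 0 by case: (ltgtP c 0) c0 => //; auto.
- rewrite [X in (_ * X)%E](_ : _ = leb `](p - a) / c, (q - a) / c]%classic); last first.
    by rewrite -affine_preimage_pos.
  rewrite !lebesgue_measure_itv/= !lte_fin ltr_pM2r ?invr_gt0//.
  rewrite ltrD2r; case: ifPn => _; last by rewrite mule0.
  rewrite -!EFinD -EFinM; congr EFin; rewrite gtr0_norm//.
  by rewrite mulrBr ![c * _]mulrC !divfK ?gt_eqF//; ring.
- rewrite [X in (_ * X)%E](_ : _ = leb `[(q - a) / c, (p - a) / c[%classic); last first.
    by rewrite -affine_preimage_neg.
  rewrite !lebesgue_measure_itv/= !lte_fin ltr_nM2r ?invr_lt0//.
  rewrite ltrD2r; case: ifPn => _; last by rewrite mule0.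
  rewrite -!EFinD -EFinM; congr EFin; rewrite ltr0_norm//.
  by rewrite mulrBr !mulNr ![c * _]mulrC !divfK ?lt_eqF//; ring.
Qed.

Lemma integral_affine (a c : R) (f : R -> \bar R) : c != 0 ->
  measurable_fun setT f -> (forall x, 0 <= f x)%E ->
  (\int[leb]_x f x = `|c|%:E * \int[leb]_x f (a + c * x)%R)%E.
Proof.
move=> c0 mf f0.
pose phi := (fun z => a + c * z) : measurableTypeR R -> measurableTypeR R.
have mphi : measurable_fun setT phi by exact: measurable_affine.
pose k : {nonneg R} := NngNum (normr_ge0 c).
have -> : (\int[leb]_x f (a + c * x)%R)%E = (\int[pushforward leb phi]_x f x)%E.
  by rewrite ge0_integral_pushforward.
rewrite -[`|c|%:E]/(k%:num%:E) -ge0_integral_mscale//.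
by apply: eq_measure_integral => A mA _; exact: (lebesgue_measure_affine a c0 mA).
Qed.

(** Centred Gaussian density indexed by its variance, the parameter that adds up under
    convolution. *)
Definition gker (c w : R) : R :=
  (Num.sqrt (2 * pi * c))^-1 * expR (- (w ^+ 2 / (2 * c))).

Lemma gker_ge0 c w : 0 <= gker c w.
Proof. by rewrite mulr_ge0 ?expR_ge0// invr_ge0. Qed.

Lemma gker_normal_pdf c m x : 0 < c -> gker c (x - m) = normal_pdf m (Num.sqrt c) x.
Proof.
move=> c0; rewrite normal_pdfE ?gt_eqF ?sqrtr_gt0//.
rewrite /normal_peak /normal_fun /gker sqr_sqrtr ?ltW//; congr (_^-1 * expR _).
  by congr Num.sqrt; rewrite -mulr_natr; ring.
by rewrite mulNr mulr_natl.
Qed.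

Lemma measurable_gker c : measurable_fun setT (gker c).
Proof.
apply: measurable_funM => //; apply: measurableT_comp => //.
by apply: measurable_funN; apply: measurable_funM => //; exact: measurable_funX.
Qed.

Lemma gkerN c w : gker c (- w) = gker c w.
Proof. by rewrite /gker sqrrN. Qed.

Lemma integral_gker c m : 0 < c -> (\int[leb]_x (gker c (x - m))%:E = 1)%E.
Proof.
move=> c0; rewrite -(integral_normal_pdf m (Num.sqrt c)).
by apply: eq_integral => x _; rewrite gker_normal_pdf.
Qed.

(** Completing the square: the second factor is the conditional density of [z] given the sum [x]. It
    integrates to [1] in [z], whence the semigroup property. *)
Lemma gker_mul c h x z : 0 < c -> 0 < h ->
  gker c (x - z) * gker h z =
  gker (c + h) x * gker (c * h / (c + h)) (z - h * x / (c + h)).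
Proof.
move=> c0 h0; have ch0 : 0 < c + h by rewrite addr_gt0.
have pi0 := pi_gt0 R.
rewrite /gker mulrACA [RHS]mulrACA -!expRD -!invfM -!sqrtrM; last 2 first.
  by rewrite !mulr_ge0 ?ltW.
  by rewrite !mulr_ge0 ?ltW.
congr (_^-1 * expR _); first by congr Num.sqrt; field; rewrite gt_eqF.
by field; rewrite !gt_eqF.
Qed.

(** Exponential tilting moves the mean by [a * c]; the prefactor is the moment generating function
    at [a]. *)
Lemma gker_expM a c m w : 0 < c ->
  expR (a * w) * gker c (w - m) =
  expR (a * m + a ^+ 2 * c / 2) * gker c (w - (m + a * c)).
Proof.
move=> c0; rewrite /gker mulrCA [RHS]mulrCA -!expRD; congr (_ * expR _).
by field; rewrite gt_eqF.
Qed.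

End gaussian_kernel.

Section gaussian_operator.
Context {R : realType} (b v : R).
Hypothesis v0 : 0 < v.
Local Notation leb := (@lebesgue_measure R).

(** Transition density of the Wiener process without boundary. *)
Definition pker (s w : R) : R := gker (v * s) (w - b * s).

(** Acts on distribution functions: if [F] is that of [C], this is that of [C] plus an independent
    increment. With extended real values, Tonelli applies without integrability conditions. *)
Definition gop (s : R) (F : R -> \bar R) (x : R) : \bar R :=
  (\int[leb]_u (F u * (pker s (x - u))%:E))%E.

(* The image of [F]: [gop s F - gop s (tilt F)] vanishes at [0]. *)
Definition tilt (F : R -> \bar R) (u : R) : \bar R :=
  ((expR (2 * b * u / v))%:E * F (- u)%R)%E.

Lemma pker_ge0 s w : 0 <= pker s w. Proof. exact: gker_ge0. Qed.

Lemma measurable_pker s : measurable_fun setT (pker s).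
Proof.
apply: (measurableT_comp (measurable_gker _)) => //.
exact: measurable_funB.
Qed.

Lemma measurable_pkerB s (x : R) : measurable_fun setT (fun u : R => pker s (x - u)).
Proof. by apply: (measurableT_comp (measurable_pker _)); exact: measurable_funB. Qed.

Lemma integral_pkerB s x : 0 < s -> (\int[leb]_u (pker s (x - u))%:E = 1)%E.
Proof.
move=> s0; rewrite -(integral_gker (x - b * s) (mulr_gt0 v0 s0)).
by apply: eq_integral => u _; rewrite /pker -gkerN; congr (gker _ _)%:E; ring.
Qed.

Lemma measurable_gop_integrand s (F : R -> \bar R) x : measurable_fun setT F ->
  measurable_fun setT (fun u : R => F u * (pker s (x - u))%:E)%E.
Proof.
move=> mF; apply: emeasurable_funM => //; apply/measurable_EFinP.
exact: measurable_pkerB.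
Qed.

Lemma gop_integrand_ge0 s (F : R -> \bar R) x u : (0 <= F u)%E ->
  (0 <= F u * (pker s (x - u))%:E)%E.
Proof. by move=> F0; rewrite mule_ge0// lee_fin pker_ge0. Qed.

Lemma gop_ge0 s (F : R -> \bar R) x : (forall u, 0 <= F u)%E -> (0 <= gop s F x)%E.
Proof. by move=> F0; apply: integral_ge0 => u _; exact: gop_integrand_ge0. Qed.

Lemma gopS s (F G : R -> \bar R) x : measurable_fun setT F -> measurable_fun setT G ->
  (forall u, 0 <= F u)%E -> (forall u, F u <= G u)%E -> (gop s F x <= gop s G x)%E.
Proof.
move=> mF mG F0 FG; apply: ge0_le_integral => //.
- by move=> u _; exact: gop_integrand_ge0.
- exact: measurable_gop_integrand.
- exact: measurable_gop_integrand.
- by move=> u _; rewrite lee_wpmul2r// lee_fin pker_ge0.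
Qed.

Lemma gopD s (F G : R -> \bar R) x : measurable_fun setT F -> measurable_fun setT G ->
  (forall u, 0 <= F u)%E -> (forall u, 0 <= G u)%E ->
  gop s (fun u => F u + G u)%E x = (gop s F x + gop s G x)%E.
Proof.
move=> mF mG F0 G0; rewrite /gop -ge0_integralD//; last 4 first.
- by move=> u _; exact: gop_integrand_ge0.
- exact: measurable_gop_integrand.
- by move=> u _; exact: gop_integrand_ge0.
- exact: measurable_gop_integrand.
by apply: eq_integral => u _; rewrite ge0_muleDl.
Qed.

Lemma gop_cst s (c : R) x : 0 < s -> gop s (cst c%:E) x = c%:E.
Proof.
move=> s0; rewrite /gop/= integralZl//=.
  by rewrite integral_pkerB// mule1.
apply/integrableP; split; first by apply/measurable_EFinP; exact: measurable_pkerB.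
under eq_integral do rewrite gee0_abs ?lee_fin ?pker_ge0//.
by rewrite integral_pkerB// ltry.
Qed.

Lemma gop_le1 s (F : R -> \bar R) x : 0 < s -> measurable_fun setT F ->
  (forall u, 0 <= F u <= 1)%E -> (gop s F x <= 1)%E.
Proof.
move=> s0 mF F01; rewrite -(gop_cst 1 x s0); apply: gopS => //.
- by move=> u; have /andP[] := F01 u.
- by move=> u; have /andP[] := F01 u.
Qed.

(** Moves the dependence on [x] from the kernel into [F], so that monotonicity in [x] is inherited
    from [F]. *)
Lemma gop_reflect s (F : R -> \bar R) x : measurable_fun setT F ->
  (forall u, 0 <= F u)%E -> gop s F x = (\int[leb]_w (F (x - w)%R * (pker s w)%:E))%E.
Proof.
move=> mF F0; rewrite /gop (@integral_affine R x (-1))//.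
- rewrite normrN1 mul1e; apply: eq_integral => w _; rewrite mulN1r.
  by congr (_ * (pker s _)%:E)%E; ring.
- exact: measurable_gop_integrand.
- by move=> u; exact: gop_integrand_ge0.
Qed.

Lemma gop_shift s (F : R -> \bar R) a x : measurable_fun setT F ->
  (forall u, 0 <= F u)%E -> gop s (fun u => F (u + a)%R) x = gop s F (x + a).
Proof.
move=> mF F0; rewrite [RHS]/gop (@integral_affine R a 1)//.
- rewrite normr1 mul1e; apply: eq_integral => w _; rewrite mul1r addrC.
  by congr (_ * (pker s _)%:E)%E; ring.
- exact: measurable_gop_integrand.
- by move=> u; exact: gop_integrand_ge0.
Qed.

Lemma gop_nondecreasing s (F : R -> \bar R) x y : measurable_fun setT F ->
  (forall u, 0 <= F u)%E -> {homo F : a b / a <= b >-> (a <= b)%E} -> x <= y ->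
  (gop s F x <= gop s F y)%E.
Proof.
move=> mF F0 ndF xy; rewrite !gop_reflect//.
have mFx (z : R) : measurable_fun setT (fun w : R => F (z - w)%R * (pker s w)%:E)%E.
  apply: emeasurable_funM; last by apply/measurable_EFinP; exact: measurable_pker.
  by apply: (measurableT_comp mF); exact: measurable_funB.
apply: ge0_le_integral => //.
- by move=> w _; rewrite mule_ge0// lee_fin pker_ge0.
- exact: mFx.
- exact: mFx.
- by move=> w _; rewrite lee_wpmul2r ?lee_fin ?pker_ge0// ndF// lerB.
Qed.

(** The weight of the image source cancels the drift, so a source at [u] and its image at [- u]
    compare through the sign of [x * u] alone. *)
Lemma pker_mirror s x u : 0 < s ->
  expR (- (2 * b * u / v)) * pker s (x + u) =
  expR (- (2 * x * u / (v * s))) * pker s (x - u).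
Proof.
move=> s0; rewrite /pker /gker mulrCA [RHS]mulrCA -!expRD; congr (_ * expR _).
by field; rewrite !gt_eqF.
Qed.

Lemma pker_opp s x u : 0 < s ->
  expR (- (2 * b * u / v)) * pker s (x + u) =
  expR (2 * b * x / v) * pker s (- x - u).
Proof.
move=> s0; rewrite /pker /gker mulrCA [RHS]mulrCA -!expRD; congr (_ * expR _).
by field; rewrite !gt_eqF.
Qed.

Lemma measurable_tilt (F : R -> \bar R) : measurable_fun setT F ->
  measurable_fun setT (tilt F).
Proof.
move=> mF; apply: emeasurable_funM.
  apply/measurable_EFinP; apply: measurableT_comp => //.
  by apply: measurable_funM => //; exact: measurable_funM.
by apply: (measurableT_comp mF); exact: measurable_funN.
Qed.

Lemma tilt_ge0 (F : R -> \bar R) u : (forall u, 0 <= F u)%E -> (0 <= tilt F u)%E.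
Proof. by move=> F0; rewrite mule_ge0// lee_fin expR_ge0. Qed.

Lemma gop_tilt_mirror s (F : R -> \bar R) x : measurable_fun setT F ->
  (forall u, 0 <= F u)%E -> gop s (tilt F) x =
  (\int[leb]_u (F u * (expR (- (2 * b * u / v)) * pker s (x + u))%:E))%E.
Proof.
move=> mF F0; rewrite /gop (@integral_affine R 0 (-1))//; last first.
- by move=> u; apply: gop_integrand_ge0; exact: tilt_ge0.
- by apply: measurable_gop_integrand; exact: measurable_tilt.
rewrite normrN1 mul1e; apply: eq_integral => u _.
rewrite /tilt add0r mulN1r opprK muleAC muleC -EFinM; congr (_ * (expR _ * _)%:E)%E.
by ring.
Qed.

Lemma gop_tilt s (F : R -> \bar R) x : 0 < s -> measurable_fun setT F ->
  (forall u, 0 <= F u)%E ->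
  gop s (tilt F) x = ((expR (2 * b * x / v))%:E * gop s F (- x))%E.
Proof.
move=> s0 mF F0; rewrite gop_tilt_mirror// /gop -ge0_integralZl//.
- by apply: eq_integral => u _; rewrite pker_opp// EFinM muleCA.
- exact: measurable_gop_integrand.
- by move=> u _; exact: gop_integrand_ge0.
Qed.

Section sign.
Variables (s : R) (F : R -> \bar R).
Hypothesis s0 : 0 < s.
Hypothesis mF : measurable_fun setT F.
Hypothesis F0 : (forall u, 0 <= F u)%E.
Hypothesis F_le0 : forall u, u <= 0 -> F u = 0%E.

Let mleft x : measurable_fun setT
  (fun u : R => F u * (expR (- (2 * b * u / v)) * pker s (x + u))%:E)%E.
Proof.
apply: emeasurable_funM => //; apply/measurable_EFinP; apply: measurable_funM.
  apply: measurableT_comp => //; apply: measurable_funN.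
  by apply: measurable_funM => //; exact: measurable_funM.
by apply: (measurableT_comp (measurable_pker _)); exact: measurable_funD.
Qed.

(** Pointwise under the integral: only [u > 0] contributes, and there the exponential of
    [pker_mirror] is at most [1]. *)
Lemma gop_tilt_le x : 0 <= x -> (gop s (tilt F) x <= gop s F x)%E.
Proof.
move=> x0; rewrite gop_tilt_mirror//; apply: ge0_le_integral => //.
- by move=> u _; rewrite mule_ge0// lee_fin mulr_ge0 ?expR_ge0 ?pker_ge0.
- exact: mleft.
- exact: measurable_gop_integrand.
- move=> u _; have [/F_le0 ->|u0] := leP u 0; first by rewrite !mul0e.
  rewrite lee_wpmul2l// lee_fin pker_mirror// ler_piMl ?pker_ge0// -[leRHS]expR0 ler_expR.
  by rewrite oppr_le0 divr_ge0// ?mulr_ge0// ltW.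
Qed.

Lemma gop_tilt_ge x : x <= 0 -> (gop s F x <= gop s (tilt F) x)%E.
Proof.
move=> x0; rewrite gop_tilt_mirror//; apply: ge0_le_integral => //.
- by move=> u _; exact: gop_integrand_ge0.
- exact: measurable_gop_integrand.
- exact: mleft.
- move=> u _; have [/F_le0 ->|u0] := leP u 0; first by rewrite !mul0e.
  rewrite lee_wpmul2l// lee_fin pker_mirror// ler_peMl ?pker_ge0// -[leLHS]expR0 ler_expR.
  by rewrite oppr_ge0 pmulr_lle0 ?invr_gt0 ?mulr_gt0// pmulr_lle0// pmulr_rle0.
Qed.

End sign.

Lemma measurable_gop_integrand2 s (F : R -> \bar R) : measurable_fun setT F ->
  measurable_fun setT (fun z : R * R => F z.2 * (pker s (z.1 - z.2))%:E)%E.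
Proof.
move=> mF; apply: emeasurable_funM; first exact: (measurableT_comp mF).
apply/measurable_EFinP; apply: (measurableT_comp (measurable_pker s)).
exact: measurable_funB.
Qed.

Lemma measurable_gop s (F : R -> \bar R) : measurable_fun setT F ->
  (forall u, 0 <= F u)%E -> measurable_fun setT (gop s F).
Proof.
move=> mF F0.
apply: (measurable_fun_fubini_tonelli_F (m2 := leb)
   (fun z : R * R => F z.2 * (pker s (z.1 - z.2))%:E)%E).
  exact: measurable_gop_integrand2.
by move=> z; exact: gop_integrand_ge0.
Qed.

Lemma pker_semigroup s h x u : 0 < s -> 0 < h ->
  (\int[leb]_w (pker s (w - u) * pker h (x - w))%:E = (pker (s + h) (x - u))%:E)%E.
Proof.
move=> s0 h0; have vs0 := mulr_gt0 v0 s0; have vh0 := mulr_gt0 v0 h0.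
(* Conditional mean and variance of the last centred increment given the total one, as in
   [gker_mul]. *)
pose m := v * h * (x - u - b * (s + h)) / (v * s + v * h).
pose c := v * s * (v * h) / (v * s + v * h).
have c0 : 0 < c by rewrite divr_gt0 ?mulr_gt0 ?addr_gt0.
transitivity (\int[leb]_w ((pker (s + h) (x - u))%:E * (gker c (w - (x - b * h - m)))%:E))%E.
  apply: eq_integral => w _; rewrite -EFinM; congr EFin.
  rewrite /pker (_ : w - u - b * s = (x - u - b * (s + h)) - (x - w - b * h)); last by ring.
  rewrite gker_mul// -/m -/c -[v * s + v * h]mulrDr -(gkerN c (w - _)).
  by congr (_ * gker _ _); ring.
rewrite ge0_integralZl//; first by rewrite integral_gker// mule1.
- apply/measurable_EFinP; apply: (measurableT_comp (measurable_gker c)).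
  exact: measurable_funB.
- by move=> w _; rewrite lee_fin gker_ge0.
- by rewrite lee_fin pker_ge0.
Qed.

Lemma gop_semigroup s h (F : R -> \bar R) x : 0 < s -> 0 < h ->
  measurable_fun setT F -> (forall u, 0 <= F u)%E ->
  gop h (gop s F) x = gop (s + h) F x.
Proof.
move=> s0 h0 mF F0.
pose f (z : R * R) := (F z.2 * (pker s (z.1 - z.2) * pker h (x - z.1))%:E)%E.
have mf : measurable_fun setT f.
  rewrite (_ : f = (fun z => (F z.2 * (pker s (z.1 - z.2))%:E) * (pker h (x - z.1))%:E)%E).
    apply: emeasurable_funM; first exact: measurable_gop_integrand2.
    apply/measurable_EFinP; apply: (measurableT_comp (measurable_pkerB h x)).
    exact: measurable_fst.
  by apply/funext => z; rewrite /f EFinM muleA.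
have f0 z : (0 <= f z)%E by rewrite /f mule_ge0// lee_fin mulr_ge0 ?pker_ge0.
transitivity (\int[leb]_w \int[leb]_u f (w, u))%E.
  rewrite /gop; apply: eq_integral => w _; rewrite -ge0_integralZr//.
  - by apply: eq_integral => u _; rewrite /f/= [in RHS]EFinM muleA.
  - exact: measurable_gop_integrand.
  - by move=> u _; exact: gop_integrand_ge0.
  - by rewrite lee_fin pker_ge0.
rewrite fubini_tonelli//; apply: eq_integral => u _; rewrite /f/=.
rewrite ge0_integralZl//; first by rewrite pker_semigroup.
- apply/measurable_EFinP; apply: measurable_funM; last exact: measurable_pkerB.
  by apply: (measurableT_comp (measurable_pker s)); exact: measurable_funB.
- by move=> w _; rewrite lee_fin mulr_ge0 ?pker_ge0.
Qed.

End gaussian_operator.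

(** * Distribution functions of Lindley chains *)

Section lindley_chain.
Context {R : realType} (b v : R).
Hypothesis v0 : 0 < v.
Local Notation leb := (@lebesgue_measure R).
Local Notation gop := (gop b v).
Local Notation tilt := (tilt b v).

(* Bounds [tilt F (u + e)] when [F <= 1] vanishes on the negative half-line. *)
Definition overshoot (e : R) (u : R) : \bar R :=
  if u < - e then (expR (2 * b * (u + e) / v))%:E else 0%E.

Lemma overshoot_ge0 e u : (0 <= overshoot e u)%E.
Proof. by rewrite /overshoot; case: ifPn => // _; rewrite lee_fin expR_ge0. Qed.

Lemma measurable_overshoot e : measurable_fun setT (overshoot e).
Proof.
apply: measurable_fun_if => //.
- exact: measurable_fun_ltr.
- apply/measurable_EFinP; apply: measurable_funTS; apply: measurableT_comp => //.
  by apply: measurable_funM => //; apply: measurable_funM => //; exact: measurable_funD.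
Qed.

(** A Chernoff bound with free parameter [m]. A step from below [- e] to [x > 0] has length [w > e],
    so the indicator is at most [expR (m * (w - e))], while the overshoot is at most an exponential
    of [w]. The product has rate [a] in [w], and [gker_expM] integrates it exactly. *)
Lemma gop_overshoot_le h e m a x : 0 < h -> 0 <= m -> 0 < x -> 0 < e ->
  a = 2 * `|b| / v + m ->
  (gop h (overshoot e) x <=
   (expR (- (m * e) + a * (b * h) + a ^+ 2 * (v * h) / 2))%:E)%E.
Proof.
move=> h0 m0 x0 e0 aE; have vh0 := mulr_gt0 v0 h0.
rewrite gop_reflect//; [|exact: measurable_overshoot|exact: overshoot_ge0].
pose g w := expR (- (m * e)) * (expR (a * w) * pker b v h w).
have mg : measurable_fun setT g.
  apply: measurable_funM => //; apply: measurable_funM; last exact: measurable_pker.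
  by apply: measurableT_comp => //; exact: measurable_funM.
apply: (@le_trans _ _ (\int[leb]_w (g w)%:E)%E).
  apply: ge0_le_integral => //.
  - by move=> w _; rewrite mule_ge0 ?overshoot_ge0// lee_fin pker_ge0.
  - apply: emeasurable_funM; last by apply/measurable_EFinP; exact: measurable_pker.
    by apply: (measurableT_comp (measurable_overshoot e)); exact: measurable_funB.
  - exact/measurable_EFinP.
  - move=> w _; rewrite /g mulrA [leRHS]EFinM lee_wpmul2r ?lee_fin ?pker_ge0//.
    rewrite /overshoot; case: ifPn => [xw|_]; last by rewrite lee_fin mulr_ge0 ?expR_ge0.
    rewrite lee_fin -expRD ler_expR aE.
    have we : e <= w by lra.
    have : 2 * b * (x - w + e) / v <= 2 * `|b| / v * w.
      rewrite [leRHS]mulrAC ler_pM2r ?invr_gt0// -!mulrA ler_pM2l//.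
      have : b * (x - w + e) <= `|b| * `|x - w + e| by rewrite -normrM ler_norm.
      move=> /le_trans; apply; rewrite ler_wpM2l// ler_norml; lra.
    have : m * e <= m * w by rewrite ler_wpM2l.
    rewrite mulrDl; lra.
rewrite le_eqVlt; apply/orP; left; apply/eqP.
pose C := expR (- (m * e) + a * (b * h) + a ^+ 2 * (v * h) / 2).
transitivity (\int[leb]_w (C%:E * (gker (v * h) (w - (b * h + a * (v * h))))%:E))%E.
  apply: eq_integral => w _; rewrite -EFinM; congr EFin.
  by rewrite /g /pker (gker_expM a (b * h) w vh0) mulrA -expRD addrA.
rewrite ge0_integralZl//; first by rewrite integral_gker// mule1.
- apply/measurable_EFinP; apply: (measurableT_comp (measurable_gker _)).
  exact: measurable_funB.
- by move=> w _; rewrite lee_fin gker_ge0.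
- by rewrite lee_fin expR_ge0.
Qed.

(* With [m = sqrt n] the exponent above is [- m e + O(1)], which beats [1 / n]. *)
Lemma gop_overshoot_small s e eps : 0 < s -> 0 < e -> 0 < eps ->
  \forall n \near \oo, forall x, 0 < x ->
    (gop (s / n.+1%:R) (overshoot e) x <= (eps / n.+1%:R)%:E)%E.
Proof.
move=> s0 e0 eps0.
pose c := 2 * `|b| / v; have c0 : 0 <= c by rewrite divr_ge0 ?mulr_ge0// ltW.
(* [K] bounds the rest of the exponent uniformly in [n], because [c + m <= (c + 1) * m] and
   [m ^+ 2 * h = s]. *)
pose K := (c + 1) * `|b| * s + (c + 1) ^+ 2 * v * s / 2.
(* The threshold comes from [(m * e / 4) ^+ 4 <= expR (m * e)]. The left side has order [n ^+ 2]:
   one factor [n] beats [1 / n], the other absorbs [expR K]. *)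
have : \forall n \near \oo, expR K / (eps * (e / 4) ^+ 4) <= n%:R.
  exact: nbhs_infty_ger.
apply: filterS => n nK x x0.
have n0 : 0 < n.+1%:R :> R by [].
pose m : R := Num.sqrt n.+1%:R; have m0 : 0 < m by rewrite sqrtr_gt0.
have m2 : m ^+ 2 = n.+1%:R by rewrite sqr_sqrtr// ltW.
have m1 : 1 <= m by rewrite -sqrtr1 ler_sqrt// ler1n.
apply: (le_trans (gop_overshoot_le _ (ltW m0) x0 e0 erefl)); first by rewrite divr_gt0.
rewrite lee_fin -/c -m2.
pose h := s / m ^+ 2; rewrite -/h.
have h0 : 0 < h by rewrite divr_gt0// exprn_gt0.
have mh : m ^+ 2 * h = s by rewrite /h mulrC divfK// gt_eqF// exprn_gt0.
have a0 : 0 <= c + m by rewrite addr_ge0// ltW.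
have am : c + m <= (c + 1) * m by rewrite mulrDl mul1r lerD2r ler_peMr.
have H1 : (c + m) * (b * h) <= (c + 1) * `|b| * s.
  have : (c + m) * (b * h) <= (c + m) * (`|b| * h).
    by rewrite ler_wpM2l// ler_pM2r// ler_norm.
  move=> /le_trans; apply.
  have : (c + m) * (`|b| * h) <= (c + 1) * m * (`|b| * h).
    by rewrite ler_wpM2r// mulr_ge0// ltW.
  move=> /le_trans; apply.
  rewrite -mh [leRHS](_ : _ = (c + 1) * m ^+ 2 * (`|b| * h)); last by ring.
  apply: ler_wpM2r; first by rewrite mulr_ge0// ltW.
  by rewrite ler_wpM2l ?addr_ge0// expr2 ler_peMl// ltW.
have H2 : (c + m) ^+ 2 * (v * h) / 2 <= (c + 1) ^+ 2 * v * s / 2.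
  rewrite ler_pM2r// -mh.
  rewrite [leRHS](_ : _ = ((c + 1) * m) ^+ 2 * (v * h)); last by ring.
  apply: ler_wpM2r; first by rewrite mulr_ge0// ltW.
  by apply: lerXn2r => //; rewrite nnegrE mulr_ge0 ?addr_ge0// ltW.
apply: (@le_trans _ _ (expR (- (m * e) + K))).
  by rewrite ler_expR /K; lra.
rewrite expRD expRN mulrC ler_pdivrMr ?expR_gt0// mulrAC ler_pdivlMr ?exprn_gt0//.
have H3 : (m * e / 4) ^+ 4 <= expR (m * e).
  rewrite [in leRHS](_ : m * e = (m * e / 4) * 4%:R); last by field.
  rewrite expRM_natr lerXn2r ?nnegrE ?expR_ge0 ?mulr_ge0 ?ltW//.
  by apply: lt_le_trans (expR_ge1Dx _); rewrite ltrDr.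
apply: le_trans (ler_wpM2l (ltW eps0) H3).
have : expR K <= n.+1%:R * (eps * (e / 4) ^+ 4).
  rewrite -ler_pdivrMr ?mulr_gt0 ?exprn_gt0 ?divr_gt0//.
  by apply: le_trans nK _; rewrite ler_nat.
rewrite -m2 => /(ler_wpM2r (ltW (exprn_gt0 2 m0))) /le_trans; apply.
by rewrite le_eqVlt; apply/orP; left; apply/eqP; field.
Qed.

Variables (h : R) (F : nat -> R -> \bar R).
Hypothesis h0 : 0 < h.
Hypothesis mF : forall k, measurable_fun setT (F k).
Hypothesis F01 : forall k u, (0 <= F k u <= 1)%E.
Hypothesis F_le0 : forall k u, u <= 0 -> F k u = 0%E.
Hypothesis ndF0 : {homo F 0 : x y / x <= y >-> (x <= y)%E}.
Hypothesis FS : forall k x, 0 < x -> F k.+1 x = gop h (F k) x.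

Let F_ge0 k u : (0 <= F k u)%E. Proof. by have /andP[] := F01 k u. Qed.
Let F_le1 k u : (F k u <= 1)%E. Proof. by have /andP[] := F01 k u. Qed.

(** The age of [F k.+1], not of [F k]: it is positive already at [k = 0], as the Gaussian kernel
    requires. *)
Let time (k : nat) : R := k.+1%:R * h.

Let time_gt0 k : 0 < time k. Proof. by rewrite mulr_gt0. Qed.

Let time0 : time 0 = h. Proof. by rewrite /time mul1r. Qed.

Let timeS k : time k.+1 = time k + h.
Proof. by rewrite /time -[k.+2]addn1 natrD mulrDl mul1r. Qed.

Let mG k : measurable_fun setT (gop (time k) (F 0)).
Proof. exact: measurable_gop. Qed.

Let mT k : measurable_fun setT (gop (time k) (tilt (F 0))).
Proof.
apply: measurable_gop; first exact: measurable_tilt.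
by move=> u; exact: tilt_ge0.
Qed.

Let G_ge0 k u : (0 <= gop (time k) (F 0) u)%E.
Proof. exact: gop_ge0. Qed.

Let T_ge0 k u : (0 <= gop (time k) (tilt (F 0)) u)%E.
Proof. by apply: gop_ge0 => w; exact: tilt_ge0. Qed.

(** For [x <= 0] this is the sign of the images solution. For [x > 0], apply the monotone [gop h] to
    the induction hypothesis and use the semigroup property. *)
Lemma chain_lower k x :
  (gop (time k) (F 0) x <= F k.+1 x + gop (time k) (tilt (F 0)) x)%E.
Proof.
elim: k x => [|k IH] x; (have [x0|x0] := leP x 0;
    [by rewrite F_le0// add0e gop_tilt_ge//; exact: F_le0|rewrite FS//]).
  by rewrite time0 leeDl// gop_ge0// => u; exact: tilt_ge0.
rewrite timeS -!gop_semigroup//; last 2 first.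
- exact: measurable_tilt.
- by move=> u; exact: tilt_ge0.
by rewrite -gopD//; apply: gopS => //; exact: emeasurable_funD.
Qed.

(** The induction hypothesis covers only [x > 0], whereas [gop h] looks at the whole line. Extending
    it there costs [overshoot e], whose image under [gop h] adds one [eps] per step. *)
Lemma chain_upper e eps k x : 0 < e -> 0 <= eps ->
  (forall x, 0 < x -> (gop h (overshoot e) x <= eps%:E)%E) -> 0 < x ->
  (F k.+1 x + gop (time k) (tilt (F 0)) (x + e) <=
   gop (time k) (F 0) (x + e) + (k.+1%:R * eps)%:E)%E.
Proof.
move=> e0 eps0 small.
have tilt_overshoot u : (tilt (F 0) (u + e) <= overshoot e u)%E.
  rewrite /tilt /overshoot; case: ifPn => ue.
    by rewrite -[leRHS]mule1 lee_wpmul2l// lee_fin expR_ge0.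
  by rewrite F_le0 ?mule0//; lra.
elim: k x => [|k IH] x x0; rewrite FS//.
  rewrite time0 [1%:R * eps]mul1r; apply: leeD.
    by apply: gop_nondecreasing => //; rewrite lerDl ltW.
  apply: le_trans (small _ x0); rewrite -gop_shift//; last 2 first.
  - exact: measurable_tilt.
  - by move=> u; exact: tilt_ge0.
  apply: gopS => //.
  - by apply: (measurableT_comp (measurable_tilt _ _ _)) => //; exact: measurable_funD.
  - exact: measurable_overshoot.
  - by move=> u; exact: tilt_ge0.
rewrite timeS -!gop_semigroup//; last 2 first.
- exact: measurable_tilt.
- by move=> u; exact: tilt_ge0.
rewrite -gop_shift// -[X in (_ <= X + _)%E]gop_shift// -gopD//; last 1 first.
  by apply: (measurableT_comp (mT k)); exact: measurable_funD.
have mGe : measurable_fun setT (fun u : R => gop (time k) (F 0) (u + e)).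
  by apply: (measurableT_comp (mG k)); exact: measurable_funD.
have mO := measurable_overshoot e.
have kE0 : (0 <= (k.+1%:R * eps)%:E)%E by rewrite lee_fin mulr_ge0.
apply: (@le_trans _ _ (gop h (fun u => (gop (time k) (F 0) (u + e) +
    ((k.+1%:R * eps)%:E + overshoot e u))%E) x)).
  apply: gopS => //.
  - apply: emeasurable_funD => //.
    by apply: (measurableT_comp (mT k)); exact: measurable_funD.
  - apply: emeasurable_funD => //; exact: emeasurable_funD.
  - by move=> u; rewrite adde_ge0.
  (* Three regions: the induction hypothesis for [u > 0]; for [u < - e], [gop_tilt] writes the image
     term as the exponential of [overshoot] times a number at most [1]; in between, [u + e >= 0] and
     the sign lemma applies. *)
  - move=> u; rewrite [leRHS]addeA; have [u0|u0] := ltP 0 u.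
      by apply: le_trans (IH _ u0) _; rewrite leeDl ?overshoot_ge0.
    rewrite F_le0// add0e; have [ue|ue] := ltP u (- e).
      apply: (@le_trans _ _ (overshoot e u)); last by rewrite leeDr// adde_ge0.
      rewrite gop_tilt// /overshoot ue -[leRHS]mule1 lee_wpmul2l ?lee_fin ?expR_ge0//.
      by apply: gop_le1 => // w.
    apply: (@le_trans _ _ (gop (time k) (F 0) (u + e))).
      apply: gop_tilt_le => //; [exact: F_le0|lra].
    by rewrite -[leRHS]addeA leeDl// adde_ge0 ?overshoot_ge0.
rewrite gopD//; last 2 first.
- exact: emeasurable_funD.
- by move=> u; rewrite adde_ge0 ?overshoot_ge0.
rewrite leeD2l// (@gopD _ _ _ _ (cst (k.+1%:R * eps)%:E))//; last by move=> u; exact: overshoot_ge0.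
rewrite gop_cst// (_ : k.+2%:R * eps = k.+1%:R * eps + eps); last first.
  by rewrite -[k.+2]addn1 natrD mulrDl mul1r.
by rewrite EFinD leeD2l// small.
Qed.

End lindley_chain.

(** * The Skorokhod problem *)

Section skorokhod.
Context {R : realType}.
Implicit Types (W X L : R -> R) (a b s v r : R).

(* The reflection at [0] of the path [v + (W - W a)] on [[a, b]], evaluated at [b]. *)
Definition refl W a b v : R :=
  Num.max (v + (W b - W a)) (sup [set W b - W u | u in `[a, b]]).

(** Says that [r] is a maximum: an upper bound that is attained. Uniqueness, flow and Lipschitz
    properties then become linear arithmetic without suprema. *)
Definition refl_spec W a b v r : Prop :=
  [/\ v + (W b - W a) <= r, forall u, a <= u <= b -> W b - W u <= r &
      r = v + (W b - W a) \/ exists2 u, a <= u <= b & r = W b - W u].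

Lemma within_continuous_dist W (D : set R) (c e : R) : {within D, continuous W} ->
  D c -> 0 < e ->
  exists2 dl, 0 < dl & forall u, D u -> `|u - c| < dl -> `|W u - W c| < e.
Proof.
move=> /subspace_continuousP/(_ c) cW Dc e0.
have /cvgrPdist_lt/(_ _ e0) := cW Dc.
move=> -[dl /= dl0 H]; exists dl => // u Du uc.
by rewrite distrC; apply: (H u) => //=; rewrite /ball/= distrC.
Qed.

Lemma within_continuousS W a b : 0 <= a -> {within `[0, +oo[, continuous W} ->
  {within `[a, b], continuous W}.
Proof.
move=> a0; apply: continuous_subspaceW => u /=; rewrite !in_itv/= andbT => /andP[+ _].
exact: le_trans.
Qed.

Lemma reflP W a b v : a <= b -> {within `[a, b], continuous W} ->
  refl_spec W a b v (refl W a b v).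
Proof.
move=> ab cW.
have [c cab Wc] := EVT_min ab cW.
set A := [set W b - W u | u in `[a, b]].
have Aub : ubound A (W b - W c).
  by move=> _ [u uab <-]; rewrite lerB// Wc.
have Ac : A (W b - W c) by exists c.
have supA : sup A = W b - W c.
  apply/eqP; rewrite eq_le; apply/andP; split.
    by apply: ge_sup => //; exists (W b - W c).
  by apply: ub_le_sup => //; exists (W b - W c).
rewrite /refl -/A supA; split.
- by rewrite le_max lexx.
- by move=> u uab; rewrite le_max; apply/orP; right; rewrite lerB// Wc.
- rewrite /Num.max; case: ifPn => _; [right|by left].
  by exists c => //; move: cab; rewrite in_itv.
Qed.

Lemma refl_spec_uniq W a b v r r' :
  refl_spec W a b v r -> refl_spec W a b v r' -> r = r'.
Proof.
have le_spec x y : refl_spec W a b v x -> refl_spec W a b v y -> x <= y.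
  by move=> [_ _ H] [y1 y2 _]; case: H => [->//|[u uab ->]]; exact: y2.
by move=> rP r'P; apply/eqP; rewrite eq_le !le_spec.
Qed.

Lemma refl_spec_ge0 W a b v r : a <= b -> refl_spec W a b v r -> 0 <= r.
Proof. by move=> ab [_ /(_ b) + _]; rewrite ab lexx subrr; exact. Qed.

(** Restarting at [b] shifts every term of the first maximum by [W c - W b], and a maximum of maxima
    is a maximum. *)
Lemma refl_spec_flow W a b c v r r' : a <= b -> b <= c ->
  refl_spec W a b v r -> refl_spec W b c r r' -> refl_spec W a c v r'.
Proof.
move=> ab bc [r1 r2 r3] [r1' r2' r3']; split.
- by apply: le_trans r1'; lra.
- move=> u /andP[au uc]; have [ub|bu] := leP u b.
    apply: le_trans r1'; have := r2 u; rewrite au ub => /(_ isT); lra.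
  by apply: r2'; rewrite (ltW bu).
- case: r3' => [r3'|[u /andP[bu uc] r3']]; last first.
    by right; exists u => //; rewrite (le_trans ab bu).
  case: r3 => [r3|[u /andP[au ub] r3]]; first by left; rewrite r3' r3; lra.
  right; exists u; last by rewrite r3' r3; lra.
  by rewrite au (le_trans ub bc).
Qed.

(** The starting value enters only one term of the maximum, with slope one. *)
Lemma refl_spec_lipschitz W a b v v' r r' :
  refl_spec W a b v r -> refl_spec W a b v' r' -> `|r - r'| <= `|v - v'|.
Proof.
have le_spec x y z w : refl_spec W a b x z -> refl_spec W a b y w ->
    z <= w + `|x - y|.
  move=> [_ _ H] [y1 y2 _]; case: H => [->|[u uab ->]].
    by have := ler_norm (x - y); lra.
  by have := y2 _ uab; have := normr_ge0 (x - y); lra.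
move=> rP r'P; have := le_spec _ _ _ _ rP r'P.
have := le_spec _ _ _ _ r'P rP; rewrite (distrC v').
by rewrite ler_norml; lra.
Qed.

(** Reflection displaces the starting point by no more than the oscillation of the driving path. *)
Lemma refl_spec_small W a b v r e : a <= b -> 0 <= v ->
  (forall u u', a <= u <= b -> a <= u' <= b -> `|W u - W u'| <= e) ->
  refl_spec W a b v r -> `|r - v| <= e.
Proof.
move=> ab v0 osc [r1 r2 r3].
have aa : a <= a <= b by rewrite lexx.
have bb : a <= b <= b by rewrite lexx andbT.
have := osc _ _ bb aa; rewrite !ler_norml => /andP[H1 H2].
apply/andP; split; first by lra.
case: r3 => [->|[u uab ->]]; first by lra.
by have := osc _ _ bb uab; rewrite ler_norml; lra.
Qed.

(** Both lower bounds come from [L] nondecreasing and [X >= 0]. For attainment: if [X] has no zero,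
    [L] is constant and [X b] is the free value; otherwise take the last zero [c], after which [L]
    no longer grows, so that [X b = W b - W c]. *)
Lemma skorokhod_refl W X L a b : a <= b ->
  {within `[a, b], continuous W} -> {within `[a, b], continuous X} ->
  (forall u, a <= u <= b -> 0 <= X u) ->
  (forall s u, a <= s -> s <= u -> u <= b ->
    X u - X s = W u - W s + (L u - L s)) ->
  (forall s u, a <= s -> s <= u -> u <= b -> L s <= L u) ->
  (forall s u, a <= s -> s <= u -> u <= b ->
    (forall w, s <= w <= u -> 0 < X w) -> L s = L u) ->
  refl_spec W a b (X a) (X b).
Proof.
move=> ab cW cX X0 dX ndL flat; split.
- by have := dX a b; have := ndL a b; rewrite !lexx ab => /(_ isT isT isT) + /(_ isT isT isT); lra.
- move=> u /andP[au ub]; have := dX u b; have := ndL u b; rewrite au ub lexx.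
  move=> /(_ isT isT isT) + /(_ isT isT isT).
  by have := X0 u; rewrite au ub => /(_ isT); lra.
pose Z := [set u | a <= u <= b /\ X u = 0].
have [[z0 Zz0]|noZ] := pselect (exists z, Z z); last first.
  left; have Lab : L a = L b.
    apply: flat => // w wab; rewrite lt_neqAle X0// andbT eq_sym.
    by apply/eqP => Xw; apply: noZ; exists w.
  by have := dX a b; rewrite !lexx ab => /(_ isT isT isT); lra.
have Zb : ubound Z b by move=> u [/andP[]].
have Zsup : has_sup Z by split; [exists z0|exists b].
pose c := sup Z.
have cb : c <= b by apply: ge_sup => //; exists z0.
have ac : a <= c.
  by case: (Zz0) => /andP[az _] _; apply: le_trans az _; apply: ub_le_sup => //; exists b.
have cab : `[a, b]%classic c by rewrite /= in_itv/= ac cb.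
have Xc : X c = 0.
  apply/eqP; rewrite eq_le X0 ?ac// andbT leNgt; apply/negP => Xc.
  have [dl dl0 H] := within_continuous_dist cX cab Xc.
  have [u [uab Xu] uc] := sup_adherent dl0 Zsup.
  have uc' : u <= c by apply: ub_le_sup => //; exists b.
  have := H u; rewrite /= in_itv/= uab => /(_ isT); rewrite ler0_norm ?subr_le0//.
  have -> : - (u - c) < dl by rewrite -/c in uc; lra.
  by move=> /(_ isT); rewrite Xu sub0r normrN gtr0_norm// ltxx.
right; exists c; first by rewrite ac cb.
have dXc := dX c b ac cb (lexx b).
(* Flatness gives [L u = L b] only for [u > c], and no continuity of [L] is assumed. But
   [L u - L c = X u - X c - (W u - W c)], which tends to [0] as [u] decreases to [c]. *)
suff : L b - L c <= 0 by have := ndL c b ac cb (lexx b); lra.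
apply/ler_addgt0Pl => e e0; rewrite addr0.
have e20 : 0 < e / 2 by rewrite divr_gt0.
have [dl dl0 H] := within_continuous_dist cX cab e20.
have [dl' dl'0 H'] := within_continuous_dist cW cab e20.
have [cb'|cb'] := eqVneq c b; first by rewrite cb' subrr ltW.
have clt : c < b by rewrite lt_neqAle cb'.
pose m := Num.min (Num.min dl dl') (b - c).
have m0 : 0 < m by rewrite !lt_min dl0 dl'0 subr_gt0.
have mdl : m <= dl by rewrite !ge_min lexx.
have mdl' : m <= dl' by rewrite !ge_min lexx orbT.
have mbc : m <= b - c by rewrite ge_min lexx orbT.
pose u := c + m / 2.
have uab : a <= u <= b by rewrite /u; lra.
have Lu : L u = L b.
  apply: flat; [by case/andP: uab|by case/andP: uab|by []|].
  move=> w /andP[uw wb]; have wab : a <= w <= b by rewrite wb andbT; rewrite /u in uw; lra.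
  rewrite lt_neqAle X0// andbT eq_sym; apply/eqP => Xw.
  have : w <= c by apply: ub_le_sup; [exists b|split].
  by rewrite /u in uw; lra.
have cu : c <= u by rewrite /u; lra.
have uc : `|u - c| < m by rewrite ger0_norm ?subr_ge0// /u; lra.
have := dX c u ac cu; case/andP: (uab) => _ ub => /(_ ub).
have := H u; rewrite /= in_itv/= uab (lt_le_trans uc mdl) => /(_ isT isT).
have := H' u; rewrite /= in_itv/= uab (lt_le_trans uc mdl') => /(_ isT isT).
by rewrite !ltr_norml Lu; lra.
Qed.

(** The waiting-time recursion of queueing theory: reflection applied at the grid points [a + k * h]
    only. *)
Fixpoint lindley W a h v (k : nat) : R :=
  if k is k'.+1 then
    Num.max (lindley W a h v k' + (W (a + k%:R * h) - W (a + k'%:R * h))) 0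
  else v.

Lemma lindley_ge0 W a h v k : 0 <= v -> 0 <= lindley W a h v k.
Proof. by move=> v0; case: k => //= k; rewrite le_max lexx orbT. Qed.

Lemma lindley_ge_start W a h v k :
  v + (W (a + k%:R * h) - W a) <= lindley W a h v k.
Proof.
elim: k => [|k IH]; first by rewrite mul0r !addr0 subrr addr0.
by rewrite [leRHS]/= le_max; apply/orP; left; lra.
Qed.

Lemma lindley_ge_grid W a h v j k : 0 <= v -> (j <= k)%N ->
  W (a + k%:R * h) - W (a + j%:R * h) <= lindley W a h v k.
Proof.
move=> v0; elim: k => [|k IH].
  by rewrite leqn0 => /eqP ->; rewrite subrr.
rewrite leq_eqVlt => /predU1P[->|]; first by rewrite subrr lindley_ge0.
rewrite ltnS => /IH {}IH; rewrite [leRHS]/= le_max; apply/orP; left; lra.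
Qed.

(** With the preceding lower bounds, this identifies the chain with the maximum that defines [refl],
    taken over grid points only. *)
Lemma lindley_attained W a h v k :
  lindley W a h v k = v + (W (a + k%:R * h) - W a) \/
  exists2 j, (j <= k)%N & lindley W a h v k = W (a + k%:R * h) - W (a + j%:R * h).
Proof.
elim: k => [|k IH]; first by left; rewrite /= mul0r addr0 subrr addr0.
rewrite [lindley _ _ _ _ _]/=; set x := (X in Num.max X 0).
have [x0|x0] := leP x 0.
  by right; exists k.+1 => //; rewrite subrr.
case: IH => [IH|[j jk IH]]; first by left; rewrite /x IH; lra.
by right; exists j; rewrite ?(leqW jk)// /x IH; lra.
Qed.

Section lindley_cvg.
Variables (W : R -> R) (a s v : R).
Hypothesis (s0 : 0 < s) (v0 : 0 <= v).
Hypothesis cW : {within `[a, a + s], continuous W}.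

Let h (n : nat) := s / n.+1%:R.

Let h0 n : 0 < h n. Proof. by rewrite divr_gt0. Qed.

Let end_h n : a + n.+1%:R * h n = a + s.
Proof. by rewrite /h mulrC divfK. Qed.

Let specP : refl_spec W a (a + s) v (refl W a (a + s) v).
Proof. by apply: reflP => //; rewrite lerDl ltW. Qed.

(** A maximum over fewer points is smaller. *)
Lemma lindley_le_refl n : lindley W a (h n) v n.+1 <= refl W a (a + s) v.
Proof.
have [r1 r2 _] := specP.
have [->|[j jn ->]] := lindley_attained W a (h n) v n.+1; rewrite end_h//.
apply: r2; rewrite lerDl mulr_ge0 ?(ltW (h0 n))//= -(end_h n) lerD2l.
by rewrite ler_pM2r// ler_nat.
Qed.

Lemma lindley_cvg_refl : lindley W a (h n) v n.+1 @[n --> \oo] --> refl W a (a + s) v.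
Proof.
apply/cvgrPdist_le => e e0.
have [r1 r2 r3] := specP.
suff : \forall n \near \oo, refl W a (a + s) v - e <= lindley W a (h n) v n.+1.
  apply: filterS => n; have := lindley_le_refl n.
  move: (lindley _ _ _ _ _) => q qr H.
  by rewrite ler_norml; lra.
case: r3 => [->|[u /andP[au ub] ->]].
  apply: nearW => n; have := lindley_ge_start W a (h n) v n.+1.
  by rewrite end_h; lra.
have uab : `[a, a + s]%classic u by rewrite /= in_itv/= au ub.
have [dl dl0 H] := within_continuous_dist cW uab e0.
have : \forall n \near \oo, s / dl < n%:R by exact: nbhs_infty_gtr.
apply: filterS => n sn.
have hdl : h n < dl.
  rewrite /h ltr_pdivrMr// mulrC -ltr_pdivrMr//; apply: lt_trans sn _.
  by rewrite ltr_nat.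
(* Last grid index before the maximiser [u]: that node is within [h n < dl] of [u], so [W] differs
   there by less than [e]. *)
pose j := Num.truncn ((u - a) / h n).
have /andP[j1 j2] : j%:R <= (u - a) / h n < j.+1%:R.
  by apply: truncn_itv; rewrite divr_ge0 ?subr_ge0// ltW.
rewrite ler_pdivlMr// in j1; rewrite ltr_pdivrMr// -natr1 mulrDl mul1r in j2.
have jn : (j <= n.+1)%N.
  rewrite -(ler_nat R) -(ler_pM2r (h0 n)); have := end_h n; lra.
have := @lindley_ge_grid W a (h n) v j n.+1 v0 jn; rewrite end_h.
have jab : `[a, a + s]%classic (a + j%:R * h n).
  rewrite /= in_itv/= lerDl mulr_ge0 ?(ltW (h0 n))//=; lra.
have := H _ jab; rewrite ltr_norml.
have -> : (- dl < a + j%:R * h n - u < dl) by lra.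
by move=> /(_ isT); rewrite ltr_norml; lra.
Qed.

End lindley_cvg.

End skorokhod.

(** * The law of the reflected Wiener process *)

Section reflected_flow.
Context {R : realType} (b v : R).
Hypothesis v0 : 0 < v.
Local Notation leb := (@lebesgue_measure R).

Definition gopR (s : R) (f : R -> R) (x : R) : R :=
  \int[leb]_u (f u * pker b v s (x - u)).

(* The distribution function after time [s] of the reflected process with initial
   distribution function [f]; meaningful for [x >= 0]. *)
Definition rflow (s : R) (f : R -> R) (x : R) : R :=
  gopR s f x - expR (2 * b * x / v) * gopR s f (- x).

(** Provides the dominating function for continuity under the integral. Since
    [(y + d) ^+ 2 >= y ^+ 2 / 2 - d ^+ 2], a Gaussian shifted by at most [1] lies below a multiple
    of the one with doubled variance. *)
Lemma gker_near (c y d : R) : 0 < c -> `|d| <= 1 ->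
  gker c (y + d) <= Num.sqrt (2 * pi * (2 * c)) / Num.sqrt (2 * pi * c) *
    expR (1 / (2 * c)) * gker (2 * c) y.
Proof.
move=> c0 d1; have pi0 := pi_gt0 R.
rewrite /gker.
have S0 : Num.sqrt (2 * pi * (2 * c)) != 0 by rewrite gt_eqF// sqrtr_gt0 !mulr_gt0.
set S := Num.sqrt _ in S0 *.
rewrite [leRHS](_ : _ = (Num.sqrt (2 * pi * c))^-1 *
    (expR (1 / (2 * c)) * expR (- (y ^+ 2 / (2 * (2 * c)))))); last first.
  by field; rewrite S0 gt_eqF// sqrtr_gt0 !mulr_gt0.
rewrite -expRD ler_wpM2l ?invr_ge0// ler_expR.
have d2 : d ^+ 2 <= 1 by rewrite -real_normK ?num_real// expr_le1.
have c2 : 0 < (2 * c)^-1 by rewrite invr_gt0 mulr_gt0.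
rewrite -mulNr -ler_pdivlMr ?invr_gt0//.
rewrite [leRHS](_ : _ = 1 - y ^+ 2 / 2); last by field; rewrite gt_eqF.
  have := sqr_ge0 (y + 2 * d); nra.
by rewrite mulr_gt0.
Qed.

Lemma integrable_gop_integrand s (f : R -> R) x : 0 < s -> measurable_fun setT f ->
  (forall u, 0 <= f u <= 1) ->
  leb.-integrable setT (fun u => (f u * pker b v s (x - u))%:E).
Proof.
move=> s0 mf f01; apply/integrableP; split.
  by apply/measurable_EFinP/measurable_funM => //; exact: measurable_pkerB.
have -> : (\int[leb]_u `|(f u * pker b v s (x - u))%:E| = gop b v s (EFin \o f) x)%E.
  apply: eq_integral => u _; rewrite -EFinM gee0_abs// lee_fin.
  by rewrite mulr_ge0 ?pker_ge0//; case/andP: (f01 u).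
apply: (@le_lt_trans _ _ 1%E); last exact: ltry.
by apply: gop_le1 => //; exact/measurable_EFinP.
Qed.

Lemma gop_fin s (f : R -> R) x : 0 < s -> measurable_fun setT f ->
  (forall u, 0 <= f u <= 1) -> gop b v s (EFin \o f) x = (gopR s f x)%:E.
Proof.
move=> s0 mf f01; rewrite /gopR /Rintegral fineK//.
exact/integrable_fin_num/integrable_gop_integrand.
Qed.

Lemma gopR_continuous s (f : R -> R) : 0 < s -> measurable_fun setT f ->
  (forall u, 0 <= f u <= 1) -> continuous (gopR s f).
Proof.
move=> s0 mf f01 a; have vs0 := mulr_gt0 v0 s0.
pose K := Num.sqrt (2 * pi * (2 * (v * s))) / Num.sqrt (2 * pi * (v * s)) *
    expR (1 / (2 * (v * s))).
pose g u := K * gker (2 * (v * s)) (u - (a - b * s)).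
have K0 : 0 <= K by rewrite !mulr_ge0 ?expR_ge0// invr_ge0.
have mg : measurable_fun setT g.
  apply: measurable_funM => //; apply: (measurableT_comp (measurable_gker _)).
  exact: measurable_funB.
apply: (@continuity_under_integral _ _ _ leb (fun x u => f u * pker b v s (x - u))
    setT _ (a - 1) (a + 1) _ _ g) => //=.
- by move=> x _; exact: integrable_gop_integrand.
- apply: aeW => u _ x _; apply: cvgM; first exact: cvg_cst.
  rewrite /pker /gker; apply: cvgM; first exact: cvg_cst.
  apply: (cvg_comp _ expR); last exact: continuous_expR.
  apply: cvgN; apply: cvgM; last exact: cvg_cst.
  apply: (cvg_comp _ (fun z => z ^+ 2)); last exact: sqr_continuous.
  by apply: cvgB; [apply: cvgB; [exact: cvg_id|exact: cvg_cst]|exact: cvg_cst].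
- apply/integrableP; split; first exact/measurable_EFinP.
  rewrite (_ : (\int[leb]_x `|(g x)%:E| = K%:E)%E) ?ltry//.
  transitivity (\int[leb]_x (K%:E * (gker (2 * (v * s)) (x - (a - b * s)))%:E))%E.
    by apply: eq_integral => x _; rewrite -EFinM gee0_abs// lee_fin mulr_ge0// gker_ge0.
  rewrite ge0_integralZl//.
  + by rewrite integral_gker ?mulr_gt0// mule1.
  + apply/measurable_EFinP; apply: (measurableT_comp (measurable_gker _)).
    exact: measurable_funB.
  + by move=> x _; rewrite lee_fin gker_ge0.
- move=> x; rewrite in_itv/= => xa; apply: aeW => u _.
  have /andP[fu0 fu1] := f01 u.
  rewrite ger0_norm ?mulr_ge0 ?pker_ge0//.
  apply: (@le_trans _ _ (pker b v s (x - u))).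
    by rewrite ler_piMl ?pker_ge0.
  rewrite /g -gkerN /pker.
  rewrite (_ : x - u - b * s = - (u - (a - b * s)) + (x - a)); last by ring.
  by apply: gker_near => //; rewrite ler_norml; lra.
- by rewrite inE/= in_itv/=; lra.
Qed.

Lemma rflow_continuous s (f : R -> R) : 0 < s -> measurable_fun setT f ->
  (forall u, 0 <= f u <= 1) -> continuous (rflow s f).
Proof.
move=> s0 mf f01 x; apply: cvgB; first exact: gopR_continuous.
apply: cvgM.
  apply: (cvg_comp _ expR); last exact: continuous_expR.
  by apply: cvgM; [apply: cvgM; [exact: cvg_cst|exact: cvg_id]|exact: cvg_cst].
apply: (cvg_comp -%R (gopR s f)); first by apply: cvgN; exact: cvg_id.
exact: gopR_continuous.
Qed.

End reflected_flow.

(** Fatou for events: [A] is contained in the increasing union of the sets [Bn N] on which every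
    [An n] with [n >= N] holds. Applied to complements, it yields upper bounds as well. *)
Lemma probability_liminf d (T : measurableType d) (R : realType)
    (P : probability T R) (A : set T) (An : nat -> set T) (e : R) :
  measurable A -> (forall n, measurable (An n)) ->
  (forall w, A w -> \forall n \near \oo, An n w) -> 0 < e ->
  \forall n \near \oo, fine (P A) - e <= fine (P (An n)).
Proof.
move=> mA mAn AAn e0.
pose Bn N := \bigcap_(n in [set n | (N <= n)%N]) An n.
have mBn N : measurable (Bn N) by apply: bigcap_measurable => //; exists N => /=.
have mUB : measurable (\bigcup_n Bn n) by exact: bigcupT_measurable.
have ndB : {homo Bn : n m / (n <= m)%N >-> (n <= m)%O}.
  by move=> n m nm; apply/subsetPset => w Bw k mk; apply: Bw; exact: leq_trans mk.
have fP (C : set T) : measurable C -> P C = (fine (P C))%:E.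
  by move=> mC; rewrite fineK// fin_num_measure.
have cB : fine (P (Bn n)) @[n --> \oo] --> fine (P (\bigcup_n Bn n)).
  apply: fine_cvg; rewrite -fP//.
  exact: (@nondecreasing_cvg_mu _ _ _ P _ mBn mUB ndB).
have : \forall n \near \oo, fine (P (\bigcup_n Bn n)) - e < fine (P (Bn n)).
  by apply: (cvgr_gt _ cB); rewrite ltrBlDr ltrDl.
apply: filterS => n /ltW le1.
have : fine (P A) <= fine (P (\bigcup_n Bn n)).
  by rewrite -lee_fin -!fP//; apply: le_measure; rewrite ?inE.
have : fine (P (Bn n)) <= fine (P (An n)).
  rewrite -lee_fin -!fP//; apply: le_measure; rewrite ?inE//.
  by move=> w; apply => /=.
by move: le1; lra.
Qed.

(** * Adapted variables, distribution functions and independent increments *)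

Section adapted.
Context d (T : measurableType d) (R : realType) (B : R -> T -> R).
Implicit Types (D : set R) (f : T -> R).

Definition adapted D f := forall A : set R, measurable A ->
  generated_by D B (f @^-1` A).

Let gens D := [set G | exists u, exists A : set R,
         [/\ 0 <= u, D u, measurable A & G = B u @^-1` A]].

(** Reads adaptedness as measurability for another structure on [T], so that closure under sums,
    maxima and limits follows from the general lemmas. *)
Lemma adaptedP D f :
  adapted D f <-> measurable_fun setT (f : g_sigma_algebraType (gens D) -> R).
Proof.
by split=> [H _ A mA|H A mA];
  [rewrite setTI; exact: H|rewrite -[X in generated_by _ _ X]setTI; exact: H].
Qed.

Lemma adapted_generator D u : 0 <= u -> D u -> adapted D (B u).
Proof. by move=> u0 Du A mA; apply: sub_gen_smallest; exists u, A. Qed.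

Lemma adaptedS D D' f : D `<=` D' -> adapted D f -> adapted D' f.
Proof.
move=> DD' Df A mA; apply: sub_sigma_algebra2 (Df _ mA) => _ [u [A' [u0 Du mA' ->]]].
by exists u, A'; split => //; exact: DD'.
Qed.

Lemma adapted_cst D c : adapted D (cst c).
Proof. by apply/adaptedP; exact: measurable_cst. Qed.

Lemma adaptedD D f g : adapted D f -> adapted D g -> adapted D (fun w => f w + g w).
Proof. by move=> /adaptedP Df /adaptedP Dg; apply/adaptedP; exact: measurable_funD. Qed.

Lemma adaptedB D f g : adapted D f -> adapted D g -> adapted D (fun w => f w - g w).
Proof. by move=> /adaptedP Df /adaptedP Dg; apply/adaptedP; exact: measurable_funB. Qed.

Lemma adaptedZ D c f : adapted D f -> adapted D (fun w => c * f w).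
Proof. by move=> /adaptedP Df; apply/adaptedP; exact: measurable_funM. Qed.

Lemma adapted_max D f g : adapted D f -> adapted D g ->
  adapted D (fun w => Num.max (f w) (g w)).
Proof. by move=> /adaptedP Df /adaptedP Dg; apply/adaptedP; exact: measurable_maxr. Qed.

Lemma adapted_cvg D (h : nat -> T -> R) f : (forall n, adapted D (h n)) ->
  (forall w, h n w @[n --> \oo] --> f w) -> adapted D f.
Proof.
move=> Dh hf; apply/adaptedP.
apply: (@measurable_fun_cvg _ (g_sigma_algebraType (gens D)) R setT h f) => [n|w _].
  exact/adaptedP.
exact: hf.
Qed.

Lemma generated_by_measurable D (G : set T) :
  (forall t, 0 <= t -> measurable_fun setT (B t)) ->
  generated_by D B G -> measurable G.
Proof.
move=> mB; apply: smallest_sub; first exact: sigma_algebra_measurable.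
by move=> _ [u [A [u0 Du mA ->]]]; rewrite -[X in measurable X]setTI; exact: mB.
Qed.

Lemma adapted_measurable D f : (forall t, 0 <= t -> measurable_fun setT (B t)) ->
  adapted D f -> measurable_fun setT f.
Proof.
move=> mB Df _ A mA; rewrite setTI; apply: generated_by_measurable mB _.
exact: Df.
Qed.

End adapted.

Section left_cdf.
Context d (T : measurableType d) (R : realType) (P : probability T R).

(** The strict inequality matches [joint_cdf], makes the function vanish for [u <= 0] when [C >= 0],
    and lets a maximum with [0] drop out of the event when [u > 0]. *)
Definition lcdf (C : T -> R) (u : R) : \bar R := P [set w | C w < u].

Lemma measurable_lt_set (C : T -> R) u : measurable_fun setT C ->
  measurable [set w | C w < u].
Proof.
move=> mC; rewrite (_ : [set w | _] = setT `&` C @^-1` `]-oo, u[); first exact: mC.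
by apply/seteqP; split => w /=; rewrite in_itv/= => // -[].
Qed.

Lemma lcdf_nondecreasing (C : T -> R) : measurable_fun setT C ->
  {homo lcdf C : x y / x <= y >-> (x <= y)%E}.
Proof.
move=> mC x y xy; apply: le_measure; rewrite ?inE; [exact: measurable_lt_set..|].
by move=> w /= /lt_le_trans; apply.
Qed.

Lemma lcdf_fin (C : T -> R) u : measurable_fun setT C ->
  lcdf C u = (fine (lcdf C u))%:E.
Proof. by move=> mC; rewrite fineK// fin_num_measure//; exact: measurable_lt_set. Qed.

Lemma lcdf01 (C : T -> R) u : measurable_fun setT C -> (0 <= lcdf C u <= 1)%E.
Proof.
by move=> mC; rewrite measure_ge0 probability_le1//; exact: measurable_lt_set.
Qed.

Lemma measurable_fine_lcdf (C : T -> R) : measurable_fun setT C ->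
  measurable_fun setT (fine \o lcdf C).
Proof.
move=> mC; apply: nondecreasing_measurable => // x y xy.
by rewrite -lee_fin /= -!lcdf_fin//; exact: lcdf_nondecreasing.
Qed.

Lemma measurable_lcdf (C : T -> R) : measurable_fun setT C ->
  measurable_fun setT (lcdf C).
Proof.
move=> mC; rewrite (_ : lcdf C = EFin \o (fine \o lcdf C)); last first.
  by apply/funext => u; rewrite /= -lcdf_fin.
by apply/measurable_EFinP; exact: measurable_fine_lcdf.
Qed.

End left_cdf.

(** The joint law agrees with the product measure on rectangles, hence everywhere; the integral over
    sections is how the product measure is computed. *)
Lemma law_pair d (T : measurableType d) (R : realType) (P : probability T R)
    d1 d2 (T1 : measurableType d1) (T2 : measurableType d2)
    (m1 : probability T1 R) (m2 : probability T2 R) (X : T -> T1) (Y : T -> T2) :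
  measurable_fun setT X -> measurable_fun setT Y ->
  (forall A A', measurable A -> measurable A' ->
    P (X @^-1` A `&` Y @^-1` A') = (m1 A * m2 A')%E) ->
  forall Z : set (T1 * T2), measurable Z ->
    P [set w | Z (X w, Y w)] = (\int[m1]_x m2 (xsection Z x))%E.
Proof.
move=> mX mY XY Z mZ.
pose XYw w := (X w, Y w).
have mXY : measurable_fun setT XYw by exact/measurable_fun_pair.
pose m' : {measure set _ -> \bar R} := pushforward P XYw.
have joint A A' : measurable A -> measurable A' -> m' mXY (A `*` A') = (m1 A * m2 A')%E.
  by move=> mA mA'; rewrite -XY.
by have := @product_measure_unique _ _ _ _ _ m1 m2 (m' mXY) joint Z mZ.
Qed.

Section increments.
Context d (T : measurableType d) (R : realType) (P : probability T R).
Variable B : R -> T -> R.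
Hypothesis bmB : brownian_motion P B.
Variables b v : R.
Hypothesis v0 : 0 < v.
Local Notation leb := (@lebesgue_measure R).

Definition wiener (w : T) (t : R) : R := b * t + Num.sqrt v * B t w.

Lemma adapted_wiener (D : set R) t : 0 <= t -> D t ->
  adapted B D (fun w => wiener w t).
Proof.
move=> t0 Dt; apply: adaptedD; first exact: adapted_cst.
by apply: adaptedZ; exact: adapted_generator.
Qed.

Lemma wiener_continuous w : {within `[0, +oo[, continuous (wiener w)}.
Proof.
have /subspace_continuousP cB := @bm_continuous _ _ _ _ _ bmB w.
apply/subspace_continuousP => t t0; apply: cvgD.
  apply: cvgM; first exact: cvg_cst.
  exact: cvg_within.
by apply: cvgM; [exact: cvg_cst|exact: cB].
Qed.

Lemma gker_wiener h z : 0 < h ->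
  Num.sqrt v * pker b v h (b * h + Num.sqrt v * z) = gker h z.
Proof.
move=> h0; have sv0 : 0 < Num.sqrt v by rewrite sqrtr_gt0.
rewrite /pker /gker addrC addKr exprMn sqr_sqrtr ?ltW//.
rewrite (_ : 2 * pi * (v * h) = v * (2 * pi * h)); last by ring.
rewrite (@sqrtrM _ v) ?ltW//.
have S0 : Num.sqrt (2 * pi * h) != 0 :> R by rewrite gt_eqF// sqrtr_gt0 !mulr_gt0// pi_gt0.
have -> : v * z ^+ 2 / (2 * (v * h)) = z ^+ 2 / (2 * h) by field; rewrite !gt_eqF.
by field; rewrite S0 gt_eqF.
Qed.

(** [C] depends on the past up to [a], so it is independent of the increment and their joint law is
    a product. Tonelli and the substitution [z |-> b * h + Num.sqrt v * z] turn the probability of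
    the half-plane [X] into a convolution. *)
Lemma cdf_add_increment (C : T -> R) (a h x : R) : 0 <= a -> 0 < h ->
  adapted B `[0, a] C ->
  P [set w | C w + (wiener w (a + h) - wiener w a) < x] =
  gop b v h (lcdf P C) x.
Proof.
move=> a0 h0 aC.
have sv0 : 0 < Num.sqrt v by rewrite sqrtr_gt0.
have mB := bm_measurable bmB.
have mC : measurable_fun setT C by exact: adapted_measurable aC.
have aah : a < a + h by rewrite ltrDl.
pose D w := B (a + h) w - B a w.
have mD : measurable_fun setT D.
  by apply: measurable_funB; apply: mB => //; rewrite addr_ge0// ltW.
pose C' : {mfun T >-> R} := HB.pack C (isMeasurableFun.Build _ _ _ _ C mC).
pose X := [set z : R * R | z.1 + (b * h + Num.sqrt v * z.2) < x].
have mX : measurable X.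
  rewrite -[X]setTI; apply: measurable_fun_ltr => //.
  apply: measurable_funD; first exact: measurable_fst.
  by apply: measurable_funD => //; apply: measurable_funM => //; exact: measurable_snd.
have CD A A' : measurable A -> measurable A' -> P (C @^-1` A `&` D @^-1` A') =
    (distribution P C' A * normal_prob 0 (Num.sqrt h) A')%E.
  move=> mA mA'; have aCA := aC _ mA.
  have := @bm_independent _ _ _ _ _ bmB a (a + h) (C @^-1` A) A' a0 aah aCA mA'.
  have := @bm_gaussian _ _ _ _ _ bmB a (a + h) A' a0 aah mA'.
  by rewrite [in Num.sqrt _]addrAC subrr add0r => -> ->.
have -> : P [set w | C w + (wiener w (a + h) - wiener w a) < x] =
    P [set w | X (C w, D w)].
  congr (P _); apply/seteqP; split => w /=;
    rewrite (_ : wiener w (a + h) - wiener w a = b * h + Num.sqrt v * D w)//;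
    rewrite /wiener /D; ring.
have := @law_pair _ _ _ P _ _ R (measurableTypeR R) (distribution P C')
  (normal_prob 0 (Num.sqrt h)) C D mC mD CD X mX.
move=> ->.
pose f (z : R * R) := (\1_X z * gker h z.2)%:E.
have mf : measurable_fun setT f.
  apply/measurable_EFinP; apply: measurable_funM; first exact: measurable_indic.
  by apply: (measurableT_comp (measurable_gker h)); exact: measurable_snd.
have f0 z : (0 <= f z)%E by rewrite lee_fin mulr_ge0// gker_ge0.
transitivity (\int[distribution P C']_c \int[leb]_z f (c, z))%E.
  apply: eq_integral => c _; rewrite /= /normal_prob integral_mkcond.
  apply: eq_integral => z _; rewrite /f patchE /xsection/= indicE.
  rewrite -[normal_pdf _ _ z]gker_normal_pdf// subr0; case: ifPn => [/set_mem /= ->|cz].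
    by rewrite mul1r.
  rewrite (_ : ((c, z) \in X) = false) ?mul0r//; apply/negP => cX.
  by move/negP: cz; apply; exact: mem_set.
rewrite fubini_tonelli//.
rewrite gop_reflect; last 2 first.
- exact: measurable_lcdf.
- by move=> u; exact: measure_ge0.
have mF (g : R -> R) : measurable_fun setT g ->
    measurable_fun setT (fun w : R => (lcdf P C (x - g w)%R * (pker b v h (g w))%:E)%E).
  move=> mg; apply: emeasurable_funM.
    by apply: (measurableT_comp (measurable_lcdf _ mC)); exact: measurable_funB.
  by apply/measurable_EFinP; apply: (measurableT_comp (measurable_pker _ _ _)).
have F0 g w : (0 <= lcdf P C (x - g w)%R * (pker b v h (g w))%:E)%E.
  by rewrite mule_ge0// lee_fin pker_ge0.
rewrite (@integral_affine R (b * h) (Num.sqrt v)) ?gt_eqF//; last 2 first.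
- exact: (mF id).
- by move=> w; exact: (F0 _ id).
rewrite gtr0_norm// -ge0_integralZl//; last first.
  by apply: (mF (fun z => b * h + Num.sqrt v * z)); exact: measurable_affine.
apply: eq_integral => z _.
rewrite muleCA -EFinM gker_wiener// /f/=.
under eq_integral do rewrite EFinM.
pose A := [set c : R | c < x - (b * h + Num.sqrt v * z)].
have mA : measurable A by exact: measurable_lt_set.
have XA c : \1_X (c, z) = \1_A c :> R.
  rewrite !indicE; congr (nat_of_bool _)%:R; apply/idP/idP; rewrite !inE /X /A /=; lra.
under eq_integral do rewrite XA.
rewrite ge0_integralZr//.
  by rewrite integral_indic// setIT.
  by apply/measurable_EFinP; exact: measurable_indic.
by rewrite lee_fin gker_ge0.
Qed.

End increments.

Section reflected_law.
Context d (T : measurableType d) (R : realType) (P : probability T R).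
Variable B : R -> T -> R.
Hypothesis bmB : brownian_motion P B.
Variables b v : R.
Hypothesis v0 : 0 < v.
Variables (a s : R) (V : T -> R).
Hypothesis a0 : 0 <= a.
Hypothesis s0 : 0 < s.
Hypothesis aV : adapted B `[0, a] V.
Hypothesis V0 : forall w, 0 <= V w.

Local Notation W := (wiener B b v).

(** The start is random so that it can be the position reached in the first environment. *)
Definition refl_end (w : T) : R := refl (W w) a (a + s) (V w).

Let h (n : nat) : R := s / n.+1%:R.
Let C n k w := lindley (W w) a (h n) (V w) k.

Let h0 n : 0 < h n. Proof. by rewrite divr_gt0. Qed.

Let nh n : n.+1%:R * h n = s. Proof. by rewrite /h mulrC divfK. Qed.

Let aC n k : adapted B `[0, a + k%:R * h n] (C n k).
Proof.
elim: k => [|k IH]; first by rewrite mul0r addr0.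
have kS : k%:R * h n <= k.+1%:R * h n by rewrite ler_pM2r// ler_nat.
have k0 : 0 <= k%:R * h n by rewrite mulr_ge0// ltW.
apply: adapted_max; last exact: adapted_cst.
apply: adaptedD; first apply: adaptedS IH.
  by move=> u /=; rewrite !in_itv/= => /andP[->/= /le_trans]; apply; rewrite lerD2l.
rewrite -/(C n k); move: IH k0 kS; move: (k.+1%:R * h n) (k%:R * h n) => x y _ y0 yx.
have x0 : 0 <= x by exact: le_trans yx.
by apply: adaptedB; apply: adapted_wiener;
  rewrite /= ?in_itv/= ?lexx ?andbT ?lerD2l ?yx ?addr_ge0.
Qed.

Let C_ge0 n k w : 0 <= C n k w. Proof. exact: lindley_ge0. Qed.

Let mB := bm_measurable bmB.

Let mC n k : measurable_fun setT (C n k).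
Proof. exact: (adapted_measurable mB (@aC n k)). Qed.

Let cW w : {within `[a, a + s], continuous (W w)}.
Proof. by apply: within_continuousS => //; exact: (@wiener_continuous _ _ _ _ _ bmB b v w). Qed.

Let C_cvg w : C n n.+1 w @[n --> \oo] --> refl_end w.
Proof. exact: lindley_cvg_refl. Qed.

Lemma adapted_refl_end : adapted B `[0, a + s] refl_end.
Proof.
apply: (@adapted_cvg _ _ _ _ _ (fun n => C n n.+1)) => // n.
by have := @aC n n.+1; rewrite nh.
Qed.

Let mR : measurable_fun setT refl_end.
Proof. exact: (adapted_measurable mB adapted_refl_end). Qed.

Let f := fine \o lcdf P V.

Let mV : measurable_fun setT V. Proof. exact: (adapted_measurable mB aV). Qed.

Let mf : measurable_fun setT f. Proof. exact: measurable_fine_lcdf. Qed.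

Let f01 u : 0 <= f u <= 1.
Proof. by have := lcdf01 P u mV; rewrite lcdf_fin// !lee_fin. Qed.

Let fE : lcdf P V = EFin \o f.
Proof. by apply/funext => u; rewrite /= -lcdf_fin. Qed.

Let F n k u := lcdf P (C n k) u.

Let F_le0 n k u : u <= 0 -> F n k u = 0%E.
Proof.
move=> u0; rewrite /F /lcdf (_ : [set w | _] = set0) ?measure0//.
apply/seteqP; split => w //= Cu; have := C_ge0 n k w; lra.
Qed.

Let FS n k x : 0 < x -> F n k.+1 x = gop b v (h n) (F n k) x.
Proof.
move=> x0; rewrite -(@cdf_add_increment _ _ _ _ _ bmB b v v0 (C n k) (a + k%:R * h n))//.
  have -> : a + k%:R * h n + h n = a + k.+1%:R * h n.
    by rewrite -natr1 mulrDl mul1r addrA.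
  by congr (P _); apply/seteqP; split => w; rewrite /= gt_max x0 andbT.
by rewrite addr_ge0// mulr_ge0// ltW.
Qed.

Let ndF n : {homo F n 0 : x y / x <= y >-> (x <= y)%E}.
Proof. exact: lcdf_nondecreasing. Qed.

Let FV n : F n 0 = EFin \o f. Proof. exact: fE. Qed.

(** Chains lie below the reflected path, so a single fine enough grid suffices: its [N.+1] steps
    cost [eps / N.+1] each. *)
Lemma refl_end_upper x e : 0 < x -> 0 < e ->
  fine (lcdf P refl_end x) <= rflow b v s f (x + e).
Proof.
move=> x0 e0; apply/ler_addgt0Pl => eps eps0.
have [N _ small] := gop_overshoot_small b v0 s0 e0 eps0.
have := @chain_upper R b v v0 (h N) (F N) (h0 N) (fun k => measurable_lcdf _ (mC N k))
  (fun k u => lcdf01 P u (mC N k)) (F_le0 N) (ndF N) (FS N) e (eps / N.+1%:R) N x e0.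
have eN : 0 <= eps / N.+1%:R by rewrite divr_ge0// ltW.
move=> /(_ eN (small N (leqnn N)) x0).
rewrite nh FV gop_tilt//; [|exact/measurable_EFinP|
  by move=> u; rewrite lee_fin; case/andP: (f01 u)].
rewrite !gop_fin// [N.+1%:R * _]mulrC divfK// [F N N.+1 x]lcdf_fin// -EFinM -!EFinD lee_fin => H.
have : fine (lcdf P refl_end x) <= fine (lcdf P (C N N.+1) x).
  rewrite -lee_fin -!lcdf_fin//; apply: le_measure; rewrite ?inE; [exact: measurable_lt_set..|].
  by move=> w /=; apply: le_lt_trans; exact: lindley_le_refl.
by move=> le_p; rewrite /rflow addrA lerBrDr [eps + _]addrC; apply: le_trans H; rewrite lerD2r.
Qed.

(** Here the chains are on the wrong side and a limit is taken: where the reflected path ends at or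
    above [x], the chains eventually exceed [x - e]. *)
Lemma refl_end_lower x e : 0 < e -> e < x ->
  rflow b v s f (x - e) <= fine (lcdf P refl_end x).
Proof.
move=> e0 ex.
have lower n : rflow b v s f (x - e) <= fine (lcdf P (C n n.+1) (x - e)).
  have := @chain_lower R b v v0 (h n) (F n) (h0 n) (fun k => measurable_lcdf _ (mC n k))
    (fun k u => lcdf01 P u (mC n k)) (F_le0 n) (FS n) n (x - e).
  rewrite nh FV gop_tilt//; [|exact/measurable_EFinP|
  by move=> u; rewrite lee_fin; case/andP: (f01 u)].
  by rewrite !gop_fin// [F n n.+1 _]lcdf_fin// -EFinM -!EFinD lee_fin /rflow lerBlDr.
apply/ler_addgt0Pr => eps eps0.
have mA : measurable (~` [set w | refl_end w < x]).
  by apply: measurableC; exact: measurable_lt_set.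
have mAn n : measurable (~` [set w | C n n.+1 w < x - e]).
  by apply: measurableC; exact: measurable_lt_set.
have ev w : (~` [set w | refl_end w < x]) w ->
    \forall n \near \oo, (~` [set w | C n n.+1 w < x - e]) w.
  move=> /= /negP; rewrite -leNgt => xw.
  have : \forall n \near \oo, refl_end w - e < C n n.+1 w.
    by apply: (cvgr_gt (refl_end w)) => //; lra.
  by apply: filterS => n; lra.
have [N _ /(_ N (leqnn N)) /=] := probability_liminf P mA mAn ev eps0.
rewrite !probability_setC; [|exact: measurable_lt_set..].
rewrite -!/(lcdf P _ _) (lcdf_fin P x mR) (lcdf_fin P _ (mC _ _)) -!EFinB/=.
by have := lower N; move: (rflow _ _ _ _ _) (fine _) (fine _) => p q r; lra.
Qed.

Lemma refl_end_law x : 0 < x -> fine (lcdf P refl_end x) = rflow b v s f x.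
Proof.
move=> x0; apply/eqP; rewrite eq_le; apply/andP; split.
- apply/ler_addgt0Pl => e e0.
  have /cvgrPdist_lt/(_ _ e0)[dl /= dl0 H] := @rflow_continuous R b v v0 s f s0 mf f01 x.
  have := H (x + dl / 2); rewrite /ball/= opprD addrA subrr sub0r normrN.
  rewrite gtr0_norm; last by rewrite divr_gt0.
  have -> : dl / 2 < dl by lra.
  move=> /(_ isT); rewrite ltr_norml.
  have := @refl_end_upper x (dl / 2) x0; have -> : 0 < dl / 2 by lra.
  move=> /(_ isT); move: (rflow _ _ _ _ _) (rflow _ _ _ _ _) (fine _) => p q r.
  by lra.
- apply/ler_addgt0Pl => e e0.
  have /cvgrPdist_lt/(_ _ e0)[dl /= dl0 H] := @rflow_continuous R b v v0 s f s0 mf f01 x.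
  pose m := Num.min dl x.
  have m0 : 0 < m by rewrite lt_min dl0.
  have mdl : m <= dl by rewrite ge_min lexx.
  have mx : m <= x by rewrite ge_min lexx orbT.
  have := H (x - m / 2); rewrite /ball/= opprB addrC subrK gtr0_norm; last by rewrite divr_gt0.
  have -> : m / 2 < dl by lra.
  move=> /(_ isT); rewrite ltr_norml.
  have := @refl_end_lower x (m / 2); have -> : 0 < m / 2 by lra.
  have -> : m / 2 < x by lra.
  move=> /(_ isT isT); move: (rflow _ _ _ _ _) (rflow _ _ _ _ _) (fine _) => p q r.
  by lra.
Qed.

End reflected_law.

(** * The complementary error function *)

Section erfc_theory.
Context {R : realType}.
Local Notation leb := (@lebesgue_measure R).

Let gauss (z : R) : R := expR (- z ^+ 2).

Let gaussE : gauss = gauss_fun. Proof. by []. Qed.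

Let igauss (D : set R) : measurable D -> leb.-integrable D (EFin \o gauss).
Proof. by move=> mD; apply: integrableS (@integrableT_gauss R). Qed.

(** Puts the variable at the upper end of the integral, where the fundamental theorem of calculus
    applies. *)
Lemma erfc_Ny (x : R) :
  erfc x = 2 / Num.sqrt pi * (Num.sqrt pi - \int[leb]_(z in `]-oo, x]) gauss z).
Proof.
rewrite /erfc; congr (_ * _); rewrite -Rintegral_itv_obnd_cbnd; last exact: igauss.
have -> : Num.sqrt pi = \int[leb]_(z in setT) gauss z.
  by rewrite /Rintegral gaussE integralT_gauss.
have -> : [set: R] = `]-oo, x] `|` `]x, +oo[.
  by apply/seteqP; split => z //= _; rewrite !in_itv/= andbT; case: leP; [left|right].
rewrite (@Rintegral_setU _ _ _ leb)//; last 2 first.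
- by apply: igauss; exact: measurableU.
- by apply/disj_setPS => z [/=]; rewrite !in_itv/= andbT; case: leP.
by rewrite addrC addKr.
Qed.

Lemma is_derive_erfc (x : R) :
  is_derive x (1 : R) (@erfc R) (- (2 / Num.sqrt pi * expR (- x ^+ 2))).
Proof.
pose F y := \int[leb]_(z in `]-oo, y]) gauss z.
have [dF F'] : derivable F x 1 /\ F^`()%classic x = gauss x.
  apply: (@continuous_FTC1 R gauss -oo%O x (x + 1)) => //.
  - by rewrite ltrDl.
  - exact: igauss.
  - exact: ltNyr.
  - exact: continuous_gauss_fun.
have {F'}dF : is_derive x (1 : R) F (gauss x).
  by rewrite -F' derive1E; exact/derivableP.
have -> : @erfc R = (fun y => 2 / Num.sqrt pi * (Num.sqrt pi - F y)).
  by apply/funext => y; exact: erfc_Ny.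
have := @is_deriveZ _ _ _ (fun y => Num.sqrt pi - F y) (2 / Num.sqrt pi) x 1 _
  (is_deriveB (is_derive_cst (Num.sqrt pi : R) x 1) dF).
by rewrite sub0r scalerN.
Qed.

Lemma continuous_erfc : continuous (@erfc R).
Proof.
move=> x; apply: differentiable_continuous; apply/derivable1_diffP.
by case: (is_derive_erfc x).
Qed.

Lemma measurable_erfc : measurable_fun setT (@erfc R).
Proof. by apply: continuous_measurable_fun; exact: continuous_erfc. Qed.

Lemma erfc_ge0 (x : R) : 0 <= erfc x.
Proof.
rewrite /erfc mulr_ge0 ?divr_ge0//; apply: Rintegral_ge0 => z _; exact: expR_ge0.
Qed.

Lemma erfc_le2 (x : R) : erfc x <= 2.
Proof.
have spi : 0 < Num.sqrt pi :> R by rewrite sqrtr_gt0 pi_gt0.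
rewrite erfc_Ny mulrAC ler_pdivrMr// ler_pM2l// gerBl.
by apply: Rintegral_ge0 => z _; exact: expR_ge0.
Qed.

Lemma integral_gker_gt (c m y : R) : 0 < c ->
  (\int[leb]_u ((\1_`]y, +oo[ u : R)%:E * (gker c (u - m))%:E) =
   (erfc ((y - m) / Num.sqrt (2 * c)) / 2)%:E)%E.
Proof.
move=> c0; have pi0 := pi_gt0 R.
set k := Num.sqrt (2 * c).
have k0 : 0 < k by rewrite sqrtr_gt0 mulr_gt0.
have spi : 0 < Num.sqrt pi :> R by rewrite sqrtr_gt0.
have k2 : k ^+ 2 = 2 * c by rewrite sqr_sqrtr// mulr_ge0// ltW.
rewrite (@integral_affine R m k) ?gt_eqF//; last 2 first.
- apply: emeasurable_funM.
    by apply/measurable_EFinP; exact: measurable_indic.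
  apply/measurable_EFinP; apply: (measurableT_comp (measurable_gker c)).
  exact: measurable_funB.
- by move=> u; rewrite mule_ge0// lee_fin ?gker_ge0.
rewrite gtr0_norm//.
pose w := (y - m) / k.
transitivity (k%:E * \int[leb]_z ((k^-1 / Num.sqrt pi)%:E * ((EFin \o gauss) \_ `]w, +oo[) z))%E.
  congr (_ * _)%E; apply: eq_integral => z _.
  have -> : gker c (m + k * z - m) = k^-1 / Num.sqrt pi * gauss z.
    rewrite /gker (_ : m + k * z - m = k * z); last by ring.
    rewrite exprMn k2 (_ : 2 * pi * c = 2 * c * pi); last by ring.
    rewrite sqrtrM ?mulr_ge0 ?ltW// -/k.
    rewrite (_ : 2 * c * z ^+ 2 / (2 * c) = z ^+ 2); last by field; rewrite gt_eqF.
    by rewrite /gauss; field; rewrite !gt_eqF.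
  rewrite patchE indicE; have -> : (m + k * z \in `]y, +oo[%classic) = (z \in `]w, +oo[%classic).
    by apply/idP/idP; rewrite !inE/= !in_itv/= !andbT /w ltr_pdivrMr//; lra.
  by case: ifPn => _; rewrite ?mul1e ?mul0e ?mule0//= -EFinM.
rewrite ge0_integralZl//; last 3 first.
- apply/(measurable_restrictT _ _).1 => //; apply: measurable_funTS.
  by apply/measurable_EFinP; exact: measurable_gauss_fun.
- by move=> z _; rewrite patchE; case: ifPn => // _; rewrite lee_fin expR_ge0.
- by rewrite lee_fin divr_ge0// invr_ge0 ltW.
rewrite -integral_mkcond muleA -EFinM.
have -> : (\int[leb]_(z in `]w, +oo[) (EFin \o gauss) z =
    (\int[leb]_(z in `]w, +oo[) gauss z)%:E)%E.
  by rewrite /Rintegral fineK//; apply: integrable_fin_num => //; exact: igauss.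
rewrite -EFinM /erfc Rintegral_itv_obnd_cbnd; last exact: igauss.
by congr EFin; rewrite -/w; field; rewrite !gt_eqF.
Qed.

End erfc_theory.

(** * The closed form of the transition law *)

Section reflected_transition.
Context {R : realType} (b v : R).
Hypothesis v0 : 0 < v.
Local Notation leb := (@lebesgue_measure R).

(* The probability that the reflected process started at [y] is below [x >= 0] after
   time [s]. *)
Definition rcdf (s x y : R) : R :=
  (erfc ((y - x + b * s) / Num.sqrt (2 * (v * s)))
   - expR (2 * b * x / v) * erfc ((y + x + b * s) / Num.sqrt (2 * (v * s)))) / 2.

Lemma rcdf0 s y : rcdf s 0 y = 0.
Proof. by rewrite /rcdf mulr0 mul0r expR0 mul1r subr0 addr0 subrr mul0r. Qed.

Lemma is_derive_erfc_affine (k c x : R) :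
  is_derive x (1 : R) (fun z => erfc (c + k * z))
    (- (2 / Num.sqrt pi * expR (- (c + k * x) ^+ 2)) * k).
Proof.
have dg : is_derive x (1 : R) (fun z => c + k * z) k.
  have := is_deriveD (is_derive_cst c x (1 : R)) (is_deriveZ k (is_derive_id x (1 : R))).
  by rewrite add0r scaler1.
exact: (@is_derive1_comp _ (@erfc R) (fun z => c + k * z) x _ _ (is_derive_erfc _) dg).
Qed.

Lemma is_derive_rcdf s x y : 0 < s ->
  is_derive x (1 : R) (rcdf s ^~ y) (rhat b v x s y).
Proof.
move=> s0; have pi0 := pi_gt0 R; have vs0 := mulr_gt0 v0 s0.
set k := Num.sqrt (2 * (v * s)).
have k0 : 0 < k by rewrite sqrtr_gt0 mulr_gt0.
have spi : 0 < Num.sqrt pi :> R by rewrite sqrtr_gt0.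
have k2 : k ^+ 2 = 2 * (v * s) by rewrite sqr_sqrtr// mulr_ge0// ltW.
have d1 := is_derive_erfc_affine (- k^-1) ((y + b * s) / k) x.
have d2 := is_derive_erfc_affine k^-1 ((y + b * s) / k) x.
have dg : is_derive x (1 : R) (fun z => 2 * b / v * z) (2 * b / v).
  by have := is_deriveZ (2 * b / v) (is_derive_id x (1 : R)); rewrite scaler1.
have de := @is_derive1_comp _ expR (fun z => 2 * b / v * z) x _ _ (is_derive_expR _) dg.
have := is_deriveZ (2^-1 : R) (is_deriveB d1 (is_deriveM de d2)).
rewrite (_ : _ \*: _ = rcdf s ^~ y); last first.
  apply/funext => z; rewrite /rcdf -/k fctE/=.
  rewrite [LHS](_ : _ = 2^-1 * (erfc ((y + b * s) / k + - k^-1 * z) -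
     expR (2 * b / v * z) * erfc ((y + b * s) / k + k^-1 * z)))//.
  rewrite mulrC; congr (_ * _); congr (erfc _ - expR _ * erfc _).
  - by field; rewrite gt_eqF.
  - by field; rewrite gt_eqF.
  - by field; rewrite gt_eqF.
set X := (X in is_derive _ _ _ X -> _); suff -> : rhat b v x s y = X by [].
rewrite {}/X /rhat.
have E1 : - ((y + b * s) / k + - k^-1 * x) ^+ 2 = - ((x - y - b * s) ^+ 2 / (2 * v * s)).
  by rewrite -[2 * v * s]mulrA -k2; field; rewrite gt_eqF.
(* The two squares differ by [4 * b * s * (x + y)], which trades the weight in [x] produced by
   differentiation for the weight in [y] displayed in [rhat]. *)
have E2 : expR (- (2 * b * y / v)) * expR (- ((x + y - b * s) ^+ 2 / (2 * v * s))) =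
    expR (2 * b / v * x) * expR (- ((y + b * s) / k + k^-1 * x) ^+ 2).
  rewrite -!expRD; congr expR.
  have -> : ((y + b * s) / k + k^-1 * x) ^+ 2 = (x + y + b * s) ^+ 2 / (2 * v * s).
    by rewrite -[2 * v * s]mulrA -k2; field; rewrite gt_eqF.
  by field; rewrite !gt_eqF.
rewrite E1 E2 /=.
have -> : Num.sqrt (2 * pi * v * s) = k * Num.sqrt pi.
  by rewrite /k -sqrtrM ?mulr_ge0 ?ltW//; congr Num.sqrt; ring.
have -> : (x + y + b * s) / Num.sqrt (2 * v * s) = (y + b * s) / k + k^-1 * x.
  by rewrite -mulrA -/k; field; rewrite gt_eqF.
have -> : 2 * b * x / v = 2 * b / v * x by field; rewrite gt_eqF.
rewrite /GRing.scale/=.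
by field; rewrite !gt_eqF.
Qed.

Lemma rhat_continuous s y : 0 < s -> continuous (fun x => rhat b v x s y).
Proof.
move=> s0 x.
have cexp (g : R -> R) : {for x, continuous g} -> {for x, continuous (fun z => expR (g z))}.
  by move=> cg; apply: (continuous_comp cg); exact: continuous_expR.
have csqr (c e : R) :
    {for x, continuous (fun z : R => expR (- ((z + c + e) ^+ 2 / (2 * v * s))))}.
  apply: cexp; apply: cvgN; apply: cvgM; last exact: cvg_cst.
  apply: (cvg_comp _ (fun z => z ^+ 2)); last exact: sqr_continuous.
  by apply: cvgD; [apply: cvgD; [exact: cvg_id|exact: cvg_cst]|exact: cvg_cst].
rewrite /rhat; apply: cvgB.
  apply: cvgM; first exact: cvg_cst.
  apply: cvgD; first exact: (csqr (- y) (- (b * s))).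
  by apply: cvgM; [exact: cvg_cst|exact: (csqr y (- (b * s)))].
have clin : {for x, continuous (fun z : R => expR (2 * b * z / v))}.
  apply: cexp; apply: cvgM; last exact: cvg_cst.
  by apply: cvgM; [exact: cvg_cst|exact: cvg_id].
apply: cvgM.
  apply: cvgM; first exact: cvg_cst.
  exact: clin.
apply: (cvg_comp _ (@erfc R)); last exact: continuous_erfc.
apply: cvgM; last exact: cvg_cst.
apply: cvgD; last exact: cvg_cst.
by apply: cvgD; [exact: cvg_id|exact: cvg_cst].
Qed.

(** Uniform in the start [y], and with a singularity in [s] that is integrable at [0]: this is what
    dominates the derivative of the mixture. *)
Lemma rhat_bound (s x y M : R) : 0 < s -> `|x| <= M ->
  `|rhat b v x s y| <=
  (1 + expR (2 * `|b| * M / v)) / Num.sqrt (2 * pi * v) / Num.sqrt s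
  + 2 * `|b| / v * expR (2 * `|b| * M / v).
Proof.
move=> s0 xM; have pi0 := pi_gt0 R.
have den0 : 0 <= 2 * v * s by rewrite !mulr_ge0 ?ltW.
have sE : Num.sqrt (2 * pi * v * s) = Num.sqrt (2 * pi * v) * Num.sqrt s.
  by rewrite sqrtrM// !mulr_ge0// ltW.
have bxM : 2 * b * x / v <= 2 * `|b| * M / v.
  rewrite ler_pM2r ?invr_gt0// -!mulrA ler_pM2l// (le_trans (ler_norm _))//.
  by rewrite normrM ler_wpM2l.
rewrite /rhat (le_trans (ler_normB _ _))// lerD//.
  rewrite normrM sE ger0_norm ?invr_ge0 ?mulr_ge0//.
  rewrite invfM mulrC -[leRHS]mulrA; apply: ler_wpM2r; first by rewrite mulr_ge0 ?invr_ge0.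
  rewrite ger0_norm ?addr_ge0 ?mulr_ge0 ?expR_ge0// lerD//.
    by rewrite -[leRHS]expR0 ler_expR oppr_le0 divr_ge0 ?sqr_ge0.
  rewrite -expRD ler_expR.
  (* For [b < 0] the factor in [y] alone is unbounded for large [y]; completing the square replaces
     it by a factor in [x]. *)
  have -> : - (2 * b * y / v) - (x + y - b * s) ^+ 2 / (2 * v * s) =
      2 * b * x / v - (x + y + b * s) ^+ 2 / (2 * v * s).
    by field; rewrite !gt_eqF.
  have : 0 <= (x + y + b * s) ^+ 2 / (2 * v * s) by rewrite divr_ge0// sqr_ge0.
  by move: (_ / (2 * v * s)) => z; move: bxM; lra.
rewrite normrM (ger0_norm (erfc_ge0 _)) [X in X * _]normrM (ger0_norm (expR_ge0 _)).
rewrite [X in X * _ * _]normrM normfV (gtr0_norm v0).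
rewrite [leRHS](_ : _ = `|b| / v * expR (2 * `|b| * M / v) * 2); last by ring.
apply: ler_pM; rewrite ?erfc_ge0 ?erfc_le2 ?mulr_ge0 ?expR_ge0 ?invr_ge0 ?(ltW v0)//.
by rewrite ler_wpM2l ?mulr_ge0 ?invr_ge0 ?(ltW v0)// ler_expR.
Qed.

(** For [x < 0], [rcdf] is not claimed to be a probability, but differentiating at [x = 0] evaluates
    it there, hence a bound without sign condition. *)
Lemma rcdf_bound (s x y M : R) : `|x| <= M -> `|rcdf s x y| <= 1 + expR (2 * `|b| * M / v).
Proof.
move=> xM; have bxM : 2 * b * x / v <= 2 * `|b| * M / v.
  rewrite ler_pM2r ?invr_gt0// -!mulrA ler_pM2l// (le_trans (ler_norm _))//.
  by rewrite normrM ler_wpM2l.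
rewrite /rcdf normrM (@ger0_norm _ 2^-1)// ler_pdivrMr// [leRHS]mulrDl mul1r.
rewrite (le_trans (ler_normB _ _))// lerD//; first by rewrite ger0_norm ?erfc_ge0 ?erfc_le2.
rewrite normrM (ger0_norm (expR_ge0 _)) (ger0_norm (erfc_ge0 _)).
by rewrite ler_pM ?expR_ge0 ?erfc_ge0 ?erfc_le2// ler_expR.
Qed.

Lemma rflow_gt s x y : 0 < s -> rflow b v s (\1_`]y, +oo[) x = rcdf s x y.
Proof.
move=> s0; have vs0 := mulr_gt0 v0 s0.
have H z : gopR b v s (\1_`]y, +oo[) z = erfc ((y - z + b * s) / Num.sqrt (2 * (v * s))) / 2.
  rewrite /gopR /Rintegral -[RHS]/(fine _%:E); congr fine.
  rewrite -(_ : y - (z - b * s) = y - z + b * s); last by ring.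
  rewrite -(integral_gker_gt (z - b * s) y vs0); apply: eq_integral => u _.
  rewrite EFinM; congr (_ * _)%E; rewrite /pker -gkerN; congr (gker _ _)%:E; ring.
by rewrite /rflow !H opprK /rcdf; ring.
Qed.

End reflected_transition.

Section mixture.
Context {R : realType} (b v : R).
Hypothesis v0 : 0 < v.
Local Notation leb := (@lebesgue_measure R).

Variables (s x : R) (q : R -> R).
Hypothesis s0 : 0 < s.
Hypothesis mq : measurable_fun setT q.
Hypothesis q0 : forall z, 0 <= q z.

Let half (x z : R) := erfc ((z - x + b * s) / Num.sqrt (2 * (v * s))) / 2.

Lemma gop_mixture :
  gop b v s (fun u => \int[leb]_z (q z * \1_`]z, +oo[ u)%:E)%E x =
  (\int[leb]_z (q z * half x z)%:E)%E.
Proof.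
have vs0 := mulr_gt0 v0 s0.
pose f (p : R * R) := (q p.2 * (\1_[set r : R * R | r.2 < r.1] p * pker b v s (x - p.1)))%:E.
have mf : measurable_fun setT f.
  apply/measurable_EFinP; apply: measurable_funM.
    exact: (measurableT_comp mq).
  apply: measurable_funM.
    apply: measurable_indic; rewrite -[X in measurable X]setTI.
    by apply: measurable_fun_ltr.
  by apply: (measurableT_comp (measurable_pkerB b v s x)).
have f0 p : (0 <= f p)%E by rewrite lee_fin !mulr_ge0 ?pker_ge0.
have ind (u z : R) : \1_[set r : R * R | r.2 < r.1] (u, z) = \1_`]z, +oo[ u :> R.
  rewrite !indicE; congr (nat_of_bool _)%:R.
  by apply/idP/idP; rewrite !inE/= in_itv/= andbT.
have mind (u : R) : measurable_fun setT (fun z : R => \1_`]z, +oo[ u : R).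
  rewrite (_ : (fun z => _) = \1_`]-oo, u[); first exact: measurable_indic.
  apply/funext => z; rewrite !indicE; congr (nat_of_bool _)%:R.
  by apply/idP/idP; rewrite !inE/= !in_itv/= andbT.
transitivity (\int[leb]_u \int[leb]_z f (u, z))%E.
  rewrite /gop; apply: eq_integral => u _; rewrite -ge0_integralZr//.
  - by apply: eq_integral => z _; rewrite -EFinM /f ind -mulrA.
  - apply/measurable_EFinP; apply: measurable_funM; [exact: mq|exact: mind].
  - by move=> z _; rewrite lee_fin mulr_ge0.
  - by rewrite lee_fin pker_ge0.
rewrite fubini_tonelli//; apply: eq_integral => z _; rewrite /f.
transitivity (\int[leb]_u
    ((q z)%:E * ((\1_`]z, +oo[ u)%:E * (gker (v * s) (u - (x - b * s)))%:E)))%E.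
  apply: eq_integral => u _; rewrite ind -!EFinM; congr (_ * (_ * _))%:E.
  by rewrite /pker -gkerN; congr (gker _ _); rewrite /=; ring.
rewrite ge0_integralZl//; last 3 first.
- apply: emeasurable_funM; first by apply/measurable_EFinP; exact: measurable_indic.
  apply/measurable_EFinP; apply: (measurableT_comp (measurable_gker _)).
  exact: measurable_funB.
- by move=> u _; rewrite mule_ge0// lee_fin gker_ge0.
- by rewrite lee_fin.
have zE : z - (x - b * s) = z - x + b * s by ring.
by rewrite (integral_gker_gt (x - b * s) z vs0) zE -EFinM.
Qed.

End mixture.

Section rflow_mixture.
Context {R : realType} (b v : R).
Hypothesis v0 : 0 < v.
Local Notation leb := (@lebesgue_measure R).
Variables (s : R) (q f : R -> R).
Hypothesis s0 : 0 < s.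
Hypothesis iq : leb.-integrable setT (EFin \o q).
Hypothesis q0 : forall z, 0 <= q z.
Hypothesis mf : measurable_fun setT f.
Hypothesis f01 : forall u, 0 <= f u <= 1.
Hypothesis fE : forall u, (f u)%:E = (\int[leb]_z (q z * \1_`]z, +oo[ u)%:E)%E.

Let mq : measurable_fun setT q.
Proof. by apply/measurable_EFinP; exact: measurable_int iq. Qed.

Let mh x : measurable_fun setT
  (fun z : R => erfc ((z - x + b * s) / Num.sqrt (2 * (v * s))) / 2).
Proof.
apply: measurable_funM => //; apply: (measurableT_comp measurable_erfc).
by apply: measurable_funM => //; apply: measurable_funD => //; exact: measurable_funB.
Qed.

Let ih x : leb.-integrable setT
  (fun z => (q z * (erfc ((z - x + b * s) / Num.sqrt (2 * (v * s))) / 2))%:E).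
Proof.
apply: le_integrable iq => //.
  by apply/measurable_EFinP; apply: measurable_funM; [exact: mq|exact: mh].
move=> z _; rewrite lee_fin normrM ler_piMr// ger0_norm ?divr_ge0 ?erfc_ge0//.
by rewrite ler_pdivrMr// mul1r erfc_le2.
Qed.

Let gopE x : gopR b v s f x =
  \int[leb]_z (q z * (erfc ((z - x + b * s) / Num.sqrt (2 * (v * s))) / 2)).
Proof.
apply: EFin_inj; rewrite -gop_fin//.
rewrite (_ : EFin \o f = (fun u => \int[leb]_z (q z * \1_`]z, +oo[ u)%:E)%E); last first.
  by apply/funext => u; rewrite /= fE.
rewrite (gop_mixture b v0 x s0 mq q0) /Rintegral fineK//.
by apply: integrable_fin_num => //; exact: ih.
Qed.

(** [rflow] is linear, and a law with density [q] is a mixture of point masses, whose distribution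
    functions are the indicators of []z, +oo[]. *)
Lemma rflow_mixture x : rflow b v s f x = \int[leb]_z (q z * rcdf b v s x z).
Proof.
rewrite /rflow !gopE -RintegralZl//; last exact: ih.
rewrite -RintegralB//; [|exact: ih|]; last first.
  have := integrableZl measurableT (expR (2 * b * x / v)) (ih (- x)).
  by apply: eq_integrable.
apply: eq_Rintegral => z _; rewrite /rcdf opprK.
by ring.
Qed.

End rflow_mixture.

Lemma wiener_reflP d (T : measurableType d) (R : realType) (P : probability T R)
    (B : R -> T -> R) (b v : R) (w : T) (a c y : R) :
  brownian_motion P B -> 0 <= a -> a <= c ->
  refl_spec (wiener B b v w) a c y (refl (wiener B b v w) a c y).
Proof.
move=> bmB a0 ac; apply: reflP => //; apply: within_continuousS => //.
exact: (@wiener_continuous _ _ _ _ _ bmB b v w).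
Qed.

Section one_phase.
Context d (T : measurableType d) (R : realType) (P : probability T R).
Variable B : R -> T -> R.
Hypothesis bmB : brownian_motion P B.
Variables b v : R.
Hypothesis v0 : 0 < v.
Variables (s y : R).
Hypothesis s0 : 0 < s.
Hypothesis y0 : 0 <= y.
Local Notation leb := (@lebesgue_measure R).
Local Notation Y := (refl_end B b v 0 s (fun=> y)).

Let mB := bm_measurable bmB.

Lemma adapted_one_phase : adapted B `[0, s] Y.
Proof.
have := @adapted_refl_end _ _ _ _ _ bmB b v 0 s (fun=> y) (lexx 0) s0 _ (fun=> y0).
by rewrite add0r; apply; exact: adapted_cst.
Qed.

Let mY : measurable_fun setT Y.
Proof. exact: (adapted_measurable mB adapted_one_phase). Qed.

Lemma fine_lcdf_cst : fine \o lcdf P (fun=> y) = \1_`]y, +oo[ :> (R -> R).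
Proof.
apply/funext => u; rewrite /= /lcdf indicE; have [yu|uy] := ltP y u.
  rewrite (_ : [set _ | _] = setT) ?probability_setT; last by apply/seteqP.
  by rewrite mem_set//= in_itv/= yu.
rewrite (_ : [set _ | _] = set0) ?measure0; last first.
  by apply/seteqP; split => w //=; rewrite ltNge uy.
by rewrite memNset//= in_itv/= andbT ltNge uy.
Qed.

Lemma one_phase_law x : 0 <= x -> fine (lcdf P Y x) = rcdf b v s x y.
Proof.
rewrite le_eqVlt => /predU1P[<-|x0].
  rewrite rcdf0 /lcdf (_ : [set w | _] = set0) ?measure0//.
  apply/seteqP; split => w //= Yw; have s0' : 0 <= 0 + s by rewrite add0r ltW.
  have := refl_spec_ge0 s0' (wiener_reflP b v w y bmB (lexx 0) s0').
  by rewrite leNgt Yw.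
rewrite (@refl_end_law _ _ _ _ _ bmB b v v0 0 s (fun=> y) (lexx 0) s0 _ (fun=> y0))//.
  by rewrite fine_lcdf_cst rflow_gt.
exact: adapted_cst.
Qed.

(** Hidden in the formula, but immediate for the distribution function that it represents. *)
Lemma rcdf01 x : 0 <= x -> 0 <= rcdf b v s x y <= 1.
Proof.
by move=> /one_phase_law <-; have := lcdf01 P x mY; rewrite lcdf_fin// !lee_fin.
Qed.

Lemma rcdf_nondecreasing x x' : 0 <= x -> x <= x' -> rcdf b v s x y <= rcdf b v s x' y.
Proof.
move=> x0 xx'; rewrite -!one_phase_law//; last exact: le_trans xx'.
by rewrite -lee_fin -!lcdf_fin//; exact: lcdf_nondecreasing.
Qed.

Lemma rhat_ge0 x : 0 < x -> 0 <= rhat b v x s y.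
Proof.
(* The derivative test used below is for strictly increasing functions, hence the added slope
   [e]. *)
move=> x0; apply/ler_addgt0Pr => e e0; pose g z := rcdf b v s z y + e * z.
have dg (z : R) : is_derive z (1 : R) g (rhat b v z s y + e).
  have := is_deriveD (is_derive_rcdf b v0 z y s0) (is_deriveZ e (is_derive_id z (1 : R))).
  by rewrite scaler1.
have -> : rhat b v x s y + e = g^`()%classic x.
  by rewrite derive1E; case: (dg x) => _ <-.
apply: (@incr_derive1_ge0_itvy R g false 0 x).
- by move=> z _; case: (dg z).
- move=> z z'; rewrite !in_itv/= !andbT => z0 _ zz'.
  by rewrite /g ler_ltD// ?ltr_pM2l// rcdf_nondecreasing// ltW.
- by rewrite in_itv/= andbT.
Qed.

(** Extended by zero because positivity is known for [z > 0] only; this is the density on the whole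
    line of the position after one phase. *)
Definition rhat_pos (z : R) : R := (fun z => rhat b v z s y) \_ `]0, +oo[ z.

Lemma rhat_pos_ge0 z : 0 <= rhat_pos z.
Proof.
rewrite /rhat_pos patchE; case: ifPn => // /set_mem /=; rewrite in_itv/= andbT.
exact: rhat_ge0.
Qed.

Lemma measurable_rhat_pos : measurable_fun setT rhat_pos.
Proof.
apply/(measurable_restrictT _ _).1 => //; apply: measurable_funTS.
by apply: continuous_measurable_fun; exact: rhat_continuous.
Qed.

(** The fundamental theorem of calculus with [rcdf0]: the law has no atom at the boundary. *)
Lemma integral_rhat_pos x : 0 < x ->
  (\int[leb]_z (rhat_pos z * \1_`]z, +oo[ x)%:E = (rcdf b v s x y)%:E)%E.
Proof.
move=> x0.
transitivity (\int[leb]_(z in `]0%R, x[) (rhat b v z s y)%:E)%E.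
  rewrite [RHS]integral_mkcond; apply: eq_integral => z _.
  rewrite /rhat_pos !patchE indicE.
  have -> : (x \in `]z, +oo[%classic) = (z < x).
    by apply/idP/idP; rewrite !inE/= in_itv/= andbT.
  have -> : (z \in `]0, +oo[%classic) = (0 < z).
    by apply/idP/idP; rewrite !inE/= in_itv/= andbT.
  have -> : (z \in `]0, x[%classic) = (0 < z < x).
    by apply/idP/idP; rewrite !inE/= in_itv/=.
  by case: (ltP 0 z); case: (ltP z x) => _ _; rewrite /= ?mulr1 ?mulr0 ?mul0r.
have mr : measurable_fun setT (fun z => (rhat b v z s y)%:E).
  by apply/measurable_EFinP; apply: continuous_measurable_fun; exact: rhat_continuous.
rewrite integral_itv_bndo_bndc; last exact: measurable_funTS.
rewrite integral_itv_obnd_cbnd; last exact: measurable_funTS.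
rewrite (@continuous_FTC2 _ _ (rcdf b v s ^~ y))//.
- by rewrite rcdf0 sube0.
- by apply: continuous_subspaceT; exact: rhat_continuous.
- have cr (z : R) : {for z, continuous (rcdf b v s ^~ y)}.
    apply: differentiable_continuous; apply/derivable1_diffP.
    by case: (is_derive_rcdf b v0 z y s0).
  split.
  + by move=> z _; case: (is_derive_rcdf b v0 z y s0).
  + by apply: cvg_at_right_filter; exact: cr.
  + by apply: cvg_at_left_filter; exact: cr.
- by move=> z _; rewrite derive1E; case: (is_derive_rcdf b v0 z y s0).
Qed.

Lemma integral_rhat_pos_le1 : (\int[leb]_z (rhat_pos z)%:E <= 1)%E.
Proof.
pose g (n : nat) (z : R) := (rhat_pos z * \1_`]z, +oo[ (n.+1%:R : R))%:E.
have mg n : measurable_fun setT (g n).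
  apply/measurable_EFinP; apply: measurable_funM; first exact: measurable_rhat_pos.
  rewrite (_ : (fun z => _) = \1_`]-oo, (n.+1%:R : R)[); first exact: measurable_indic.
  apply/funext => z; rewrite !indicE; congr (nat_of_bool _)%:R.
  by apply/idP/idP; rewrite !inE/= !in_itv/= andbT.
have g0 n z : setT z -> (0 <= g n z)%E.
  by move=> _; rewrite lee_fin mulr_ge0 ?rhat_pos_ge0.
have ndg z : setT z -> {homo g ^~ z : n m / (n <= m)%N >-> (n <= m)%E}.
  move=> _ n m nm; rewrite lee_fin ler_wpM2l ?rhat_pos_ge0// !indicE ler_nat.
  have [/set_mem/=|//] := boolP (_ \in _); rewrite in_itv/= andbT => zn.
  rewrite mem_set//= in_itv/= andbT (lt_le_trans zn)//.
  by rewrite ler_nat.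
have H := @cvg_monotone_convergence _ _ R leb setT measurableT g mg g0 ndg.
have -> : (\int[leb]_z (rhat_pos z)%:E = \int[leb]_z limn (g ^~ z))%E.
  apply: eq_integral => z _; apply/esym/cvg_lim => //; apply: cvg_near_cst.
  have : \forall n \near \oo, z < n%:R by exact: nbhs_infty_gtr.
  apply: filterS => n zn; rewrite /g indicE mem_set ?mulr1//=.
  by rewrite in_itv/= andbT (lt_trans zn)// ltr_nat.
rewrite -(cvg_lim _ H)//; apply: lime_le; first by apply/cvg_ex; eexists; exact: H.
apply: nearW => n; rewrite integral_rhat_pos// lee_fin.
by have /andP[] := @rcdf01 n.+1%:R (ler0n _ _).
Qed.

Lemma integrable_rhat_pos : leb.-integrable setT (EFin \o rhat_pos).
Proof.
apply/integrableP; split; first by apply/measurable_EFinP; exact: measurable_rhat_pos.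
rewrite (_ : (\int[leb]_z `|(EFin \o rhat_pos) z| = \int[leb]_z (rhat_pos z)%:E)%E).
  by apply: le_lt_trans integral_rhat_pos_le1 _; exact: ltry.
by apply: eq_integral => z _; rewrite gee0_abs// lee_fin rhat_pos_ge0.
Qed.

End one_phase.

(** * Switching at a deterministic time *)

Section two_phases.
Context d (T : measurableType d) (R : realType) (P : probability T R).
Variable B : R -> T -> R.
Hypothesis bmB : brownian_motion P B.
Variables b1 v1 b2 v2 : R.
Hypothesis v10 : 0 < v1.
Hypothesis v20 : 0 < v2.
Variables (t y : R).
Hypothesis t0 : 0 < t.
Hypothesis y0 : 0 <= y.
Local Notation leb := (@lebesgue_measure R).
Local Notation W1 := (wiener B b1 v1).
Local Notation W2 := (wiener B b2 v2).

(* The position at time [t] when the environment switches at time [tau]. *)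
Definition two_phase (tau : R) (w : T) : R := refl (W2 w) tau t (refl (W1 w) 0 tau y).

Section fixed_switch.
Variable tau : R.
Hypothesis tau0 : 0 < tau.
Hypothesis taut : tau < t.

Local Notation V := (refl_end B b1 v1 0 tau (fun=> y)).

Let V_ge0 w : 0 <= V w.
Proof.
have tau0' : 0 <= 0 + tau by rewrite add0r ltW.
exact: refl_spec_ge0 tau0' (wiener_reflP b1 v1 w y bmB (lexx 0) tau0').
Qed.

Let aV : adapted B `[0, tau] V. Proof. exact: (adapted_one_phase bmB b1 v1 tau0 y0). Qed.

Let ts0 : 0 < t - tau. Proof. by rewrite subr_gt0. Qed.

Let two_phaseE : two_phase tau = refl_end B b2 v2 tau (t - tau) V.
Proof. by apply/funext => w; rewrite /two_phase /refl_end add0r [tau + _]addrC subrK. Qed.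

Lemma adapted_two_phase : adapted B `[0, t] (two_phase tau).
Proof.
rewrite two_phaseE.
have := @adapted_refl_end _ _ _ _ _ bmB b2 v2 tau (t - tau) V (ltW tau0) ts0 aV V_ge0.
by rewrite [tau + _]addrC subrK.
Qed.

Let mV : measurable_fun setT V.
Proof. exact: (adapted_measurable (bm_measurable bmB) aV). Qed.

Let f := fine \o lcdf P V.

Let f01 u : 0 <= f u <= 1.
Proof. by have := lcdf01 P u mV; rewrite lcdf_fin// !lee_fin. Qed.

Let fE u : (f u)%:E = (\int[leb]_z (rhat_pos b1 v1 tau y z * \1_`]z, +oo[ u)%:E)%E.
Proof.
have [u0|u0] := ltP 0 u.
  rewrite integral_rhat_pos// /f /=.
  by rewrite (one_phase_law bmB b1 v10 tau0 y0 (ltW u0)).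
rewrite /f /= /lcdf (_ : [set w | _] = set0); last first.
  by apply/seteqP; split => w //=; have := V_ge0 w; lra.
rewrite measure0; apply/esym; apply: integral0_eq => z _.
rewrite /rhat_pos patchE; case: ifPn => [|_]; last by rewrite mul0r.
rewrite inE/= in_itv/= andbT => z0; rewrite indicE memNset ?mulr0//= in_itv/= andbT.
by apply/negP; rewrite -leNgt (le_trans u0)// ltW.
Qed.

Lemma two_phase_law_pos x : 0 < x -> fine (lcdf P (two_phase tau) x) =
  \int[leb]_z (rhat_pos b1 v1 tau y z * rcdf b2 v2 (t - tau) x z).
Proof.
move=> x0; rewrite two_phaseE.
rewrite (@refl_end_law _ _ _ _ _ bmB b2 v2 v20 tau (t - tau) V (ltW tau0) ts0 aV V_ge0 x x0).
apply: rflow_mixture => //.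
- exact: (integrable_rhat_pos bmB).
- by move=> z; exact: (rhat_pos_ge0 bmB).
- exact: measurable_fine_lcdf.
Qed.

Lemma two_phase_lcdf0 : lcdf P (two_phase tau) 0 = 0%E.
Proof.
rewrite two_phaseE /lcdf (_ : [set w | _] = set0) ?measure0//.
apply/seteqP; split => w //= Yw.
have tE : tau <= tau + (t - tau) by rewrite lerDl ltW.
have := refl_spec_ge0 tE (wiener_reflP b2 v2 w (V w) bmB (ltW tau0) tE).
by rewrite leNgt Yw.
Qed.

Lemma two_phase_law x : 0 <= x -> fine (lcdf P (two_phase tau) x) =
  \int[leb]_z (rhat_pos b1 v1 tau y z * rcdf b2 v2 (t - tau) x z).
Proof.
rewrite le_eqVlt => /predU1P[<-|]; last exact: two_phase_law_pos.
rewrite two_phase_lcdf0 /Rintegral integral0_eq// => z _.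
by rewrite rcdf0 mulr0.
Qed.

Lemma two_phase_lcdf_continuous x : 0 < x ->
  {for x, continuous (fine \o lcdf P (two_phase tau))}.
Proof.
move=> x0.
have mf : measurable_fun setT f by exact: measurable_fine_lcdf.
have H z : 0 < z -> (fine \o lcdf P (two_phase tau)) z = rflow b2 v2 (t - tau) f z.
  move=> z0; rewrite /= two_phaseE.
  exact: (@refl_end_law _ _ _ _ _ bmB b2 v2 v20 tau (t - tau) V (ltW tau0) ts0 aV V_ge0).
have cr := @rflow_continuous R b2 v2 v20 (t - tau) f ts0 mf f01 x.
rewrite /prop_for /continuous_at (H _ x0); apply: cvg_trans cr; apply: near_eq_cvg.
by near=> z; rewrite (H z)//; near: z; exact: lt_nbhsr.
Unshelve. all: by end_near. Qed.

End fixed_switch.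

End two_phases.

(** * Dependence on the switching time *)

Section two_refl.
Context {R : realType}.
Variables (W1 W2 : R -> R) (t y : R).
Hypothesis cW1 : {within `[0, +oo[, continuous W1}.
Hypothesis cW2 : {within `[0, +oo[, continuous W2}.
Hypothesis y0 : 0 <= y.

Let two_refl tau := refl W2 tau t (refl W1 0 tau y).

(** From [q] on, both paths are driven by [W2], so their distance at [t] is at most that at [q]. On
    [[p, q]] each has moved by at most [e] from the common position [r]. *)
Lemma two_refl_dist (p q e : R) : 0 <= p -> p <= q -> q <= t ->
  (forall u u', p <= u <= q -> p <= u' <= q -> `|W1 u - W1 u'| <= e) ->
  (forall u u', p <= u <= q -> p <= u' <= q -> `|W2 u - W2 u'| <= e) ->
  `|two_refl q - two_refl p| <= 2 * e.
Proof.
move=> p0 pq qt osc1 osc2.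
have P (W : R -> R) (a b v : R) : {within `[0, +oo[, continuous W} -> 0 <= a -> a <= b ->
    refl_spec W a b v (refl W a b v).
  by move=> cW a0 ab; apply: reflP => //; exact: within_continuousS.
have q0 := le_trans p0 pq.
set r := refl W1 0 p y.
have rP : refl_spec W1 0 p y r by exact: P.
have r0 : 0 <= r by exact: refl_spec_ge0 rP.
have r1P : refl_spec W1 p q r (refl W1 0 q y).
  rewrite (_ : refl W1 0 q y = refl W1 p q r); first exact: P.
  have H := refl_spec_flow p0 pq rP (P W1 p q r cW1 p0 pq).
  exact: refl_spec_uniq (P W1 0 q y cW1 _ q0) H.
have r2P : refl_spec W2 p q r (refl W2 p q r) by exact: P.
have YpP : refl_spec W2 q t (refl W2 p q r) (two_refl p).
  rewrite (_ : two_refl p = refl W2 q t (refl W2 p q r)); first exact: P.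
  have H := refl_spec_flow pq qt r2P (P W2 q t _ cW2 q0 qt).
  exact: refl_spec_uniq (P W2 p t r cW2 p0 (le_trans pq qt)) H.
have := refl_spec_lipschitz (P W2 q t (refl W1 0 q y) cW2 q0 qt) YpP.
have := refl_spec_small pq r0 osc1 r1P; have := refl_spec_small pq r0 osc2 r2P.
move=> H2 H1 H3; apply: le_trans H3 _; rewrite distrC in H2.
rewrite -[_ - refl W2 p q r](subrKA r); apply: le_trans (ler_normD _ _) _.
by rewrite mulrDl mul1r lerD.
Qed.

Lemma two_refl_cvg (tau : R) (taun : nat -> R) : 0 <= tau <= t ->
  (forall n, 0 <= taun n <= t) -> taun n @[n --> \oo] --> tau ->
  two_refl (taun n) @[n --> \oo] --> two_refl tau.
Proof.
move=> /andP[tau0 taut] taun0t ctau; apply/cvgrPdist_le => e e0.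
have e40 : 0 < e / 4 by rewrite divr_gt0.
have Dtau : `[0, +oo[%classic tau by rewrite /= in_itv/= tau0.
have [d1 d10 H1] := within_continuous_dist cW1 Dtau e40.
have [d2 d20 H2] := within_continuous_dist cW2 Dtau e40.
have m0 : 0 < Num.min d1 d2 by rewrite lt_min d10.
move/cvgrPdist_lt: ctau => /(_ _ m0); apply: filterS => n.
rewrite lt_min => /andP[n1 n2]; have /andP[tn0 tnt] := taun0t n.
have osc (W : R -> R) (dl a b : R) : `|a - b| < dl -> tau = a \/ tau = b -> 0 <= a ->
    (forall u, `[0, +oo[%classic u -> `|u - tau| < dl -> `|W u - W tau| < e / 4) ->
    forall u u', a <= u <= b -> a <= u' <= b -> `|W u - W u'| <= e / 2.
  move=> ab tE a0 H.
  have K u : a <= u <= b -> `|W u - W tau| < e / 4.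
    move=> /andP[au ub]; apply: H; first by rewrite /= in_itv/= (le_trans a0).
    apply: le_lt_trans ab; rewrite [leRHS]ler0_norm ?subr_le0 ?(le_trans au)//.
    by case: tE => ->; rewrite ler_norml; lra.
  move=> u u' /K Ku /K Ku'; rewrite -[_ - _](subrKA (W tau)).
  apply: le_trans (ler_normD _ _) _; rewrite (distrC _ (W u')).
  have := lerD (ltW Ku) (ltW Ku'); move: (_ + _) => z; lra.
have [le|/ltW le] := leP tau (taun n).
  rewrite distrC (_ : e = 2 * (e / 2)); last by field.
  by apply: two_refl_dist => //; [apply: osc H1|apply: osc H2] => //; left.
rewrite (_ : e = 2 * (e / 2)); last by field.
by apply: two_refl_dist => //; [apply: (osc _ d1)|apply: (osc _ d2)] => //;
  rewrite 1?distrC//; right.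
Qed.

End two_refl.

Section switch_time.
Context d (T : measurableType d) (R : realType) (P : probability T R).
Variable B : R -> T -> R.
Hypothesis bmB : brownian_motion P B.
Variables b1 v1 b2 v2 : R.
Hypothesis v10 : 0 < v1.
Hypothesis v20 : 0 < v2.
Variables (t y : R).
Hypothesis t0 : 0 < t.
Hypothesis y0 : 0 <= y.
Local Notation Y := (two_phase B b1 v1 b2 v2 t y).

(** The last grid node is [t] itself; a switch there leaves the position unchanged. *)
Lemma two_phase_end : Y t = refl_end B b1 v1 0 t (fun=> y).
Proof.
apply/funext => w; rewrite /two_phase /refl_end add0r.
have t0' := ltW t0.
have r0 := refl_spec_ge0 t0' (wiener_reflP b1 v1 w y bmB (lexx 0) t0').
have H := wiener_reflP b2 v2 w (refl (wiener B b1 v1 w) 0 t y) bmB t0' (lexx t).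
apply: refl_spec_uniq H _; split.
- by rewrite subrr addr0.
- move=> u tut; have -> : u = t by apply: le_anti; rewrite andbC.
  by rewrite subrr.
- by left; rewrite subrr addr0.
Qed.

Lemma adapted_switch (tau : R) : 0 < tau <= t -> adapted B `[0, t] (Y tau).
Proof.
move=> /andP[tau0]; rewrite le_eqVlt => /predU1P[->|taut].
  by rewrite two_phase_end; exact: (adapted_one_phase bmB b1 v1 t0 y0).
exact: (adapted_two_phase bmB b1 v1 b2 v2 y0 tau0 taut).
Qed.

Lemma measurable_switch (tau : R) : 0 < tau <= t -> measurable_fun setT (Y tau).
Proof. by move=> /adapted_switch; apply: adapted_measurable (bm_measurable bmB). Qed.

(** Pointwise convergence of the positions gives the lower bound since the event is open; the upper
    bound uses that the limit distribution function is continuous at [x]. *)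
Lemma switch_lcdf_cvg (x tau : R) (taun : nat -> R) : 0 < x -> 0 < tau < t ->
  (forall n, 0 < taun n <= t) -> taun n @[n --> \oo] --> tau ->
  fine (lcdf P (Y (taun n)) x) @[n --> \oo] --> fine (lcdf P (Y tau) x).
Proof.
move=> x0 /andP[tau0 taut] taun0t ctau.
have cY w : Y (taun n) w @[n --> \oo] --> Y tau w.
  apply: two_refl_cvg => //.
  - exact: (@wiener_continuous _ _ _ _ _ bmB b1 v1 w).
  - exact: (@wiener_continuous _ _ _ _ _ bmB b2 v2 w).
  - by rewrite !ltW.
  - by move=> n; have /andP[/ltW-> ->] := taun0t n.
have mY : measurable_fun setT (Y tau) by apply: measurable_switch; rewrite tau0 ltW.
have mYn n : measurable_fun setT (Y (taun n)) by exact: measurable_switch.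
apply/cvgrPdist_le => e e0; have e20 : 0 < e / 2 by rewrite divr_gt0.
have [dl dl0 Gdl] : exists2 dl : R, 0 < dl &
    fine (lcdf P (Y tau) (x + dl)) <= fine (lcdf P (Y tau) x) + e / 2.
  have /cvgrPdist_lt/(_ _ e20)[dl /= dl0 H] :=
    @two_phase_lcdf_continuous _ _ _ P _ bmB b1 v1 b2 v2 v20 t y y0 tau tau0 taut x x0.
  exists (dl / 2); first by rewrite divr_gt0.
  have := H (x + dl / 2); rewrite /ball/= opprD addrA subrr sub0r normrN gtr0_norm ?divr_gt0//.
  rewrite ltr_pdivrMr// mulr_natr mulr2n ltrDl => /(_ dl0).
  by rewrite ltr_norml; move: (fine _) (fine _) => p q; lra.
have Lo := probability_liminf P (measurable_lt_set x mY) (fun n => measurable_lt_set x (mYn n)).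
have {}Lo := Lo e (fun w Yw => cvgr_lt _ (cY w) _ Yw) e0.
have Up := probability_liminf P (measurableC (measurable_lt_set (x + dl) mY))
  (fun n => measurableC (measurable_lt_set x (mYn n))).
have ev w : (~` [set w | Y tau w < x + dl]) w ->
    \forall n \near \oo, (~` [set w | Y (taun n) w < x]) w.
  move=> /= /negP; rewrite -leNgt => xw.
  have : \forall n \near \oo, Y tau w - dl < Y (taun n) w.
    by apply: (cvgr_gt (Y tau w)) => //; rewrite ltrBlDr ltrDl.
  by apply: filterS => n H; apply/negP; rewrite -leNgt; lra.
have {}Up := Up (e / 2) ev e20.
near=> n.
have lo : fine (lcdf P (Y tau) x) - e <= fine (lcdf P (Y (taun n)) x).
  by near: n; exact: Lo.
have : fine (P (~` [set w | Y tau w < x + dl])) - e / 2 <=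
    fine (P (~` [set w | Y (taun n) w < x])) by near: n; exact: Up.
rewrite !probability_setC; [|exact: measurable_lt_set..].
rewrite -!/(lcdf P _ _) (lcdf_fin P _ mY) (lcdf_fin P _ (mYn _)) -!EFinB/=.
move: Gdl lo; move: (fine _) (fine _) (fine _) => p q r; rewrite ler_norml; lra.
Unshelve. all: by end_near. Qed.

End switch_time.

(** * Switching at an exponential time *)

Section grid.
Context {R : realType}.
Variable t : R.
Hypothesis t0 : 0 < t.

Definition grid_cell (n : nat) (u : R) : nat := Num.truncn (u * n.+1%:R / t).

(** The right end of cell [j], so that the rounded time is positive even for [u = 0]. *)
Definition grid_node (n j : nat) : R := j.+1%:R * t / n.+1%:R.

Local Notation grid_up n u := (grid_node n (grid_cell n u)).

Lemma grid_cell_lt (n : nat) (u : R) : 0 <= u < t -> (grid_cell n u < n.+1)%N.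
Proof.
move=> /andP[u0 ut]; rewrite /grid_cell truncn_lt_nat; last by rewrite divr_ge0 ?mulr_ge0// ltW.
by rewrite ltr_pdivrMr// mulrC ltr_pM2l.
Qed.

Lemma grid_node_itv (n j : nat) : (j < n.+1)%N -> 0 < grid_node n j <= t.
Proof.
move=> jn; rewrite /grid_node divr_gt0 ?mulr_gt0//= ler_pdivrMr// [leRHS]mulrC.
by rewrite ler_pM2r// ler_nat.
Qed.

Lemma grid_up_itv (n : nat) (u : R) : 0 <= u < t -> 0 < grid_up n u <= t.
Proof. by move=> /(grid_cell_lt n)/grid_node_itv. Qed.

Lemma grid_up_near (n : nat) (u : R) : 0 <= u -> u <= grid_up n u <= u + t / n.+1%:R.
Proof.
move=> u0; have z0 : 0 <= u * n.+1%:R / t by rewrite divr_ge0 ?mulr_ge0// ltW.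
have /andP[] := truncn_itv z0; rewrite -/(grid_cell n u).
rewrite ler_pdivlMr// ltr_pdivrMr// => l1 l2.
rewrite /grid_node ler_pdivlMr// (ltW l2)/= -natr1 mulrDl mul1r mulrDl lerD2r.
by rewrite ler_pdivrMr.
Qed.

Lemma grid_up_cvg (u : R) : 0 <= u -> grid_up n u @[n --> \oo] --> u.
Proof.
move=> u0; apply: (@squeeze_cvgr _ _ _ _ (fun=> u) (fun n => u + t / n.+1%:R)).
- by apply: nearW => n; exact: grid_up_near.
- exact: cvg_cst.
- rewrite -[X in _ --> X]addr0; apply: cvgD; first exact: cvg_cst.
  rewrite -[X in _ --> X](mulr0 t); apply: cvgM; first exact: cvg_cst.
  exact: cvg_harmonic.
Qed.

Lemma measurable_grid_cell (n j : nat) : measurable [set u | grid_cell n u = j].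
Proof.
have mf : measurable_fun setT (fun u : R => (grid_cell n u)%:R : R).
  apply: nondecreasing_measurable => // u u' uu'; rewrite ler_nat; apply: le_truncn.
  by rewrite ler_pM2r ?invr_gt0// ler_pM2r.
have := mf measurableT [set (j%:R : R)] (measurable_set1 _); rewrite setTI.
congr (measurable _); apply/seteqP; split => u /=; last by move->.
by move/eqP; rewrite eqr_nat => /eqP.
Qed.

Lemma measurable_grid_fun (n : nat) (h : nat -> R) :
  measurable_fun setT (h \o grid_cell n).
Proof.
move=> _ A mA; rewrite setTI.
rewrite (_ : _ @^-1` _ = \bigcup_(j in [set j | A (h j)]) [set u | grid_cell n u = j]).
  by apply: bigcup_measurable => j _; exact: measurable_grid_cell.
by apply/seteqP; split => u /= => [Au|[j Aj uj]]; [|by rewrite uj]; exists (grid_cell n u).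
Qed.

End grid.

Section independent_switch.
Context d (T : measurableType d) (R : realType) (P : probability T R).
Variables (B : R -> T -> R) (E : R -> T -> env) (S : T -> R) (eta p : R).
Hypothesis bmB : brownian_motion P B.
Hypothesis envP : environment P eta p E S.
Hypothesis ind : independent_sources P B E S.
Hypothesis eta0 : 0 < eta.
Variables b1 v1 b2 v2 : R.
Hypothesis v10 : 0 < v1.
Hypothesis v20 : 0 < v2.
Variables (t y : R).
Hypothesis t0 : 0 < t.
Hypothesis y0 : 0 <= y.
Local Notation leb := (@lebesgue_measure R).
Local Notation Y := (two_phase B b1 v1 b2 v2 t y).
Local Notation pdf := (exponential_pdf eta).

Let E1 : set T := [set w | E 0 w = env1].

Let mE1 : measurable E1. Proof. exact: (env_measurable envP). Qed.

Let mSA (A : set R) : measurable A -> measurable (S @^-1` A).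
Proof. by move=> mA; rewrite -[X in measurable X]setTI; exact: (env_holding_measurable envP). Qed.

Let mpdf : measurable_fun setT pdf. Proof. exact: measurable_exponential_pdf. Qed.

Let pdf0 u : 0 <= pdf u. Proof. by apply: exponential_pdf_ge0; exact: ltW. Qed.

Lemma prob_env1_switch (Z : T -> R) (x : R) (A : set R) :
  adapted B setT Z -> measurable A ->
  P ([set w | Z w < x] `&` E1 `&` S @^-1` A) =
  (lcdf P Z x * p%:E * exponential_prob eta A)%E.
Proof.
move=> aZ mA; rewrite -(env_initial envP) -(env_holding_law envP)//; apply: ind => //.
rewrite (_ : [set w | Z w < x] = Z @^-1` `]-oo, x[); first exact: aZ.
by apply/seteqP; split => w; rewrite /= in_itv.
Qed.

Definition switch_cdf (x u : R) : R := fine (lcdf P (Y u) x).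

Let cell n j : set R := [set u | 0 <= u < t /\ grid_cell t n u = j].

Let mcell n j : measurable (cell n j).
Proof.
rewrite (_ : cell n j = `[0, t[ `&` [set u | grid_cell t n u = j]).
  by apply: measurableI => //; exact: measurable_grid_cell.
by apply/seteqP; split => u /=; rewrite in_itv.
Qed.

Let tcell n D : trivIset D (cell n).
Proof. by move=> i j _ _ [u [[_ <-] [_ <-]]]. Qed.

Let cellU n : \big[setU/set0]_(j < n.+1) cell n j = `[0, t[%classic.
Proof.
rewrite -bigcup_mkord; apply/seteqP; split => u /=; rewrite in_itv/=.
  by move=> [j _ []].
by move=> ut; exists (grid_cell t n u) => //=; exact: grid_cell_lt.
Qed.

Let An n x : set T := [set w | [/\ E 0 w = env1, 0 <= S w < t &
  Y (grid_node t n (grid_cell t n (S w))) w < x]].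

Let mY n j : (j < n.+1)%N -> measurable_fun setT (Y (grid_node t n j)).
Proof. by move=> jn; apply: (measurable_switch bmB) => //; exact: grid_node_itv. Qed.

Let Ancell n x j := [set w | Y (grid_node t n j) w < x] `&` E1 `&` S @^-1` cell n j.

Let mAncell n x j : (j < n.+1)%N -> measurable (Ancell n x j).
Proof.
move=> jn; apply: measurableI; last exact: mSA.
by apply: measurableI => //; apply: measurable_lt_set; exact: mY.
Qed.

Let AnE n x : An n x = \big[setU/set0]_(j < n.+1) Ancell n x j.
Proof.
rewrite -bigcup_mkord; apply/seteqP; split => w /=.
  move=> [Ew Sw Yw]; exists (grid_cell t n (S w)) => //=; exact: grid_cell_lt.
by move=> [j _ [[/= Yw Ew] [Sw cj]]]; split => //; rewrite cj.
Qed.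

Let mAn n x : measurable (An n x).
Proof.
by rewrite AnE -bigcup_mkord; apply: bigcup_measurable => j /= /(mAncell x).
Qed.

(** On each cell the rounded switching time is a constant, so independence factors the probability;
    the sum over cells is the integral of a step function. *)
Lemma prob_grid_switch n x : P (An n x) =
  (p%:E * \int[leb]_(u in `[0%R, t[)
    (pdf u * switch_cdf x (grid_node t n (grid_cell t n u)))%:E)%E.
Proof.
rewrite AnE measure_semi_additive_ord_I; last 3 first.
- by move=> k; exact: mAncell.
- by move=> i j _ _ [w [[_ [_ <-]] [_ [_ <-]]]].
- by rewrite -AnE.
have mf D : measurable_fun D (fun u =>
    (pdf u * switch_cdf x (grid_node t n (grid_cell t n u)))%:E).
  apply: measurable_funTS; apply/measurable_EFinP; apply: measurable_funM => //.
  exact: (measurable_grid_fun t0 n (fun j => switch_cdf x (grid_node t n j))).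
have s0 u : 0 <= switch_cdf x u by apply: fine_ge0; exact: measure_ge0.
rewrite -(cellU n) -(big_mkord xpredT (cell n)).
rewrite (@ge0_integral_bigsetU _ _ _ leb _ (cell n) _ (index_iota 0 n.+1) (mcell n) (iota_uniq _ _)
  (@tcell n _) (mf _)); last by move=> u _; rewrite lee_fin mulr_ge0.
rewrite big_mkord ge0_sume_distrr; last first.
  by move=> j _; apply: integral_ge0 => u _; rewrite lee_fin mulr_ge0.
apply: eq_bigr => j _.
have aY : adapted B setT (Y (grid_node t n j)).
  by apply: adaptedS (adapted_switch bmB b1 v1 b2 v2 t0 y0 (grid_node_itv t0 (ltn_ord j))).
apply: etrans (prob_env1_switch x aY (mcell n j)) _.
have -> : (\int[leb]_(u in cell n j)
    (pdf u * switch_cdf x (grid_node t n (grid_cell t n u)))%:E =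
    \int[leb]_(u in cell n j) ((pdf u)%:E * (switch_cdf x (grid_node t n j))%:E))%E.
  by apply: eq_integral => u /set_mem[_ ->].
rewrite ge0_integralZr//.
- rewrite (lcdf_fin P _ (mY (ltn_ord j))) -/(switch_cdf x _) [(_ * p%:E)%E]muleC -muleA.
  by congr (_ * _)%E; rewrite muleC.
- exact: mcell.
- by apply/measurable_EFinP; exact: measurable_funTS.
- by move=> u _; rewrite lee_fin.
- by rewrite lee_fin.
Qed.

Let integrable_pdf (D : set R) : measurable D -> leb.-integrable D (EFin \o pdf).
Proof.
move=> mD; apply: (@integrableS _ _ _ leb setT) => //; apply/integrableP; split.
  exact/measurable_EFinP.
under eq_integral do rewrite gee0_abs ?lee_fin//.
by rewrite [X in (X < _)%E]integral_exponential_pdf// ltry.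
Qed.

Let pdf_mix_le (k : R -> R) u : 0 <= k u <= 1 -> (`|(pdf u * k u)%:E| <= (EFin \o pdf) u)%E.
Proof.
by move=> /andP[k0 k1]; rewrite gee0_abs ?lee_fin ?mulr_ge0// ler_piMr.
Qed.

Let measurable_pdf_mix (D : set R) (k : R -> R) : measurable_fun D k ->
  measurable_fun D (fun u => (pdf u * k u)%:E).
Proof.
move=> mk; apply/measurable_EFinP; apply: measurable_funM => //.
exact: measurable_funTS.
Qed.

Lemma integrable_exponential_mix (D : set R) (k : R -> R) : measurable D ->
  measurable_fun D k -> (forall u, D u -> 0 <= k u <= 1) ->
  leb.-integrable D (fun u => (pdf u * k u)%:E).
Proof.
move=> mD mk k01; have ip := integrable_pdf mD; apply: (le_integrable _ _ _ ip) => //.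
  exact: measurable_pdf_mix.
by move=> u Du; rewrite [leRHS]gee0_abs ?lee_fin//; apply: pdf_mix_le; exact: k01.
Qed.

(** Dominated convergence under the exponential density. It serves both to refine the grid and to
    approach [x] from the left. *)
Lemma exponential_mix_cvg (g : nat -> R -> R) (h : R -> R) :
  (forall n, measurable_fun `]0, t[ (g n)) ->
  (forall n u, `]0, t[%classic u -> 0 <= g n u <= 1) ->
  (forall u, `]0, t[%classic u -> g n u @[n --> \oo] --> h u) ->
  \int[leb]_(u in `]0, t[) (pdf u * g n u) @[n --> \oo] -->
  \int[leb]_(u in `]0, t[) (pdf u * h u).
Proof.
move=> mg g01 gh.
have mh : measurable_fun `]0, t[ h by exact: measurable_fun_cvg gh.
have h01 u : `]0, t[%classic u -> 0 <= h u <= 1.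
  move=> ut; have cg := gh u ut; have cvg_g : cvgn (g ^~ u) by apply/cvg_ex; exists (h u).
  rewrite -(cvg_lim _ cg)//; apply/andP; split; [apply: limr_ge|apply: limr_le] => //;
  by apply: nearW => n; case/andP: (g01 n u ut).
apply: fine_cvg; rewrite fineK; last first.
  by apply: integrable_fin_num => //; exact: integrable_exponential_mix.
apply: (@dominated_cvg _ _ _ leb _ _ _ _ (EFin \o pdf)) => //.
- by move=> n; exact: measurable_pdf_mix.
- move=> u ut; apply: cvg_EFin; first exact: nearW.
  by apply: cvgM; [exact: cvg_cst|exact: gh].
- exact: integrable_pdf.
- by move=> n u ut; apply: pdf_mix_le => //; exact: g01.
Qed.

Lemma switch_cdf01 x u : 0 < u <= t -> 0 <= switch_cdf x u <= 1.
Proof.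
move=> /(measurable_switch bmB b1 v1 b2 v2 t0 y0) mYu.
by have := lcdf01 P x mYu; rewrite lcdf_fin// !lee_fin.
Qed.

Lemma grid_switch_cdf_cvg x u : 0 < x -> 0 < u < t ->
  switch_cdf x (grid_node t n (grid_cell t n u)) @[n --> \oo] --> switch_cdf x u.
Proof.
move=> x0 ut; have /andP[u0 ut'] := ut.
apply: (switch_lcdf_cvg bmB) => //; last by apply: grid_up_cvg => //; exact: ltW.
by move=> n; apply: grid_up_itv; rewrite // ltW.
Qed.

Lemma measurable_switch_cdf x : 0 < x -> measurable_fun `]0, t[ (switch_cdf x).
Proof.
move=> x0; apply: (@measurable_fun_cvg _ _ _ _
  (fun n u => switch_cdf x (grid_node t n (grid_cell t n u)))).
  move=> n; apply: measurable_funTS.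
  exact: (measurable_grid_fun t0 n (fun j => switch_cdf x (grid_node t n j))).
by move=> u /=; rewrite in_itv/= => ut; exact: grid_switch_cdf_cvg.
Qed.

Definition switch_mix x : R := \int[leb]_(u in `]0, t[) (pdf u * switch_cdf x u).

Lemma prob_grid_switch_cvg x : 0 < x ->
  fine (P (An n x)) @[n --> \oo] --> p * switch_mix x.
Proof.
move=> x0.
pose g n u := switch_cdf x (grid_node t n (grid_cell t n u)).
have mg n D : measurable_fun D (g n).
  apply: measurable_funTS.
  exact: (measurable_grid_fun t0 n (fun j => switch_cdf x (grid_node t n j))).
have g01 n u : 0 <= u < t -> 0 <= g n u <= 1.
  by move=> ut; apply: switch_cdf01; exact: grid_up_itv.
rewrite (_ : (fun n => fine (P (An n x))) =
    (fun n => p * \int[leb]_(u in `]0, t[) (pdf u * g n u))); last first.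
  apply/funext => n; rewrite prob_grid_switch fineM//; last first.
    apply: integrable_fin_num => //; apply: integrable_exponential_mix; [by []|exact: mg|].
    by move=> u /=; rewrite in_itv/= => ut; exact: g01.
  rewrite -integral_itv_obnd_cbnd//.
  by apply: measurable_pdf_mix; exact: mg.
apply: cvgM; first exact: cvg_cst.
apply: exponential_mix_cvg; first by move=> n; exact: mg.
- by move=> n u /=; rewrite in_itv/= => /andP[u0 ut]; apply: g01; rewrite ut ltW.
- by move=> u /=; rewrite in_itv/= => ut; exact: grid_switch_cdf_cvg.
Qed.

(** Closes the gap between [x'] and [x] left by the lower bound on the probability. The [n.+2] keeps
    the argument positive from [n = 0] on. *)
Lemma switch_mix_left_cvg x : 0 < x ->
  switch_mix (x - x / n.+2%:R) @[n --> \oo] --> switch_mix x.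
Proof.
move=> x0.
have xn n : 0 < x - x / n.+2%:R.
  by rewrite subr_gt0 ltr_pdivrMr// ltr_pMr// ltr1n.
apply: exponential_mix_cvg.
- by move=> n; exact: measurable_switch_cdf.
- move=> n u /=; rewrite in_itv/= => /andP[u0 ut].
  by apply: switch_cdf01; rewrite u0 ltW.
- move=> u /=; rewrite in_itv/= => /andP[u0 ut].
  have cG := @two_phase_lcdf_continuous _ _ _ P _ bmB b1 v1 b2 v2 v20 t y y0 u u0 ut x x0.
  have cx : x - x / n.+2%:R @[n --> \oo] --> x.
    rewrite -[X in _ --> X]subr0; apply: cvgB; first exact: cvg_cst.
    rewrite -[X in _ --> X](mulr0 x); apply: cvgM; first exact: cvg_cst.
    by have := @cvg_harmonic R; rewrite -(cvg_shiftS (@harmonic R)).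
  exact: (cvg_comp _ _ cx cG).
Qed.

Variable Z : T -> R.
Hypothesis mZ : measurable_fun setT Z.
Hypothesis ZE : forall w, E 0 w = env1 -> S w <= t -> Z w = Y (S w) w.

Lemma holding_time_gt0 w : E 0 w = env1 -> 0 < S w.
Proof. by move=> Ew; case: ((env_path envP w (lexx 0)).1 Ew). Qed.

Let D : set T := E1 `&` S @^-1` `[0, t[.

Let mD : measurable D. Proof. by apply: measurableI => //; exact: mSA. Qed.

Let Y_cvg w : D w -> Y (grid_node t n (grid_cell t n (S w))) w @[n --> \oo] --> Z w.
Proof.
move=> [/= Ew]; rewrite in_itv/= => /andP[S0 St]; rewrite ZE//; last exact: ltW.
apply: two_refl_cvg => //.
- exact: (@wiener_continuous _ _ _ _ _ bmB b1 v1 w).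
- exact: (@wiener_continuous _ _ _ _ _ bmB b2 v2 w).
- by rewrite S0 ltW.
- by move=> n; have /andP[/ltW -> ->] := grid_up_itv t0 n (introT andP (conj S0 St)).
- exact: grid_up_cvg.
Qed.

Let AnD n x w : D w -> Y (grid_node t n (grid_cell t n (S w))) w < x -> An n x w.
Proof. by move=> [/= Ew]; rewrite in_itv. Qed.

Let AZ x := D `&` [set w | Z w < x].

Let mAZ x : measurable (AZ x).
Proof. by apply: measurableI => //; exact: measurable_lt_set. Qed.

Let prob_switch_le x : 0 < x -> fine (P (AZ x)) <= p * switch_mix x.
Proof.
move=> x0; apply/ler_addgt0Pr => e e0; rewrite -lerBlDr.
have ev w : AZ x w -> \forall n \near \oo, An n x w.
  move=> [Dw Zw].
  have : \forall n \near \oo, Y (grid_node t n (grid_cell t n (S w))) w < x.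
    exact: (cvgr_lt _ (Y_cvg Dw) _ Zw).
  by apply: filterS => n; exact: AnD.
have H := probability_liminf P (mAZ x) (fun n => mAn n x) ev e0.
have cA := prob_grid_switch_cvg x0; rewrite -(cvg_lim _ cA)//.
by apply: limr_ge => //; apply/cvg_ex; eexists; exact: cA.
Qed.

Let fine_measureD (A : set T) : measurable A -> A `<=` D ->
  fine (P (D `\` A)) = fine (P D) - fine (P A).
Proof.
move=> mA AD; rewrite measureD//; last by rewrite ltey_eq fin_num_measure.
by rewrite setIidr// fineB// fin_num_measure.
Qed.

(** Complements are taken inside [D], where [Z w >= x] forces the rounded position above [x']
    eventually. *)
Let prob_switch_ge x x' : 0 < x' -> x' < x -> p * switch_mix x' <= fine (P (AZ x)).
Proof.
move=> x'0 x'x; apply/ler_addgt0Pr => e e0.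
have ev w : (D `\` AZ x) w -> \forall n \near \oo, (D `\` An n x') w.
  move=> [Dw /= NZ]; have Zw : x <= Z w by rewrite leNgt; apply/negP => Zw; exact: NZ.
  have : \forall n \near \oo, x' < Y (grid_node t n (grid_cell t n (S w))) w.
    exact: (cvgr_gt _ (Y_cvg Dw) _ (lt_le_trans x'x Zw)).
  apply: filterS => n Yw; split => // -[_ _].
  by apply/negP; rewrite -leNgt ltW.
have H := probability_liminf P (measurableD mD (mAZ x))
  (fun n => measurableD mD (mAn n x')) ev e0.
have cA := prob_grid_switch_cvg x'0; rewrite -(cvg_lim _ cA)//.
apply: limr_le; first by apply/cvg_ex; eexists; exact: cA.
apply: filterS H => n; rewrite !fine_measureD//.
- by move: (fine _) (fine _) (fine _) => a b c; lra.
- by move=> w [Ew Sw _]; split => //=; rewrite in_itv.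
- by move=> w [].
Qed.

Lemma prob_switch x : 0 < x -> fine (P (E1 `&` S @^-1` `[0, t[ `&` [set w | Z w < x])) =
  p * switch_mix x.
Proof.
move=> x0; apply/eqP; rewrite eq_le prob_switch_le//=.
have cm := switch_mix_left_cvg x0.
have cpm : p * switch_mix (x - x / n.+2%:R) @[n --> \oo] --> p * switch_mix x.
  by apply: cvgM cm; exact: cvg_cst.
rewrite -(cvg_lim _ cpm)//; apply: limr_le; first by apply/cvg_ex; eexists; exact: cpm.
apply: nearW => n; apply: prob_switch_ge.
  by rewrite subr_gt0 ltr_pdivrMr// ltr_pMr// ltr1n.
by rewrite ltrBlDr ltrDl divr_gt0.
Qed.

End independent_switch.

Lemma exponential_prob_gt (R : realType) (eta t : R) : 0 < eta -> 0 <= t ->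
  exponential_prob eta `]t, +oo[ = (expR (- (eta * t)))%:E.
Proof.
move=> eta0 t0; have cE : continuous (fun z : R => - expR (- eta * z)).
  move=> z; apply: cvgN; apply: (cvg_comp (fun z : R => - eta * z)).
    by apply: cvgM; [exact: cvg_cst|exact: cvg_id].
  exact: continuous_expR.
have mpdf : measurable_fun setT (EFin \o exponential_pdf eta).
  by apply/measurable_EFinP; exact: measurable_exponential_pdf.
rewrite /exponential_prob integral_itv_obnd_cbnd; last exact: measurable_funTS.
rewrite (@ge0_continuous_FTC2y _ _ (fun x => - (expR (- eta * x))) _ 0)//.
- by rewrite sub0e EFinN oppeK mulNr.
- by move=> x _; apply: exponential_pdf_ge0; exact: ltW.
- apply: (@continuous_subspaceW R^o _ _ [set` `[0, +oo[%R]).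
    by move=> x /=; rewrite !in_itv/= !andbT; exact: le_trans.
  exact: within_continuous_exponential_pdf.
- rewrite -oppr0; apply: cvgN.
  rewrite (_ : (fun x => expR (- eta * x)) =
               (fun z => expR (- z)) \o (fun z => eta * z)); last first.
    by apply: eq_fun => x; rewrite mulNr.
  apply: (@cvg_comp _ _ _ _ _ _ (pinfty_nbhs R)); last exact: cvgr_expR.
  exact: gt0_cvgMry.
- by apply/cvg_at_right_filter; exact: cE.
- move=> x; rewrite in_itv/= andbT => tx.
  by apply: derive1_exponential_pdf; rewrite in_itv/= andbT (le_lt_trans t0).
Qed.

Section alternating.
Context d (T : measurableType d) (R : realType) (P : probability T R).
Variables (beta omega2 : env -> R) (eta p y : R).
Variables (B : R -> T -> R) (S : T -> R) (L X : R -> T -> R) (E : R -> T -> env).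
Hypothesis aw : alternating_wiener P beta omega2 eta p y B S L X E.
Hypothesis omega0 : forall i, 0 < omega2 i.
Hypothesis eta0 : 0 < eta.
Hypothesis y0 : 0 <= y.
Variable t : R.
Hypothesis t0 : 0 < t.

Local Notation W i := (wiener B (beta i) (omega2 i)).
Local Notation Y := (two_phase B (beta env1) (omega2 env1) (beta env2) (omega2 env2) t y).

Let bmB := aw_brownian aw.
Let envP := aw_environment aw.
Let ind := aw_independent aw.

(** The interval is open on the right so that a segment can end at the switching time, where the
    environment has already changed. *)
Lemma path_segment i w (a c : R) : 0 <= a -> a <= c ->
  (forall u, a <= u < c -> E u w = i) -> X c w = refl (W i w) a c (X a w).
Proof.
move=> a0 ac Ei.
have ge0 u : a <= u -> 0 <= u by exact: le_trans.
apply: refl_spec_uniq (wiener_reflP (beta i) (omega2 i) w (X a w) bmB a0 ac).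
apply: (@skorokhod_refl R (W i w) (X ^~ w) (L ^~ w)) => //.
- apply: within_continuousS => //.
  exact: (@wiener_continuous _ _ _ _ _ bmB (beta i) (omega2 i) w).
- by apply: within_continuousS => //; exact: (@aw_continuous _ _ _ _ _ _ _ _ _ _ _ _ _ _ aw w).
- by move=> u /andP[au _]; apply: (aw_ge0 aw); exact: ge0.
- move=> s u au su uc; rewrite (aw_increment aw (ge0 _ au) su (i := i)) /wiener; first by ring.
  by move=> r /andP[sr ru]; apply: Ei; rewrite (le_trans au sr) (lt_le_trans ru uc).
- by move=> s u au su uc; apply: (aw_regulator_nondecreasing aw) => //; exact: ge0.
- by move=> s u au su uc Xp; apply: (aw_regulator_flat aw) => //; exact: ge0.
Qed.

Lemma env_before w (u : R) : 0 <= u -> E 0 w = env1 -> u < S w -> E u w = env1.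
Proof. by move=> u0 Ew uS; apply/(env_path envP w u0). Qed.

Lemma env_after w (u : R) : 0 <= u -> E 0 w = env1 -> S w <= u -> E u w = env2.
Proof.
move=> u0 Ew Su; case Eu : (E u w) => //.
by have [_] := (env_path envP w u0).1 Eu; rewrite ltNge Su.
Qed.

Lemma env_never w (u : R) : 0 <= u -> E 0 w = env2 -> E u w = env2.
Proof.
move=> u0 Ew; case Eu : (E u w) => //.
by have [] := (env_path envP w u0).1 Eu; rewrite Ew.
Qed.

Local Notation Z i := (refl_end B (beta i) (omega2 i) 0 t (fun=> y)).

Lemma path_before w : E 0 w = env1 -> t < S w -> X t w = Z env1 w.
Proof.
move=> Ew tS; rewrite (@path_segment env1 w 0 t (lexx 0) (ltW t0)).
  by rewrite (aw_start aw) /refl_end add0r.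
by move=> u /andP[u0 ut]; apply: env_before => //; exact: lt_trans tS.
Qed.

Lemma path_never w : E 0 w = env2 -> X t w = Z env2 w.
Proof.
move=> Ew; rewrite (@path_segment env2 w 0 t (lexx 0) (ltW t0)).
  by rewrite (aw_start aw) /refl_end add0r.
by move=> u /andP[u0 ut]; exact: env_never.
Qed.

Lemma path_after w : E 0 w = env1 -> S w <= t -> X t w = Y (S w) w.
Proof.
move=> Ew St; have S0 := ltW (holding_time_gt0 envP Ew).
rewrite (@path_segment env2 w (S w) t S0 St); last first.
  by move=> u /andP[Su _]; apply: env_after => //; exact: le_trans Su.
rewrite (@path_segment env1 w 0 (S w) (lexx 0) S0); last first.
  by move=> u /andP[u0 uS]; exact: env_before.
by rewrite (aw_start aw).
Qed.

Let aZ i : adapted B setT (Z i).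
Proof. by apply: adaptedS (adapted_one_phase bmB (beta i) (omega2 i) t0 y0). Qed.

Let mZ i : measurable_fun setT (Z i).
Proof. exact: adapted_measurable (bm_measurable bmB) (aZ i). Qed.

Lemma joint_cdf_env1 x : 0 <= x -> joint_cdf P X E env1 t x =
  p * expR (- (eta * t)) * rcdf (beta env1) (omega2 env1) t x y.
Proof.
move=> x0; rewrite /joint_cdf.
rewrite (_ : [set w | _] = [set w | Z env1 w < x] `&` [set w | E 0 w = env1] `&`
    S @^-1` `]t, +oo[); last first.
  apply/seteqP; split => w /=; rewrite in_itv/= andbT.
    by move=> [+ /(env_path envP w (ltW t0))[Ew tS]]; rewrite path_before.
  by move=> [[Zw Ew] tS]; split; [rewrite path_before|exact: env_before (ltW t0) _ _].
rewrite (prob_env1_switch envP ind x (aZ env1))// exponential_prob_gt ?ltW//.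
rewrite (lcdf_fin P x (mZ env1)) (one_phase_law bmB (beta env1) (omega0 env1) t0 y0 x0).
by rewrite -!EFinM/=; ring.
Qed.

Let mE0 i : measurable [set w | E 0 w = i]. Proof. exact: (env_measurable envP). Qed.

Let mX : measurable_fun setT (X t). Proof. by apply: (aw_measurable aw); exact: ltW. Qed.

Let mSA (A : set R) : measurable A -> measurable (S @^-1` A).
Proof. by move=> mA; rewrite -[X in measurable X]setTI; exact: (env_holding_measurable envP). Qed.

Let prob_env2 : P [set w | E 0 w = env2] = (1 - p)%:E.
Proof.
rewrite EFinB -(env_initial envP) -probability_setC//; congr (P _).
by apply/seteqP; split => w /=; case: (E 0 w).
Qed.

Let prob_never x : 0 <= x -> P ([set w | Z env2 w < x] `&` [set w | E 0 w = env2]) =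
  ((1 - p) * rcdf (beta env2) (omega2 env2) t x y)%:E.
Proof.
move=> x0; have gZ : generated_by setT B [set w | Z env2 w < x].
  rewrite (_ : [set w | _] = Z env2 @^-1` `]-oo, x[); first exact: aZ.
  by apply/seteqP; split => w; rewrite /= in_itv.
have := ind env2 gZ (@measurableT _ R); rewrite preimage_setT setIT probability_setT mule1 => ->.
rewrite prob_env2 -[P [set w | _ < x]]/(lcdf P (Z env2) x) (lcdf_fin P x (mZ env2)).
by rewrite (one_phase_law bmB (beta env2) (omega0 env2) t0 y0 x0) -EFinM mulrC.
Qed.

Local Notation mix := (switch_mix P B eta (beta env1) (omega2 env1) (beta env2) (omega2 env2) t y).

(** The grid covers [[0, t[], so a switch exactly at [t] is split off as a null event. *)
Let prob_hit : P (S @^-1` [set t]) = 0%E.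
Proof. by rewrite (env_holding_law envP)// /exponential_prob integral_set1. Qed.

Lemma joint_cdf_env2 x : 0 <= x -> joint_cdf P X E env2 t x =
  (1 - p) * rcdf (beta env2) (omega2 env2) t x y + p * mix x.
Proof.
rewrite le_eqVlt => /predU1P[<-|x0].
  rewrite rcdf0 mulr0 /switch_mix /joint_cdf (_ : [set w | _] = set0); last first.
    apply/seteqP; split => w //= -[Xw _]; have := aw_ge0 aw w (ltW t0).
    by rewrite leNgt Xw.
  rewrite measure0 /Rintegral integral0_eq//= ?mulr0 ?addr0// => u.
  rewrite /= in_itv/= => /andP[u0 ut].
  by rewrite /switch_cdf (two_phase_lcdf0 bmB)// mulr0.
pose A1 := [set w | E 0 w = env1] `&` S @^-1` `[0, t[ `&` [set w | X t w < x].
pose A2 := [set w | Z env2 w < x] `&` [set w | E 0 w = env2].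
pose N := [set w | E 0 w = env1] `&` S @^-1` [set t] `&` [set w | X t w < x].
have mXx : measurable [set w | X t w < x] by exact: measurable_lt_set.
have mA1 : measurable A1.
  by apply: measurableI => //; apply: measurableI => //; exact: mSA.
have mN : measurable N.
  by apply: measurableI => //; apply: measurableI => //; exact: mSA.
have mA2 : measurable A2 by apply: measurableI => //; exact: measurable_lt_set.
have N0 : P N = 0%E.
  apply/eqP; rewrite eq_le measure_ge0 andbT -prob_hit.
  by apply: le_measure; rewrite ?inE//; [exact: mSA|move=> w [[]]].
rewrite /joint_cdf (_ : [set w | _] = A2 `|` (A1 `|` N)); last first.
  apply/seteqP; split => w /=.
    move=> [Xx E2]; case Ew : (E 0 w); last by left; split => //=; rewrite -path_never.
    right; have St : S w <= t.
      by rewrite leNgt; apply/negP => /(env_before (ltW t0) Ew); rewrite E2.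
    have S0 := ltW (holding_time_gt0 envP Ew).
    case: (ltgtP (S w) t) St => // [St _|St _]; [left|right]; split=> //; split=> //=.
    by rewrite in_itv/= S0.
  move=> [[Zx Ew]|[|]]; first by split; [rewrite path_never|exact: env_never (ltW t0) _].
  - move=> [[/= Ew]]; rewrite in_itv/= => /andP[_ St] Xx; split => //.
    by apply: env_after => //; exact: ltW.
  - by move=> [[/= Ew St] Xx]; split => //; apply: env_after; rewrite ?St// ltW.
have -> : P (A2 `|` (A1 `|` N)) = (P A2 + P A1)%E.
  rewrite -[P A1](measureU0 mA1 mN N0); apply: measureU => //; first exact: measurableU.
  by apply/seteqP; split => w //= -[[_ +]] [[[]]|[[]]] => /= ->.
rewrite [P A2]prob_never ?ltW// fineD//; last by rewrite fin_num_measure.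
congr (_ + _).
exact: (@prob_switch _ _ _ _ _ _ _ _ _ bmB envP ind eta0 _ _ _ _ (omega0 env2)
  t y t0 y0 (X t) mX path_after x x0).
Qed.

End alternating.

(** * Differentiation of the mixture *)

Section measurability.
Context d (Y : measurableType d) (R : realType).
Implicit Types (f g h : Y -> R).

Lemma measurable_inv : measurable_fun setT (fun x : R => x^-1).
Proof.
rewrite -(setvU [set (0 : R)]); apply/measurable_funU => //.
  exact: measurableC.
split; last exact: measurable_fun_set1.
apply: open_continuous_measurable_fun.
  by rewrite openC; exact: closed_eq.
by move=> x; rewrite inE/= => /eqP x0; exact: inv_continuous.
Qed.

Lemma measurable_funV f : measurable_fun setT f -> measurable_fun setT (fun w => (f w)^-1).
Proof. exact: (measurableT_comp measurable_inv). Qed.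

Lemma measurable_fun_sqrt f : measurable_fun setT f ->
  measurable_fun setT (fun w => Num.sqrt (f w)).
Proof.
by apply: measurableT_comp; apply: continuous_measurable_fun; exact: sqrt_continuous.
Qed.

Lemma measurable_fun_expR f : measurable_fun setT f ->
  measurable_fun setT (fun w => expR (f w)).
Proof. by move=> mf; apply: measurableT_comp mf; exact: measurable_expR. Qed.

Lemma measurable_fun_erfc f : measurable_fun setT f ->
  measurable_fun setT (fun w => erfc (f w)).
Proof. by move=> mf; apply: measurableT_comp mf; exact: measurable_erfc. Qed.

Variables b v : R.

Lemma measurable_fun_rcdf f g h : measurable_fun setT f -> measurable_fun setT g ->
  measurable_fun setT h -> measurable_fun setT (fun w => rcdf b v (f w) (g w) (h w)).
Proof.
move=> mf mg mh; rewrite /rcdf; apply: measurable_funM; last by [].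
have msq : measurable_fun setT (fun w => (Num.sqrt (2 * (v * f w)))^-1).
  by apply/measurable_funV/measurable_fun_sqrt; do 2 apply: measurable_funM => //.
have mbf : measurable_fun setT (fun w => b * f w) by exact: measurable_funM.
apply: measurable_funB.
  apply: measurable_fun_erfc; apply: measurable_funM => //.
  by apply: measurable_funD => //; exact: measurable_funB.
apply: measurable_funM.
  apply: measurable_fun_expR; apply: measurable_funM => //.
  exact: measurable_funM.
apply: measurable_fun_erfc; apply: measurable_funM => //.
by apply: measurable_funD => //; exact: measurable_funD.
Qed.

Lemma measurable_fun_rhat f g h : measurable_fun setT f -> measurable_fun setT g ->
  measurable_fun setT h -> measurable_fun setT (fun w => rhat b v (f w) (g w) (h w)).
Proof.
move=> mf mg mh; rewrite /rhat.
have mbg : measurable_fun setT (fun w => b * g w) by exact: measurable_funM.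
have mden : measurable_fun setT (fun w => (2 * v * g w)^-1).
  by apply: measurable_funV; exact: measurable_funM.
have mgauss (k : Y -> R) : measurable_fun setT k ->
    measurable_fun setT (fun w => expR (- ((k w - b * g w) ^+ 2 / (2 * v * g w)))).
  move=> mk; apply: measurable_fun_expR; apply: measurableT_comp => //.
  apply: measurable_funM => //; apply: measurable_funX.
  exact: measurable_funB.
apply: measurable_funB.
  apply: measurable_funM.
    by apply/measurable_funV/measurable_fun_sqrt; exact: measurable_funM.
  apply: measurable_funD; first by apply: mgauss; exact: measurable_funB.
  apply: measurable_funM; last by apply: mgauss; exact: measurable_funD.
  apply: measurable_fun_expR; apply: measurableT_comp => //.
  by apply: measurable_funM => //; exact: measurable_funM.
apply: measurable_funM.
  apply: measurable_funM => //; apply: measurable_fun_expR.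
  by apply: measurable_funM => //; exact: measurable_funM.
apply: measurable_fun_erfc; apply: measurable_funM.
  by apply: measurable_funD => //; exact: measurable_funD.
by apply/measurable_funV/measurable_fun_sqrt; exact: measurable_funM.
Qed.

End measurability.

(** Inner integrals given by Fubini are finite only almost everywhere; replacing them by [fine]
    yields iterated integrals of real functions. *)
Lemma integral_fine d (Y : measurableType d) (R : realType)
    (mu : {measure set Y -> \bar R}) (D : set Y) (F : Y -> \bar R) :
  measurable D -> mu.-integrable D F ->
  (\int[mu]_(x in D) F x = \int[mu]_(x in D) (fine (F x))%:E)%E.
Proof.
move=> mD iF; have mF := measurable_int mu iF.
apply: ae_eq_integral => //.
  by apply/measurable_EFinP; apply: measurableT_comp mF; exact: fine_measurable.
by move: (integrable_ae mD iF); apply: filterS => x /[apply] Fx; rewrite fineK.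
Qed.

Lemma integrable_fine d (Y : measurableType d) (R : realType)
    (mu : {measure set Y -> \bar R}) (D : set Y) (F : Y -> \bar R) :
  measurable D -> mu.-integrable D F -> mu.-integrable D (EFin \o (fine \o F)).
Proof.
move=> mD iF; have mF := measurable_int mu iF.
apply: (le_integrable mD _ _ iF).
  by apply/measurable_EFinP; apply: measurableT_comp mF; exact: fine_measurable.
by move=> x _ /=; case: (F x) => [r| |] //=; rewrite normr0 leey.
Qed.

(** * Iterated integrals over a rectangle *)

Section rectangle.
Context {R : realType}.
Local Notation leb := (@lebesgue_measure R).
Variables (A C : set R) (f : R * R -> R).
Hypothesis mA : measurable A.
Hypothesis mC : measurable C.

Let g : R * R -> \bar R := (EFin \o f) \_ (A `*` C).

Let gE z u : g (z, u) = (if z \in A then ((fun u => (f (z, u))%:E) \_ C) u else 0)%E.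
Proof. by rewrite /g !patchE in_setX; case: (z \in A). Qed.

Let gE' z u : g (z, u) = (if u \in C then ((fun z => (f (z, u))%:E) \_ A) z else 0)%E.
Proof. by rewrite /g !patchE in_setX; case: (z \in A); case: (u \in C). Qed.

Let inner z : (\int[leb]_u g (z, u) =
  ((fun z => \int[leb]_(u in C) (f (z, u))%:E) \_ A) z)%E.
Proof.
rewrite patchE; under eq_integral do rewrite gE.
by case: ifPn => _; [rewrite -integral_mkcond|rewrite integral0].
Qed.

Let inner' u : (\int[leb]_z g (z, u) =
  ((fun u => \int[leb]_(z in A) (f (z, u))%:E) \_ C) u)%E.
Proof.
rewrite patchE; under eq_integral do rewrite gE'.
by case: ifPn => _; [rewrite -integral_mkcond|rewrite integral0].
Qed.

Let mAC : measurable (A `*` C). Proof. exact: measurableX. Qed.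

Lemma integrable_rectangle : measurable_fun setT f ->
  (\int[leb]_(u in C) \int[leb]_(z in A) `|(f (z, u))%:E| < +oo)%E ->
  (leb \x leb)%E.-integrable (A `*` C) (EFin \o f).
Proof.
move=> mf fin.
have mg : measurable_fun setT g.
  by apply: (measurable_restrictT _ mAC).1; apply: measurable_funTS; apply/measurable_EFinP.
apply: (@integrable_mkcond _ _ R (leb \x leb)%E _ (EFin \o f) mAC).2.
apply/integrable21ltyP; first exact: mg.
apply: le_lt_trans fin; rewrite [leRHS]integral_mkcond le_eqVlt; apply/orP; left; apply/eqP.
apply: eq_integral => u _; rewrite [RHS]patchE.
transitivity (\int[leb]_z `|g (z, u)|)%E; [by []|under eq_integral do rewrite gE'].
case: ifPn => _; last by under eq_integral do rewrite abse0; rewrite integral0.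
rewrite [RHS]integral_mkcond; apply: eq_integral => z _; rewrite !patchE.
by case: ifPn => // _; rewrite abse0.
Qed.

Hypothesis intf : (leb \x leb)%E.-integrable (A `*` C) (EFin \o f).

Let intg : (leb \x leb)%E.-integrable setT g.
Proof. exact: (@integrable_mkcond _ _ R (leb \x leb)%E _ (EFin \o f) mAC).1. Qed.

Lemma integrable_rectangle_inner1 :
  leb.-integrable A (fun z => \int[leb]_(u in C) (f (z, u))%:E)%E.
Proof.
apply: (@integrable_mkcond _ _ R leb _ _ mA).2; have := integrable_fubini_F intg.
by apply: eq_integrable => // z _; rewrite /fubini_F inner.
Qed.

Lemma integrable_rectangle_inner2 :
  leb.-integrable C (fun u => \int[leb]_(z in A) (f (z, u))%:E)%E.
Proof.
apply: (@integrable_mkcond _ _ R leb _ _ mC).2.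
have mg := measurable_int _ intg; have mabs : measurable_fun setT (abse \o g).
  exact: measurableT_comp.
have mG := measurable_fubini_G intg.
suff : leb.-integrable setT (fubini_G leb g).
  by apply: eq_integrable => // z _; rewrite /fubini_G inner'.
apply/integrableP; split; first exact: mG.
apply: le_lt_trans ((integrable21ltyP _ _ mg).1 intg); apply: ge0_le_integral => //.
- exact: measurableT_comp.
- by apply: (@measurable_fun_fubini_tonelli_G _ _ _ _ R leb (abse \o g)) => // w; exact: abse_ge0.
- move=> u _; apply: le_abse_integral => //.
  exact: measurableT_comp.
Qed.

Lemma Rintegral_rectangle1 : \int[(leb \x leb)%E]_(w in A `*` C) f w =
  \int[leb]_(z in A) \int[leb]_(u in C) f (z, u).
Proof.
congr fine; rewrite -(@integral_fine _ _ R leb _ _ mA integrable_rectangle_inner1).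
rewrite integral_mkcond -(integral12_prod_meas1 intg) [RHS]integral_mkcond.
by apply: eq_integral => z _; rewrite /fubini_F inner.
Qed.

Lemma Rintegral_rectangle2 : \int[(leb \x leb)%E]_(w in A `*` C) f w =
  \int[leb]_(u in C) \int[leb]_(z in A) f (z, u).
Proof.
congr fine; rewrite -(@integral_fine _ _ R leb _ _ mC integrable_rectangle_inner2).
rewrite integral_mkcond -(integral21_prod_meas1 intg) [RHS]integral_mkcond.
by apply: eq_integral => z _; rewrite /fubini_G inner'.
Qed.

Lemma integrable_Rintegral_rectangle1 :
  leb.-integrable A (EFin \o (fun z => \int[leb]_(u in C) f (z, u))).
Proof. exact: (@integrable_fine _ _ R leb _ _ mA integrable_rectangle_inner1). Qed.

Lemma integrable_Rintegral_rectangle2 :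
  leb.-integrable C (EFin \o (fun u => \int[leb]_(z in A) f (z, u))).
Proof. exact: (@integrable_fine _ _ R leb _ _ mC integrable_rectangle_inner2). Qed.

End rectangle.

Local Notation leb := lebesgue_measure.

(** The singularity at [t] is approached through the increasing intervals [F n], on which
    [- (2 * Num.sqrt (t - u))] is a primitive. *)
Lemma integral_inv_sqrt_sub_le (R : realType) (t : R) : 0 < t ->
  (\int[leb]_(u in `]0%R, t[) ((Num.sqrt (t - u))^-1)%:E <=
   (2 * Num.sqrt t)%:E)%E.
Proof.
move=> t0; pose F (n : nat) : set R := `[0, t - t / n.+2%:R]%classic.
have Fn n : 0 < t - t / n.+2%:R by rewrite subr_gt0 ltr_pdivrMr// ltr_pMr// ltr1n.
have mf : measurable_fun setT (fun u : R => ((Num.sqrt (t - u))^-1)%:E).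
  apply/measurable_EFinP/measurable_funV/measurable_fun_sqrt.
  exact: measurable_funB.
have f0 (u : R) : (0 <= ((Num.sqrt (t - u))^-1)%:E)%E by rewrite lee_fin invr_ge0.
have ndF : {homo F : n m / (n <= m)%N >-> (n <= m)%O}.
  move=> n m nm; apply/subsetPset => u; rewrite /F /= !in_itv/= => /andP[-> /le_trans]; apply.
  by rewrite lerD2l lerN2 ler_pM2l// lef_pV2 ?posrE// ler_nat.
have mF n : measurable (F n) by exact: measurable_itv.
have H : (\int[leb]_(u in F n) ((Num.sqrt (t - u))^-1)%:E)%E @[n --> \oo] -->
    (\int[leb]_(u in \bigcup_n F n) ((Num.sqrt (t - u))^-1)%:E)%E.
  apply: ge0_nondecreasing_set_cvg_integral => // n; exact: measurable_funTS.
apply: (@le_trans _ _ (\int[leb]_(u in \bigcup_n F n) ((Num.sqrt (t - u))^-1)%:E)%E).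
  apply: ge0_subset_integral => //.
  - exact: bigcupT_measurable.
  - exact: measurable_funTS.
  move=> u /=; rewrite in_itv/= => /andP[u0 ut].
  have : \forall n \near \oo, t / (t - u) < n%:R by exact: nbhs_infty_gtr.
  case=> N _ /(_ N (leqnn N)) /=; rewrite ltr_pdivrMr ?subr_gt0// => HN.
  exists N => //; rewrite /F /= in_itv/= ltW//=.
  rewrite lerBrDr -lerBrDl ler_pdivrMr// mulrC (le_trans (ltW HN))//.
  by rewrite ler_pM2r ?subr_gt0// ler_nat !leqW.
rewrite -(cvg_lim _ H)//; apply: lime_le; first by apply/cvg_ex; eexists; exact: H.
apply: nearW => n.
have dF (u : R) : u < t ->
    is_derive u (1 : R) (fun u => - (2 * Num.sqrt (t - u))) (Num.sqrt (t - u))^-1.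
  move=> ut; have tu0 : 0 < t - u by rewrite subr_gt0.
  have d1 : is_derive u (1 : R) (fun u => t - u) (- 1).
    by have := is_deriveB (is_derive_cst t u (1 : R)) (is_derive_id u (1 : R)); rewrite sub0r.
  have d2 := is_deriveN (is_deriveZ (2 : R)
    (@is_derive1_comp _ (@Num.sqrt R) (fun u => t - u) u _ _ (is_derive1_sqrt tu0) d1)).
  apply: is_derive_eq d2 _; rewrite /GRing.scale/=.
  by field; rewrite gt_eqF// sqrtr_gt0.
have csqrt (u : R) : {for u, continuous (fun u => Num.sqrt (t - u))}.
  apply: (cvg_comp (fun u : R => t - u)); last exact: sqrt_continuous.
  by apply: cvgB; [exact: cvg_cst|exact: cvg_id].
have cF (u : R) : {for u, continuous (fun u => - (2 * Num.sqrt (t - u)))}.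
  by apply: cvgN; apply: cvgM; [exact: cvg_cst|exact: csqrt].
rewrite /F (@continuous_FTC2 _ _ (fun u => - (2 * Num.sqrt (t - u))))//.
- rewrite -EFinB lee_fin subr0 opprK gerDr oppr_le0.
  by rewrite mulr_ge0.
- apply: continuous_in_subspaceT => u; rewrite inE/= in_itv/= => /andP[_ ut].
  have tu0 : 0 < t - u by rewrite subr_gt0 (le_lt_trans ut)// ltrBlDr ltrDl divr_gt0.
  by apply: cvgV; [rewrite gt_eqF// sqrtr_gt0|exact: csqrt].
- split.
  + move=> u; rewrite in_itv/= => /andP[_ ut].
    have ut' : u < t by apply: lt_trans ut _; rewrite ltrBlDr ltrDl divr_gt0.
    by case: (dF u ut').
  + by apply: cvg_at_right_filter; exact: cF.
  + by apply: cvg_at_left_filter; exact: cF.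
- move=> u; rewrite in_itv/= => /andP[_ ut]; rewrite derive1E.
  have ut' : u < t by apply: lt_trans ut _; rewrite ltrBlDr ltrDl divr_gt0.
  by case: (dF u ut').
Qed.

Section switch_density.
Context d (T : measurableType d) (R : realType) (P : probability T R).
Variable B : R -> T -> R.
Hypothesis bmB : brownian_motion P B.
Variables eta b1 v1 b2 v2 : R.
Hypothesis eta0 : 0 < eta.
Hypothesis v10 : 0 < v1.
Hypothesis v20 : 0 < v2.
Variables (t y : R).
Hypothesis t0 : 0 < t.
Hypothesis y0 : 0 <= y.
Local Notation leb := (@lebesgue_measure R).

Let A : set R := `]0, +oo[%classic.
Let C : set R := `]0, t[%classic.

Let mA : measurable A. Proof. exact: measurable_itv. Qed.
Let mC : measurable C. Proof. exact: measurable_itv. Qed.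
Let mAC : measurable (A `*` C). Proof. exact: measurableX. Qed.

Let q (w : R * R) : R := rhat b1 v1 w.1 w.2 y * expR (- (eta * w.2)).

Let mq : measurable_fun setT q.
Proof.
apply: measurable_funM; first exact: measurable_fun_rhat.
apply: measurable_fun_expR; apply: measurableT_comp => //.
exact: measurable_funM.
Qed.

Let q_le z u : A z -> C u -> 0 <= q (z, u) <= rhat_pos b1 v1 u y z.
Proof.
rewrite /A /C /= !in_itv/= andbT => z0 /andP[u0 ut].
have r0 := rhat_ge0 bmB b1 v10 u0 y0 z0.
rewrite /q /rhat_pos patchE mem_set /=; last by rewrite in_itv/= z0.
rewrite mulr_ge0 ?expR_ge0//= ler_piMr// -expR0 ler_expR oppr_le0.
by rewrite mulr_ge0// ltW.
Qed.

(** For fixed [u], [q] lies below a density in [z] of mass at most [1], so a bound on [h] that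
    depends on [u] alone survives the integration in [z]. *)
Lemma integrable_switch_kernel (h : R * R -> R) (K : R -> R) :
  measurable_fun setT h -> measurable_fun setT K -> (forall u, 0 <= K u) ->
  (\int[leb]_(u in C) (K u)%:E < +oo)%E ->
  (forall z u, A z -> C u -> `|h (z, u)| <= K u) ->
  (leb \x leb)%E.-integrable (A `*` C) (EFin \o (fun w => q w * h w)).
Proof.
move=> mh mK K0 finK hK.
have mqh : measurable_fun setT (fun w => q w * h w) by exact: measurable_funM.
apply: integrable_rectangle => //; apply: le_lt_trans finK.
pose g : R * R -> \bar R := (fun w => `|(q w * h w)%:E|%E) \_ (A `*` setT).
have mg : measurable_fun setT g.
  apply: (measurable_restrictT _ _).1; first exact: measurableX.
  apply: measurable_funTS; apply: measurableT_comp => //.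
  exact/measurable_EFinP.
have gE u : (\int[leb]_(z in A) `|(q (z, u) * h (z, u))%:E| = \int[leb]_z g (z, u))%E.
  rewrite integral_mkcond; apply: eq_integral => z _; rewrite /g !patchE in_setX in_setT andbT.
  by [].
have g0 w : (0 <= g w)%E by rewrite /g patchE; case: ifPn.
apply: ge0_le_integral => //.
- by move=> u _; exact: integral_ge0.
- apply: (@eq_measurable_fun _ _ _ _ _ (fun u => \int[leb]_z g (z, u))%E).
    by move=> u _; rewrite gE.
  apply: measurable_funTS.
  exact: (@measurable_fun_fubini_tonelli_G _ _ _ _ R leb g mg g0).
- by apply: measurable_funTS; apply/measurable_EFinP.
move=> u Cu; have /andP[u0 ut] : 0 < u < t by move: Cu; rewrite /C /= in_itv.
have mr : measurable_fun setT (rhat_pos b1 v1 u y) by exact: measurable_rhat_pos.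
rewrite integral_mkcond.
apply: (@le_trans _ _ (\int[leb]_z ((rhat_pos b1 v1 u y z)%:E * (K u)%:E))%E).
  apply: ge0_le_integral => //.
  - by move=> z _; rewrite patchE; case: ifPn.
  - apply: (@eq_measurable_fun _ _ _ _ _ (fun z => g (z, u))).
      by move=> z _; rewrite /g !patchE in_setX in_setT andbT.
    exact: measurableT_comp.
  - apply: emeasurable_funM => //; exact/measurable_EFinP.
  move=> z _; rewrite patchE; case: ifPn => [/set_mem Az|_]; last first.
    rewrite -EFinM lee_fin mulr_ge0//; exact: (rhat_pos_ge0 bmB).
  have /andP[qz0 qz] := q_le Az Cu.
  by rewrite -EFinM abse_EFin lee_fin normrM (ger0_norm qz0) ler_pM// hK.
rewrite ge0_integralZr//; last first.
- by rewrite lee_fin.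
- by move=> z _; rewrite lee_fin; exact: (rhat_pos_ge0 bmB).
- exact/measurable_EFinP.
rewrite -[leRHS]mul1e lee_wpmul2r ?lee_fin//.
exact: (integral_rhat_pos_le1 bmB).
Qed.

(** The shape of [rhat_bound]; [c = 0] covers the bounded integrand [rcdf]. *)
Let K (c c' u : R) := c * (Num.sqrt (t - u))^-1 + c'.

Let K0 c c' u : 0 <= c -> 0 <= c' -> 0 <= K c c' u.
Proof. by move=> c0 c'0; rewrite addr_ge0// mulr_ge0// invr_ge0. Qed.

Let msqrt : measurable_fun setT (fun u : R => (Num.sqrt (t - u))^-1).
Proof. by apply/measurable_funV/measurable_fun_sqrt; exact: measurable_funB. Qed.

Let mK c c' : measurable_fun setT (K c c').
Proof. by apply: measurable_funD => //; exact: measurable_funM. Qed.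

Let finK c c' : 0 <= c -> 0 <= c' -> (\int[leb]_(u in C) (K c c' u)%:E < +oo)%E.
Proof.
move=> c0 c'0; rewrite /K; under eq_integral do rewrite EFinD EFinM.
have ms : measurable_fun C (fun u : R => ((Num.sqrt (t - u))^-1)%:E).
  by apply: measurable_funTS; apply/measurable_EFinP.
have s0 (u : R) : (0 <= ((Num.sqrt (t - u))^-1)%:E)%E by rewrite lee_fin invr_ge0.
rewrite ge0_integralD//; last 2 first.
- by move=> u _; rewrite mule_ge0// lee_fin.
- exact: emeasurable_funM.
rewrite ge0_integralZl// lte_add_pinfty//.
  apply: (@le_lt_trans _ _ (c%:E * (2 * Num.sqrt t)%:E)%E); last by rewrite -EFinM ltry.
  by rewrite lee_wpmul2l ?lee_fin//; exact: integral_inv_sqrt_sub_le.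
have lebC : leb C = t%:E by rewrite /C lebesgue_measure_itv/= lte_fin t0 -EFinB subr0.
by rewrite integral_cst// [X in (_ * X)%E]lebC -EFinM ltry.
Qed.

Let f (x : R) (w : R * R) := q w * rcdf b2 v2 (t - w.2) x w.1.

Let f' (x : R) (w : R * R) := q w * rhat b2 v2 x (t - w.2) w.1.

Let intf x : (leb \x leb)%E.-integrable (A `*` C) (EFin \o f x).
Proof.
have k0 : 0 <= 1 + expR (2 * `|b2| * `|x| / v2) by rewrite addr_ge0 ?expR_ge0.
apply: (@integrable_switch_kernel _ (K 0 (1 + expR (2 * `|b2| * `|x| / v2)))) => //.
- by apply: measurable_fun_rcdf => //; exact: measurable_funB.
- by move=> u; exact: K0.
- exact: finK.
- by move=> z u _ _; rewrite /K mul0r add0r; exact: rcdf_bound.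
Qed.

Let is_derive_f x w : C w.2 -> is_derive x (1 : R) (f ^~ w) (f' x w).
Proof.
rewrite /C /= in_itv/= => /andP[_ ut]; have tu0 : 0 < t - w.2 by rewrite subr_gt0.
exact: (is_deriveZ (q w) (is_derive_rcdf b2 v20 x w.1 tu0)).
Qed.

Let c1 M : R := (1 + expR (2 * `|b2| * M / v2)) / Num.sqrt (2 * pi * v2).
Let c2 M : R := 2 * `|b2| / v2 * expR (2 * `|b2| * M / v2).

Let c10 M : 0 <= c1 M. Proof. by rewrite divr_ge0 ?addr_ge0 ?expR_ge0. Qed.
Let c20 M : 0 <= c2 M.
Proof. by rewrite mulr_ge0 ?expR_ge0// divr_ge0 ?mulr_ge0// ltW. Qed.

Let f'_le x M z u : `|x| <= M -> C u -> `|rhat b2 v2 x (t - u) z| <= K (c1 M) (c2 M) u.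
Proof.
rewrite /C /= in_itv/= => xM /andP[_ ut]; have tu0 : 0 < t - u by rewrite subr_gt0.
exact: rhat_bound.
Qed.

Let intf' x : (leb \x leb)%E.-integrable (A `*` C) (EFin \o f' x).
Proof.
apply: (@integrable_switch_kernel _ (K (c1 `|x|) (c2 `|x|))) => //.
- by apply: measurable_fun_rhat => //; exact: measurable_funB.
- by move=> u; exact: K0.
- exact: finK.
- by move=> z u _ Cu; exact: f'_le.
Qed.

(** The absolute value makes the dominating function nonnegative on the whole plane; [q] has a known
    sign only on the rectangle. *)
Let G M (w : R * R) := `|q w * K (c1 M) (c2 M) w.2|.

Let intG M : (leb \x leb)%E.-integrable (A `*` C) (EFin \o G M).
Proof.
have mKs : measurable_fun setT (fun w : R * R => K (c1 M) (c2 M) w.2).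
  exact: (measurableT_comp (mK _ _)).
suff : (leb \x leb)%E.-integrable (A `*` C) (EFin \o (fun w => q w * K (c1 M) (c2 M) w.2)).
  by move/integrable_abse.
apply: (@integrable_switch_kernel _ (K (c1 M) (c2 M))) => //.
- by move=> u; exact: K0.
- exact: finK.
- by move=> z u _ _; rewrite ger0_norm// K0.
Qed.

(** A two-sided derivative at every real [x], boundary included, because [f] extends by its formula
    to [x < 0]. The domination is over [a] within [1] of [x]. *)
Let cvg_f (x : R) :
  h^-1 *: (\int[(leb \x leb)%E]_(w in A `*` C) f (h + x) w
           - \int[(leb \x leb)%E]_(w in A `*` C) f x w) @[h --> 0^'] -->
  \int[(leb \x leb)%E]_(w in A `*` C) f' x w.
Proof.
have d1 a w : C w.2 -> partial1of2 f a w = f' a w.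
  by move=> Cw; rewrite partial1of2E; case: (is_derive_f a Cw).
have -> : \int[(leb \x leb)%E]_(w in A `*` C) f' x w =
    \int[(leb \x leb)%E]_(w in A `*` C) partial1of2 f x w.
  by apply: eq_Rintegral => w /set_mem[_ Cw]; rewrite d1.
have Ix : `]x - 1, x + 1[%classic x by rewrite /= in_itv/= ltrBlDr ltrDl ltr01.
apply: (@cvg_differentiation_under_integral _ _ _ (leb \x leb)%E f _ mAC x _ _ Ix _ _
  (G (`|x| + 1))).
- by move=> a _; exact: intf.
- by move=> a w _ [_ Cw]; case: (is_derive_f a Cw).
- by move=> w; exact: normr_ge0.
- exact: intG.
- move=> a w; rewrite /= in_itv/= => /andP[xa ax] [_ Cw]; rewrite d1// /f' /G !normrM.
  apply: ler_wpM2l => //; rewrite [leRHS]ger0_norm ?K0//; apply: f'_le => //.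
  rewrite -[a](subrK x) addrC (le_trans (ler_normD _ _))// lerD2l ler_norml; lra.
Qed.

Lemma switch_mixE x : 0 <= x -> switch_mix P B eta b1 v1 b2 v2 t y x =
  eta * \int[(leb \x leb)%E]_(w in A `*` C) f x w.
Proof.
move=> x0; rewrite (Rintegral_rectangle2 mA mC (intf x)).
rewrite -RintegralZl//; last exact: (integrable_Rintegral_rectangle2 mA mC (intf x)).
apply: eq_Rintegral => u /set_mem Cu.
have /andP[u0 ut] : 0 < u < t by move: Cu; rewrite /C /= in_itv.
rewrite (exponential_pdfE _ (ltW u0)) /switch_cdf (two_phase_law bmB b1 b2 v10 v20 y0 u0 ut x0).
rewrite -[_ * expR _ * _]mulrA; congr (_ * _).
rewrite [in RHS]Rintegral_mkcond.
have mT := @measurableT _ R.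
have ir : leb.-integrable setT (EFin \o (fun z => rhat_pos b1 v1 u y z * rcdf b2 v2 (t - u) x z)).
  have ip := integrable_rhat_pos bmB b1 v10 u0 y0.
  have ikp := @integrableZl _ _ R leb _ mT (1 + expR (2 * `|b2| * `|x| / v2)) _ ip.
  apply: (le_integrable _ _ _ ikp) => //.
    apply/measurable_EFinP; apply: measurable_funM; first exact: measurable_rhat_pos.
    exact: measurable_fun_rcdf.
  move=> z _ /=; have := rcdf_bound b2 v20 (t - u) z (lexx `|x|).
  move: (rcdf _ _ _ _ _) (rhat_pos _ _ _ _ _) => r r1 rk.
  rewrite lee_fin !normrM mulrC ler_wpM2r//.
  by rewrite [leRHS]ger0_norm// addr_ge0// expR_ge0.
rewrite -RintegralZl//; apply: eq_Rintegral => z _.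
rewrite /rhat_pos !patchE mulNr; case: ifPn => _; last by rewrite mul0r mulr0.
by rewrite /f /q /= mulrA [_ * expR _]mulrC mulrA.
Qed.

(** [switch_mixE] is available for nonnegative arguments only, which is all that the one-sided
    filter sees; on it the two-sided limit restricts to the claim. *)
Lemma switch_mix_density x : 0 <= x ->
  has_density_at (switch_mix P B eta b1 v1 b2 v2 t y) x
    (eta * \int[leb]_(z in `[0, +oo[) \int[leb]_(tau in `]0, t[)
       (rhat b1 v1 z tau y * expR (- (eta * tau)) * rhat b2 v2 x (t - tau) z)).
Proof.
move=> x0; rewrite /has_density_at.
rewrite -(Rintegral_itv_obnd_cbnd (integrable_Rintegral_rectangle1 mA mC (intf' x))).
rewrite -(Rintegral_rectangle1 mA mC (intf' x)).
apply: (@cvg_trans _ ((fun h => eta * (h^-1 *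
    (\int[(leb \x leb)%E]_(w in A `*` C) f (h + x) w
     - \int[(leb \x leb)%E]_(w in A `*` C) f x w))) @ within [set h | 0 <= x + h] 0^')).
  apply: near_eq_cvg; near=> h.
  have xh : 0 <= x + h by near: h; exact: withinT.
  by rewrite (switch_mixE xh) (switch_mixE x0) -mulrBr [x + h]addrC mulrCA.
apply: cvgM; first exact: cvg_cst.
by apply: cvg_within_filter; exact: (@cvg_f x).
Unshelve. all: by end_near. Qed.

End switch_density.

(** * Calculus of densities on the half-line *)

Section density_rules.
Context {R : realType}.
Implicit Types (F G : R -> R) (x a b c : R).

Lemma eq_has_density_at F G x a : 0 <= x -> (forall z, 0 <= z -> F z = G z) ->
  has_density_at G x a -> has_density_at F x a.
Proof.
move=> x0 FG; apply: cvg_trans; apply: near_eq_cvg; near=> h.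
have xh : 0 <= x + h by near: h; exact: withinT.
by rewrite !FG.
Unshelve. all: by end_near. Qed.

Lemma has_density_atD F G x a b : has_density_at F x a -> has_density_at G x b ->
  has_density_at (fun z => F z + G z) x (a + b).
Proof.
move=> dF dG; rewrite /has_density_at.
rewrite (_ : (fun h => _) = (fun h => h^-1 * (F (x + h) - F x)) \+
    (fun h => h^-1 * (G (x + h) - G x))); first exact: cvgD.
by apply/funext => h; rewrite /= -mulrDr opprD addrACA.
Qed.

Lemma has_density_atZ F x a c : has_density_at F x a ->
  has_density_at (fun z => c * F z) x (c * a).
Proof.
move=> dF; rewrite /has_density_at.
rewrite (_ : (fun h => _) = (fun h => c * (h^-1 * (F (x + h) - F x)))).
  by apply: cvgM; [exact: cvg_cst|exact: dF].
by apply/funext => h; rewrite -mulrBr mulrCA.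
Qed.

Lemma is_derive_has_density_at F x a : is_derive x (1 : R) F a -> has_density_at F x a.
Proof.
move=> [dF <-]; apply: cvg_within_filter; move: dF => /cvgP; rewrite -/(derive F x 1).
apply: cvg_trans; apply: near_eq_cvg; apply: nearW => h.
by rewrite /= /GRing.scale/= mulr1 [h + x]addrC.
Qed.

End density_rules.

Theorem proposition7 (d : measure_display) (T : measurableType d)
    (R : realType) (P : probability T R)
    (lambda mu omega2 : env -> R) (eta1 p y : R)
    (B : R -> T -> R) (S : T -> R) (L : R -> T -> R)
    (X : R -> T -> R) (E : R -> T -> env) :
  (forall i, 0 < lambda i) -> (forall i, 0 < mu i) ->
  (forall i, 0 < omega2 i) -> 0 < eta1 -> 0 <= p <= 1 -> 0 <= y ->
  alternating_wiener P (fun i => lambda i - mu i) omega2 eta1 p y B S L X E ->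
  let r := fun i x t z => rhat (lambda i - mu i) (omega2 i) x t z in
  forall t x : R, 0 < t -> 0 <= x ->
    has_density_at (joint_cdf P X E env1 t) x
      (p * expR (- (eta1 * t)) * r env1 x t y)
    /\
    has_density_at (joint_cdf P X E env2 t) x
      ((1 - p) * r env2 x t y
       + p * eta1 *
         \int[lebesgue_measure]_(z in `[0, +oo[)
           \int[lebesgue_measure]_(tau in `]0, t[)
             (r env1 z tau y * expR (- (eta1 * tau)) * r env2 x (t - tau) z)).
Proof.
move=> _ _ omega0 eta0 _ y0 aw r t x t0 x0; have bmB := aw_brownian aw.
split.
  apply: (eq_has_density_at x0 (joint_cdf_env1 aw omega0 eta0 y0 t0)).
  apply: has_density_atZ; apply: is_derive_has_density_at.
  exact: is_derive_rcdf.
apply: (eq_has_density_at x0 (joint_cdf_env2 aw omega0 eta0 y0 t0)).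
have never := is_derive_has_density_at
  (is_derive_rcdf (lambda env2 - mu env2) (omega0 env2) x y t0).
have switch := @switch_mix_density _ _ _ P B bmB eta1 (lambda env1 - mu env1) (omega2 env1)
  (lambda env2 - mu env2) (omega2 env2) eta0 (omega0 env1) (omega0 env2) t y t0 y0 x x0.
rewrite -mulrA.
exact: (@has_density_atD _ _ _ _ _ _ (@has_density_atZ _ _ _ _ (1 - p) never)
  (@has_density_atZ _ _ _ _ p switch)).
Qed.
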